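(* The Nichols algebra $\mathcal{B}(\mathtt{HV}_1)$ is presented by generators $x_1,x_2,x_3,x_4$ and relations \begin{align*} & x_i^2=0, \quad i\in\{1,2,3\};\\ & x_1x_2+x_3x_1+x_2x_3=0, \qquad x_2x_1+x_1x_3+x_3x_2=0;\\ & x_4^6=0;\\ & (x_{124}x_{134}+\omega^2x_{134}x_{124})^3=0;\\ & x_{i14}-\omega\, x_{1(2-i)4}=0,\quad i\in\{2,3\};\\ & x_4x_{h4}-q_2x_{h4}x_4=0,\quad h\in\{1,2,3\}. \end{align*} Let $\mathcal{G}\subset T(\mathtt{HV}_1)$ be the set of the left-hand sides of these relations, which generates the defining ideal $\mathcal{J}(\mathtt{HV}_1)$. Then $\mathcal{G}$ is minimal, i.e. for every $r\in\mathcal{G}$ the ideal generated by $\mathcal{G}\setminus\{r\}$ is strictly smaller than $\mathcal{J}(\mathtt{HV}_1)$. Moreover, with $x_{124134}:=x_{124}x_{134}+\omega^2x_{134}x_{124}$, the set of all products $$x_4^{n_4}\; u\; x_{124}^{n_{124}}\,x_{124134}^{n_{124134}}\,x_{134}^{n_{134}}\; v$$ is a basis of $\mathcal{B}(\mathtt{HV}_1)$, where $0\le n_4<6$, $0\le n_{124},n_{134}<2$, $0\le n_{124134}<3$, the factor $u$ is either $x_{14}^{n_{14}}x_{24}^{n_{24}}x_{34}^{n_{34}}$ or $x_{14}^{n_{14}}x_{24}x_{14}x_{34}^{n_{34}}$, the factor $v$ is either $x_1^{n_1}x_2^{n_2}x_3^{n_3}$ or $x_1^{n_1}x_2x_1x_3^{n_3}$,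 and $0\le n_{14},n_{24},n_{34},n_1,n_2,n_3<2$.
   Context: $\Bbbk$ is an algebraically closed field of characteristic zero. Indices in $\{1,2,3\}$ obtained by arithmetic (such as $2i-j$, $2-i$) are read modulo 3 with representatives $1,2,3$. Fix $q_1,q_2\in\Bbbk^\times$ such that $\omega:=-q_1q_2$ is a primitive cube root of unity. $\mathtt{HV}_1=V_1\oplus V_2$ is the braided vector space with basis $x_1,x_2,x_3$ (of $V_1$) and $x_4$ (of $V_2$) and braiding $c(x_i\otimes x_j)=-x_{2i-j}\otimes x_i$, $c(x_i\otimes x_4)=q_1x_4\otimes x_i$, $c(x_4\otimes x_i)=q_2x_i\otimes x_4$, $c(x_4\otimes x_4)=-\omega^2x_4\otimes x_4$, for $i,j\in\{1,2,3\}$. The Nichols algebra of a (realizable) braided vector space $V$ is $\mathcal{B}(V)=T(V)/\mathcal{J}(V)$, where $\mathcal{J}(V)$ is the largest graded (categorical) Hopf ideal of $T(V)$ concentrated in degrees $\ge 2$; equivalently $\mathcal{B}(V)$ is the graded braided Hopf algebra quotient of $T(V)$ whose space of primitive elements is $V$. Notation: $x_{h4}=x_hx_4-q_1x_4x_h$ and $x_{ij4}=x_ix_{j4}+q_1x_{(2i-j)4}x_i$ for $h,i,j\in\{1,2,3\}$. *)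

(* Defs.v *)
From HB Require Import structures.
From mathcomp Require Import all_boot all_order all_algebra.
From mathcomp Require Import generic_quotient ring_quotient.
From mathcomp Require Import finmap.
From mathcomp Require Import boolp classical_sets.
From mathcomp Require Import monalg.

Set Implicit Arguments.
Unset Strict Implicit.
Unset Printing Implicit Defensive.

Import GRing.Theory.
Local Open Scope ring_scope.
Local Open Scope classical_set_scope.

Section Ideals.
Variable R : nzRingType.

Definition two_sided_ideal (J : set R) : Prop :=
  [/\ J 0, forall x y, J x -> J y -> J (x + y)
    & forall a x b, J x -> J (a * x * b)].

Definition ideal_gen (P : set R) : set R :=
  [set x | forall J, two_sided_ideal J -> P `<=` J -> J x].

End Ideals.

Definition is_basis (k : fieldType) (V : lmodType k) (X : finType) (b : X -> V)
    : Prop :=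
  (forall a : X -> k, \sum_j a j *: b j = 0 -> forall j, a j = 0) /\
  (forall v : V, exists a : X -> k, v = \sum_j a j *: b j).

Lemma scale_malgU (k : fieldType) (X : choiceType) (c d : k) (m : X) :
  c *: << d *g m >> = << c * d *g m >> :> {malg k[X]}.
Proof. by apply/malgP => m'; rewrite mcoeffZ !mcoeffU mulrnAr. Qed.

Section LinearExtension.
Variables (k : fieldType) (X : choiceType) (M : lmodType k).

Definition linext (f : X -> M) (t : {malg k[X]}) : M :=
  \sum_(m <- msupp t) t@_m *: f m.

Lemma linextEw (f : X -> M) (t : {malg k[X]}) (d : {fset X}) :
  (msupp t `<=` d)%fset -> linext f t = \sum_(m <- d) t@_m *: f m.
Proof.
move=> le_d; rewrite /linext; apply: big_fset_incl => // m _ /mcoeff_outdom ->.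
by rewrite scale0r.
Qed.

Lemma linextD (f : X -> M) : {morph linext f : s t / s + t}.
Proof.
move=> s t; rewrite (linextEw f (d := (msupp s `|` msupp t)%fset) (msuppD_le s t)).
rewrite (linextEw f (fsubsetUl (msupp s) (msupp t))).
rewrite (linextEw f (fsubsetUr (msupp s) (msupp t))) -big_split /=.
by apply: eq_bigr => m _; rewrite mcoeffD scalerDl.
Qed.

Lemma linext0 (f : X -> M) : linext f 0 = 0.
Proof. by rewrite /linext msupp0 big_seq_fset0. Qed.

End LinearExtension.

(* V is the braided vector space with basis (x_i)_(i : I) and braiding
   c(x_i (x) x_j) = q i j *: x_(act i j) (x) x_i.  T(V) is the algebra of the
   free monoid {fmonom I} of words, and the space T(V) (x) T(V), with basis the
   pure tensors of two words, is the space of finitely supported functions on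
   pairs of words. *)
Section NicholsAlgebra.
Variables (k : fieldType) (I : finType).
Variables (act : I -> I -> I) (q : I -> I -> k).

Local Notation W := {fmonom I}.
Local Notation T := {malg k[W]}.
Local Notation TT := {malg k[(W * W)%type]}.

Definition gen (i : I) : T := << fmu i >>.

Definition tensor (s t : T) : TT :=
  \sum_(u <- msupp s) \sum_(v <- msupp t) << s@_u * t@_v *g (u, v) >>.

(* The braiding of T(V) is the one extending c compatibly with products:
   c(u (x) v) = (u . v) (x) u for words u = x_i1 ... x_in and v, where
   u . v = g_i1(... g_in(v)) and g_i is the algebra endomorphism of T(V) with
   g_i(x_j) = q i j *: x_(act i j).  Thus u . x_j is the scalar [letter_q u j]
   times the letter [letter_act u j]. *)
Fixpoint letter_act (u : seq I) (j : I) : I :=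
  if u is i :: u' then act i (letter_act u' j) else j.

Fixpoint letter_q (u : seq I) (j : I) : k :=
  if u is i :: u' then q i (letter_act u' j) * letter_q u' j else 1.

Definition word_act (u v : W) : W := FMonom [seq letter_act u j | j <- v].

Definition word_q (u v : W) : k := \prod_(j <- (v : seq I)) letter_q u j.

Definition braiding : TT -> TT :=
  linext (fun p : (W * W)%type => << word_q p.1 p.2 *g (word_act p.1 p.2, p.1) >>).

Definition mult : TT -> T := linext (fun p : (W * W)%type => << mmul p.1 p.2 >>).

(* The product of the braided tensor square: (p1 (x) p2) (r1 (x) r2) is obtained
   from p1 (x) c(p2 (x) r1) (x) r2 by multiplying the first two and the last two
   factors. *)
Definition braided_mul (s t : TT) : TT :=
  linext (fun p : (W * W)%type => linext (fun r : (W * W)%type =>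
    << word_q p.2 r.1 *g (mmul p.1 (word_act p.2 r.1), mmul p.2 r.2) >>) t) s.

Definition comul : T -> TT :=
  linext (fun w : W =>
    foldr (fun i => braided_mul (tensor (gen i) 1 + tensor 1 (gen i)))
          (tensor 1 1) w).

Definition counit (x : T) : k := x@_(mone : W).

(* S(x y) = mult (c (S x (x) S y)) and S x_i = - x_i. *)
Definition antipode : T -> T :=
  linext (fun w : W =>
    foldr (fun i s => mult (braiding (tensor (- gen i) s))) 1 w).

Definition homog (n : nat) (x : T) : T :=
  \sum_(m <- msupp x | fdeg m == n) << x@_m *g m >>.

Definition tensor_sub (A B : set T) : set TT :=
  [set t | exists2 s : seq (T * T),
     (forall p, p \in s -> A p.1 /\ B p.2) & t = \sum_(p <- s) tensor p.1 p.2].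

(* J is a Hopf ideal in the braided category: besides the usual conditions,
   J is a categorical subspace, i.e. compatible with the braiding. *)
Record hopf_ideal (J : set T) : Prop := HopfIdeal {
  hopf_ideal_ideal : two_sided_ideal J;
  hopf_ideal_comul : forall x, J x ->
    exists s t, [/\ tensor_sub J setT s, tensor_sub setT J t & comul x = s + t];
  hopf_ideal_counit : forall x, J x -> counit x = 0;
  hopf_ideal_antipode : forall x, J x -> J (antipode x);
  hopf_ideal_braidingl :
    braiding @` tensor_sub J setT = tensor_sub setT J;
  hopf_ideal_braidingr :
    braiding @` tensor_sub setT J = tensor_sub J setT
}.

Record nichols_admissible (J : set T) : Prop := NicholsAdmissible {
  nichols_admissible_hopf : hopf_ideal J;
  nichols_admissible_graded : forall n x, J x -> J (homog n x);
  nichols_admissible_deg : forall x, J x ->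
    forall m, m \in msupp x -> (2 <= fdeg m)%N
}.

(* The union of the admissible ideals; by [nichols_ideal_admissible] below it
   is itself admissible, hence the largest admissible ideal. *)
Definition nichols_ideal : set T :=
  [set x | exists2 J, nichols_admissible J & J x].

Lemma nichols_ideal_max (J : set T) :
  nichols_admissible J -> J `<=` nichols_ideal.
Proof. by move=> adm x Jx; exists J. Qed.

Lemma tensor_sub0 (A B : set T) : tensor_sub A B 0.
Proof. by exists [::]; rewrite ?big_nil. Qed.

Lemma tensor_subD (A B : set T) s t :
  tensor_sub A B s -> tensor_sub A B t -> tensor_sub A B (s + t).
Proof.
move=> [ls hs ->] [lt ht ->]; exists (ls ++ lt); last by rewrite big_cat.
by move=> p; rewrite mem_cat => /orP[/hs|/ht].
Qed.

Lemma tensor_subS (A A' B B' : set T) :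
  A `<=` A' -> B `<=` B' -> tensor_sub A B `<=` tensor_sub A' B'.
Proof.
by move=> sA sB t [s hs ->]; exists s => // p /hs [/sA ? /sB].
Qed.

Lemma tensorE (s t : T) :
  tensor s t = linext (fun u => linext (fun v => << (u, v) >> : TT) t) s.
Proof.
apply: eq_bigr => u _; rewrite /linext scaler_sumr; apply: eq_bigr => v _.
by rewrite scalerA scale_malgU mulr1.
Qed.

Lemma tensorDl (s s' t : T) : tensor (s + s') t = tensor s t + tensor s' t.
Proof. by rewrite !tensorE linextD. Qed.

Lemma tensorDr (s t t' : T) : tensor s (t + t') = tensor s t + tensor s t'.
Proof.
rewrite !tensorE /linext -big_split /=; apply: eq_bigr => u _.
by rewrite -scalerDr -linextD.
Qed.

Lemma homogD n : {morph homog n : x y / x + y}.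
Proof.
have E x : homog n x =
    linext (fun m : W => if fdeg m == n then << m >> else 0 : T) x.
  rewrite /homog big_mkcond; apply: eq_bigr => m _.
  case: (fdeg m == n); first by rewrite scale_malgU mulr1.
  exact/esym/scaler0.
by move=> x y; rewrite !E linextD.
Qed.

Section Sum.
Variables J K : set T.
Let JK : set T := [set x + y | x in J & y in K].

Lemma tensor_sub_suml : J 0 -> K 0 ->
  tensor_sub JK setT =
  [set s + t | s in tensor_sub J setT & t in tensor_sub K setT].
Proof.
move=> J0 K0; apply/seteqP; split=> [_ [s hs ->]|_ [s Js [t Kt <-]]].
  elim: s hs => [_|p s IHs hs].
    rewrite big_nil; exists 0; first exact: tensor_sub0.
    by exists 0; [exact: tensor_sub0|rewrite addr0].
  have [[x Jx [y Ky xy]] _] := hs p (mem_head _ _).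
  have [|s1 h1 [s2 h2 e]] := IHs.
    by move=> r rs; apply: hs; rewrite inE rs orbT.
  rewrite big_cons -e -xy tensorDl.
  exists (tensor x p.2 + s1).
    apply: tensor_subD => //; exists [:: (x, p.2)]; last by rewrite big_seq1.
    by move=> r; rewrite inE => /eqP ->.
  exists (tensor y p.2 + s2); last by rewrite addrACA.
  apply: tensor_subD => //; exists [:: (y, p.2)]; last by rewrite big_seq1.
  by move=> r; rewrite inE => /eqP ->.
apply: tensor_subD.
  apply: tensor_subS Js => // x Jx.
  by exists x => //; exists 0 => //; rewrite addr0.
apply: tensor_subS Kt => // x Kx.
by exists 0 => //; exists x => //; rewrite add0r.
Qed.

Lemma tensor_sub_sumr : J 0 -> K 0 ->
  tensor_sub setT JK =
  [set s + t | s in tensor_sub setT J & t in tensor_sub setT K].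
Proof.
move=> J0 K0; apply/seteqP; split=> [_ [s hs ->]|_ [s Js [t Kt <-]]].
  elim: s hs => [_|p s IHs hs].
    rewrite big_nil; exists 0; first exact: tensor_sub0.
    by exists 0; [exact: tensor_sub0|rewrite addr0].
  have [_ [x Jx [y Ky xy]]] := hs p (mem_head _ _).
  have [|s1 h1 [s2 h2 e]] := IHs.
    by move=> r rs; apply: hs; rewrite inE rs orbT.
  rewrite big_cons -e -xy tensorDr.
  exists (tensor p.1 x + s1).
    apply: tensor_subD => //; exists [:: (p.1, x)]; last by rewrite big_seq1.
    by move=> r; rewrite inE => /eqP ->.
  exists (tensor p.1 y + s2); last by rewrite addrACA.
  apply: tensor_subD => //; exists [:: (p.1, y)]; last by rewrite big_seq1.
  by move=> r; rewrite inE => /eqP ->.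
apply: tensor_subD.
  apply: tensor_subS Js => // x Jx.
  by exists x => //; exists 0 => //; rewrite addr0.
apply: tensor_subS Kt => // x Kx.
by exists 0 => //; exists x => //; rewrite add0r.
Qed.

Lemma image_sum (f : TT -> TT) (A B : set TT) : {morph f : s t / s + t} ->
  f @` [set s + t | s in A & t in B] = [set s + t | s in f @` A & t in f @` B].
Proof.
move=> fD; apply/seteqP; split.
  move=> _ [_ [s As [t Bt <-]] <-]; rewrite fD.
  by exists (f s); [exists s|exists (f t) => //; exists t].
move=> _ [_ [s As <-] [_ [t Bt <-] <-]]; rewrite -fD.
by exists (s + t) => //; exists s => //; exists t.
Qed.

Lemma nichols_admissible_sum :
  nichols_admissible J -> nichols_admissible K -> nichols_admissible JK.
Proof.
case=> -[[J0 JD JM] Jc Je JS Jl Jr] Jg Jd.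
case=> -[[K0 KD KM] Kc Ke KS Kl Kr] Kg Kd.
have JJK : J `<=` JK by move=> x; exists x => //; exists 0 => //; rewrite addr0.
have KJK : K `<=` JK by move=> x; exists 0 => //; exists x => //; rewrite add0r.
split; first split.
- split; first exact: JJK.
    move=> _ _ [x Jx [y Ky <-]] [x' Jx' [y' Ky' <-]].
    exists (x + x'); first exact: JD.
    by exists (y + y'); [exact: KD|rewrite addrACA].
  move=> a _ b [x Jx [y Ky <-]]; rewrite mulrDr mulrDl.
  by exists (a * x * b); [exact: JM|exists (a * y * b) => //; exact: KM].
- move=> _ [x Jx [y Ky <-]].
  have [s [t [hs ht ex]]] := Jc x Jx; have [s' [t' [hs' ht' ey]]] := Kc y Ky.
  exists (s + s'), (t + t'); split.
  + by apply: tensor_subD; [apply: tensor_subS hs|apply: tensor_subS hs'].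
  + by apply: tensor_subD; [apply: tensor_subS ht|apply: tensor_subS ht'].
  + by rewrite [LHS]linextD -!/(comul _) ex ey addrACA.
- move=> _ [x Jx [y Ky <-]]; rewrite /counit mcoeffD.
  by rewrite -!/(counit _) Je // Ke // addr0.
- move=> _ [x Jx [y Ky <-]]; rewrite [antipode _]linextD -!/(antipode _).
  by exists (antipode x); [exact: JS|exists (antipode y) => //; exact: KS].
- by rewrite tensor_sub_suml // tensor_sub_sumr // image_sum ?Jl ?Kl //;
    exact: linextD.
- by rewrite tensor_sub_suml // tensor_sub_sumr // image_sum ?Jr ?Kr //;
    exact: linextD.
- move=> n _ [x Jx [y Ky <-]]; rewrite homogD.
  by exists (homog n x); [exact: Jg|exists (homog n y) => //; exact: Kg].
- move=> _ [x Jx [y Ky <-]] m /(fsubsetP (msuppD_le x y)).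
  by rewrite in_fsetU => /orP[/(Jd x Jx)|/(Kd y Ky)].
Qed.

End Sum.

Lemma image_tensor_sub0 (f : TT -> TT) (A B : set T) : f 0 = 0 ->
    A = [set 0] \/ B = [set 0] -> f @` tensor_sub A B = [set 0].
Proof.
move=> f0 AB; have tAB : tensor_sub A B = [set 0].
  apply/seteqP; split=> [_ [s hs ->]|_ ->]; last exact: tensor_sub0.
  rewrite big_seq big1 // => p /hs[]; case: AB => -> => [-> _|_ ->].
    by rewrite /tensor msupp0 big_seq_fset0.
  by rewrite /tensor msupp0 big1 // => u _; rewrite big_seq_fset0.
by rewrite tAB image_set1 f0.
Qed.

Lemma nichols_admissible0 : nichols_admissible [set 0].
Proof.
have E1 : tensor_sub [set 0] setT = [set 0].
  by rewrite -[LHS]image_id (@image_tensor_sub0 id) //; left.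
have E2 : tensor_sub setT [set 0] = [set 0].
  by rewrite -[LHS]image_id (@image_tensor_sub0 id) //; right.
split; first split.
- by split=> [|x y -> ->|a x b ->]; rewrite /= ?addr0 ?mulr0 ?mul0r.
- move=> x ->; exists 0, 0; rewrite E1 E2; split=> //.
  by rewrite [LHS]linext0 addr0.
- by move=> x ->; rewrite /counit mcoeff0.
- by move=> x ->; rewrite /antipode linext0.
- by rewrite E2; apply: image_tensor_sub0; [exact: linext0|left].
- by rewrite E1; apply: image_tensor_sub0; [exact: linext0|right].
- by move=> n x ->; rewrite /homog big_mkcond msupp0 big_seq_fset0.
- by move=> x -> m; rewrite msupp0.
Qed.

Local Notation J := nichols_ideal.

Lemma nichols_ideal_seq (f : T * T -> T) (s : seq (T * T)) :
  (forall p, p \in s -> J (f p)) ->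
  exists2 K, nichols_admissible K & forall p, p \in s -> K (f p).
Proof.
elim: s => [_|p s IHs hs]; first by exists [set 0] => //; exact: nichols_admissible0.
have [K admK Kp] := hs p (mem_head _ _).
have [|L admL Ls] := IHs; first by move=> r rs; apply: hs; rewrite inE rs orbT.
have K0 : K 0 by case: admK => -[[]].
have L0 : L 0 by case: admL => -[[]].
exists [set x + y | x in K & y in L]; first exact: nichols_admissible_sum.
move=> r; rewrite inE => /orP[/eqP ->|/Ls Lr].
  by exists (f p) => //; exists 0 => //; rewrite addr0.
by exists 0 => //; exists (f r) => //; rewrite add0r.
Qed.

Lemma tensor_sub_nicholsl t : tensor_sub J setT t ->
  exists2 K, nichols_admissible K & tensor_sub K setT t.
Proof.
move=> [s hs ->]; have [|K admK Ks] := @nichols_ideal_seq fst s.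
  by move=> p /hs[].
by exists K => //; exists s => // p /Ks.
Qed.

Lemma tensor_sub_nicholsr t : tensor_sub setT J t ->
  exists2 K, nichols_admissible K & tensor_sub setT K t.
Proof.
move=> [s hs ->]; have [|K admK Ks] := @nichols_ideal_seq snd s.
  by move=> p /hs[].
by exists K => //; exists s => // p /Ks.
Qed.

Lemma nichols_ideal_admissible : nichols_admissible J.
Proof.
split; first split.
- split; first by exists [set 0] => //; exact: nichols_admissible0.
    move=> x y [K admK Kx] [L admL Ly].
    exists [set x + y | x in K & y in L]; first exact: nichols_admissible_sum.
    by exists x => //; exists y.
  move=> a x b [K admK Kx]; exists K => //.
  by case: admK => -[[_ _ KM] _ _ _ _ _] _ _; exact: KM.
- move=> x [K admK Kx]; have KJ := nichols_ideal_max admK.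
  case: admK => -[_ /(_ x Kx)[s [t [hs ht e]]] _ _ _ _] _ _.
  exists s, t; split=> //.
    exact: tensor_subS hs.
  exact: tensor_subS ht.
- by move=> x [K [[_ _ h _ _ _] _ _]]; exact: h.
- by move=> x [K admK Kx]; exists K => //; case: admK => -[_ _ _ h _ _] _ _; exact: h.
- apply/seteqP; split=> [_ [t /tensor_sub_nicholsl[K admK Kt] <-]|].
    apply: (tensor_subS (A := setT) (B := K)) => //; first exact: nichols_ideal_max.
    by case: admK => -[_ _ _ _ <- _] _ _; exists t.
  move=> t /tensor_sub_nicholsr[K admK].
  have KJ := nichols_ideal_max admK.
  case: admK => -[_ _ _ _ <- _] _ _ [s Ks <-]; exists s => //.
  exact: tensor_subS Ks.
- apply/seteqP; split=> [_ [t /tensor_sub_nicholsr[K admK Kt] <-]|].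
    apply: (tensor_subS (A := K) (B := setT)) => //; first exact: nichols_ideal_max.
    by case: admK => -[_ _ _ _ _ <-] _ _; exists t.
  move=> t /tensor_sub_nicholsl[K admK].
  have KJ := nichols_ideal_max admK.
  case: admK => -[_ _ _ _ _ <-] _ _ [s Ks <-]; exists s => //.
  exact: tensor_subS Ks.
- by move=> n x [K admK Kx]; exists K => //; case: admK => _ h _; exact: h.
- by move=> x [K [_ _ h]]; exact: h.
Qed.

Definition nichols_pred : {pred T} := [pred x | x \in J].

Lemma nichols_predE x : (x \in nichols_pred) = `[< J x >].
Proof. by rewrite inE /=; apply/idP/asboolP; rewrite inE. Qed.

Lemma nichols_predP x : reflect (J x) (x \in nichols_pred).
Proof. by rewrite nichols_predE; exact: asboolP. Qed.

Lemma nichols_pred_mul a b x : x \in nichols_pred -> a * x * b \in nichols_pred.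
Proof.
move=> /nichols_predP Jx; apply/nichols_predP.
by case: nichols_ideal_admissible => -[[_ _ JM] _ _ _ _ _] _ _; exact: JM.
Qed.

Lemma nichols_pred_mull a x : x \in nichols_pred -> a * x \in nichols_pred.
Proof. by move=> Jx; rewrite -[a * x]mulr1; exact: nichols_pred_mul. Qed.

Lemma nichols_pred_mulr b x : x \in nichols_pred -> x * b \in nichols_pred.
Proof. by move=> Jx; rewrite -[x]mul1r; exact: nichols_pred_mul. Qed.

Lemma nichols_pred_scale c x : x \in nichols_pred -> c *: x \in nichols_pred.
Proof. by rewrite -mul_malgC; exact: nichols_pred_mull. Qed.

Lemma nichols_pred1 : 1 \notin nichols_pred.
Proof.
apply/nichols_predP => J1.
case: nichols_ideal_admissible => _ _ /(_ 1 J1 mone).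
by rewrite -mcoeff_neq0 mcoeff1 eqxx oner_neq0 fdeg1 => /(_ isT).
Qed.

Lemma nichols_pred_zmod_closed : zmod_closed nichols_pred.
Proof.
case: nichols_ideal_admissible => -[[J0 JD _] _ _ _ _ _] _ _.
split=> [|x y /nichols_predP Jx Jy]; apply/nichols_predP => //.
apply: JD => //; apply/nichols_predP.
by rewrite -scaleN1r; exact: nichols_pred_scale.
Qed.

HB.instance Definition _ :=
  GRing.isZmodClosed.Build T nichols_pred nichols_pred_zmod_closed.

(* B(V) = T(V) / J(V). *)
Definition nichols_algebra : Type := Quotient.quot nichols_pred.

Local Notation B := nichols_algebra.

HB.instance Definition _ := GRing.Zmodule.on B.
HB.instance Definition _ := EqQuotient.on B.

Local Open Scope quotient_scope.

Lemma nichols_piP (x y : T) : (\pi_B x = \pi_B y) <-> J (x - y).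
Proof.
have e : (x - y \in nichols_pred) = (\pi_B x == \pi_B y).
  exact: Quotient.idealrBE.
split=> [/eqP h|/nichols_predP h]; last by apply/eqP; rewrite -e.
by apply/nichols_predP; rewrite e.
Qed.

Lemma nichols_piD : {morph \pi_B : x y / x + y}.
Proof. exact: Quotient.pi_add. Qed.

Definition nichols_one : B := \pi_B 1.
Definition nichols_mul (a b : B) : B := \pi_B (repr a * repr b).
Definition nichols_scale (c : k) (a : B) : B := \pi_B (c *: repr a).

Lemma nichols_piM (x y : T) : \pi_B (x * y) = nichols_mul (\pi_B x) (\pi_B y).
Proof.
have h z : J (z - repr (\pi_B z)) by apply/nichols_piP; rewrite reprK.
apply/nichols_piP/nichols_predP.
set x' := repr (\pi_B x); set y' := repr (\pi_B y).
have -> : x * y - x' * y' = (x - x') * y + x' * (y - y').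
  by rewrite mulrBl mulrBr subrKA.
have hx : (x - x') * y \in nichols_pred.
  by apply: nichols_pred_mulr; apply/nichols_predP; exact: h.
have hy : x' * (y - y') \in nichols_pred.
  by apply: nichols_pred_mull; apply/nichols_predP; exact: h.
exact: rpredD hx hy.
Qed.

Lemma nichols_piZ c (x : T) : \pi_B (c *: x) = nichols_scale c (\pi_B x).
Proof.
have h z : J (z - repr (\pi_B z)) by apply/nichols_piP; rewrite reprK.
apply/nichols_piP/nichols_predP.
by rewrite -scalerBr; apply: nichols_pred_scale; apply/nichols_predP; exact: h.
Qed.

Lemma nichols_piK (a : B) : exists x, \pi_B x = a.
Proof. by exists (repr a); exact: reprK. Qed.

Lemma nichols_mulA : associative nichols_mul.
Proof.
move=> a b c; have [x <-] := nichols_piK a; have [y <-] := nichols_piK b.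
have [z <-] := nichols_piK c; rewrite -(nichols_piM y z) -(nichols_piM x y).
by rewrite -(nichols_piM x (y * z)) -(nichols_piM (x * y) z) mulrA.
Qed.

Lemma nichols_mul1 : left_id nichols_one nichols_mul.
Proof.
by move=> a; have [x <-] := nichols_piK a; rewrite -(nichols_piM 1 x) mul1r.
Qed.

Lemma nichols_mulr1 : right_id nichols_one nichols_mul.
Proof.
by move=> a; have [x <-] := nichols_piK a; rewrite -(nichols_piM x 1) mulr1.
Qed.

Lemma nichols_mulDl : left_distributive nichols_mul +%R.
Proof.
move=> a b c; have [x <-] := nichols_piK a; have [y <-] := nichols_piK b.
have [z <-] := nichols_piK c; rewrite -(nichols_piD x y) -(nichols_piM (x + y) z).
rewrite -(nichols_piM x z) -(nichols_piM y z) -(nichols_piD (x * z) (y * z)).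
by congr (\pi_B _); exact: mulrDl.
Qed.

Lemma nichols_mulDr : right_distributive nichols_mul +%R.
Proof.
move=> a b c; have [x <-] := nichols_piK a; have [y <-] := nichols_piK b.
have [z <-] := nichols_piK c; rewrite -(nichols_piD y z) -(nichols_piM x (y + z)).
rewrite -(nichols_piM x y) -(nichols_piM x z) -(nichols_piD (x * y) (x * z)).
by congr (\pi_B _); exact: mulrDr.
Qed.

Lemma nichols_one_neq0 : nichols_one != 0.
Proof.
apply/eqP => e; case/negP: nichols_pred1; apply/nichols_predP.
rewrite -[1]subr0; apply/nichols_piP; rewrite -/nichols_one e.
by apply: (@addrI _ (\pi_B 0)); rewrite -nichols_piD !addr0.
Qed.

HB.instance Definition _ := GRing.Zmodule_isNzRing.Build B
  nichols_mulA nichols_mul1 nichols_mulr1 nichols_mulDl nichols_mulDr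
  nichols_one_neq0.

Lemma nichols_scaleA c d a :
  nichols_scale c (nichols_scale d a) = nichols_scale (c * d) a.
Proof.
have [x <-] := nichols_piK a.
by rewrite -(nichols_piZ d x) -(nichols_piZ c) -(nichols_piZ (c * d)) scalerA.
Qed.

Lemma nichols_scale1 : left_id 1 nichols_scale.
Proof.
by move=> a; have [x <-] := nichols_piK a; rewrite -(nichols_piZ 1 x) scale1r.
Qed.

Lemma nichols_scaleDr : right_distributive nichols_scale +%R.
Proof.
move=> c a b; have [x <-] := nichols_piK a; have [y <-] := nichols_piK b.
rewrite -(nichols_piD x y) -(nichols_piZ c (x + y)) -(nichols_piZ c x).
rewrite -(nichols_piZ c y) -(nichols_piD (c *: x) (c *: y)).
by congr (\pi_B _); exact: scalerDr.
Qed.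

Lemma nichols_scaleDl a : {morph nichols_scale^~ a : c d / c + d}.
Proof.
move=> c d /=; have [x <-] := nichols_piK a; rewrite -(nichols_piZ (c + d) x).
rewrite -(nichols_piZ c x) -(nichols_piZ d x) -(nichols_piD (c *: x) (d *: x)).
by congr (\pi_B _); exact: scalerDl.
Qed.

HB.instance Definition _ := GRing.Zmodule_isLmodule.Build k B
  nichols_scaleA nichols_scale1 nichols_scaleDr nichols_scaleDl.

Lemma nichols_scaleAl c (a b : B) : c *: (a * b) = c *: a * b.
Proof.
have [x <-] := nichols_piK a; have [y <-] := nichols_piK b.
transitivity (\pi_B (c *: (x * y))).
  by rewrite (nichols_piZ c (x * y)) (nichols_piM x y).
by rewrite scalerAl (nichols_piM (c *: x) y) (nichols_piZ c x).
Qed.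

HB.instance Definition _ := GRing.Lmodule_isLalgebra.Build k B nichols_scaleAl.

Definition nichols_proj (x : T) : B := \pi_B x.

Lemma nichols_projP (x : T) : nichols_proj x = 0 <-> J x.
Proof.
have e0 : \pi_B 0 = 0 :> B.
  by apply: (@addrI _ (\pi_B 0)); rewrite -nichols_piD !addr0.
by rewrite -e0 nichols_piP subr0.
Qed.

Lemma nichols_proj_surj (a : B) : exists x, nichols_proj x = a.
Proof. exact: nichols_piK. Qed.

Lemma nichols_proj_linear : linear nichols_proj.
Proof.
move=> c x y; rewrite /nichols_proj nichols_piD nichols_piZ.
by [].
Qed.

HB.instance Definition _ :=
  GRing.isLinear.Build k T B *:%R nichols_proj nichols_proj_linear.

Lemma nichols_proj_monoid_morphism : monoid_morphism nichols_proj.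
Proof. split; [exact: erefl | exact: nichols_piM]. Qed.

HB.instance Definition _ :=
  GRing.isMonoidMorphism.Build T B nichols_proj nichols_proj_monoid_morphism.

End NicholsAlgebra.

(* [Some i] indexes x_i, for i in {1, 2, 3} read modulo 3 (so that 3 = 0 in
   'Z_3), and [None] indexes x_4. *)
Definition hv_index : finType := option 'Z_3.

Section HV1.
Variables (k : fieldType) (q1 q2 : k).

Definition hv_omega : k := - (q1 * q2).

Definition hv_act (a b : hv_index) : hv_index :=
  match a, b with
  | Some i, Some j => Some (2 * i - j)
  | _, _ => b
  end.

Definition hv_q (a b : hv_index) : k :=
  match a, b with
  | Some _, Some _ => -1
  | Some _, None => q1
  | None, Some _ => q2
  | None, None => - hv_omega ^+ 2
  end.

Local Notation T := {malg k[{fmonom hv_index}]}.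

Definition hv_x (i : 'Z_3) : T := @gen k hv_index (Some i).
Definition hv_x4 : T := @gen k hv_index None.

Definition hv_xh4 (h : 'Z_3) : T := hv_x h * hv_x4 - q1 *: (hv_x4 * hv_x h).

Definition hv_xij4 (i j : 'Z_3) : T :=
  hv_x i * hv_xh4 j + q1 *: (hv_xh4 (2 * i - j) * hv_x i).

Definition hv_x124134 : T :=
  hv_xij4 1 2 * hv_xij4 1 3 + hv_omega ^+ 2 *: (hv_xij4 1 3 * hv_xij4 1 2).

Definition hv_relations : set T :=
  [set r | r \in
    [:: hv_x 1 ^+ 2; hv_x 2 ^+ 2; hv_x 3 ^+ 2;
        hv_x 1 * hv_x 2 + hv_x 3 * hv_x 1 + hv_x 2 * hv_x 3;
        hv_x 2 * hv_x 1 + hv_x 1 * hv_x 3 + hv_x 3 * hv_x 2;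
        hv_x4 ^+ 6;
        hv_x124134 ^+ 3;
        hv_xij4 2 1 - hv_omega *: hv_xij4 1 (2 - 2);
        hv_xij4 3 1 - hv_omega *: hv_xij4 1 (2 - 3);
        hv_x4 * hv_xh4 1 - q2 *: (hv_xh4 1 * hv_x4);
        hv_x4 * hv_xh4 2 - q2 *: (hv_xh4 2 * hv_x4);
        hv_x4 * hv_xh4 3 - q2 *: (hv_xh4 3 * hv_x4)]].

Definition hv_nichols_ideal : set T := nichols_ideal hv_act hv_q.

Definition hv_proj : T -> nichols_algebra hv_act hv_q :=
  @nichols_proj k hv_index hv_act hv_q.

(* The exponents of a factor of one of the two shapes a^l b^m c^n and
   a^l b a c^n. *)
Definition hv_factor_index : finType := ('I_2 * 'I_2 * 'I_2 + 'I_2 * 'I_2)%type.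

Definition hv_factor (a b c : T) (e : hv_factor_index) : T :=
  match e with
  | inl (l, m, n) => a ^+ l * b ^+ m * c ^+ n
  | inr (l, n) => a ^+ l * b * a * c ^+ n
  end.

Definition hv_pbw_index : finType :=
  ('I_6 * hv_factor_index * 'I_2 * 'I_3 * 'I_2 * hv_factor_index)%type.

Definition hv_pbw (e : hv_pbw_index) : T :=
  let '(n4, u, n124, n124134, n134, v) := e in
  hv_x4 ^+ n4 * hv_factor (hv_xh4 1) (hv_xh4 2) (hv_xh4 3) u
    * hv_xij4 1 2 ^+ n124 * hv_x124134 ^+ n124134 * hv_xij4 1 3 ^+ n134
    * hv_factor (hv_x 1) (hv_x 2) (hv_x 3) v.

End HV1.

(* Main.v *)
(* For each letter x_i let g_i be the automorphism x_j |-> q_ij x_(i . j) of T(V)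
   and d_i the skew derivation with d_i(x_j) = [i = j] and
   d_i(x y) = x d_i(y) + d_i(x) g_i(y).  The elements killed by every composite
   of derivations followed by the counit form the radical of a bilinear pairing,
   and the Nichols ideal is this radical.  An element without constant term is
   therefore a relation as soon as all its derivations are, which proves the
   twelve relations one after the other.

   Modulo the relations, words in the ten PBW letters can be rewritten with the
   rules found by completing the relations; this yields that the PBW monomials
   span.  For independence modulo the radical, every PBW monomial e has a pair
   (a, b) of words such that a e b is a nonzero multiple of the top monomial
   while a e' b = 0 for every larger monomial e'.  A linear relation multiplied by
   the pair of its smallest monomial would put the top monomial into the radical,
   but 35 derivations send that monomial to -18 omega.

   Each relation r is separated from the others by a matrix representation of the
   free algebra in which all the others vanish and r does not: for the cube of
   x_124134 a representation of dimension 24, for the rest the representation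
   recording the factors of one fixed word. *)
Require Import Defs.
From HB Require Import structures.
From Stdlib Require Import ZArith.
From mathcomp Require Import all_boot all_order all_algebra.
From mathcomp Require Import finmap boolp classical_sets monalg.
From mathcomp Require Import ssrZ ring zify.

Set Implicit Arguments.
Unset Strict Implicit.
Unset Printing Implicit Defensive.

Import GRing.Theory.
Local Open Scope ring_scope.
Local Open Scope classical_set_scope.

(** * Free algebras *)

(** Presentation and basis come out of one squeeze: the monomials span modulo the ideal J of the
    relations, J lies in the radical R, and the monomials are independent modulo R; hence J = R.
    Rewriting enters only through its soundness: every step preserves classes modulo an ideal, and
    the computed results are merely checked to have the required shape.

    All computation takes place in Z[ω][q_1, 1/q_1], since q_2 = -ω/q_1. Characteristic zero
    guarantees that nonzero norms from Z[ω] stay nonzero: those of the coefficients divided out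
    during completion, of the multiples of top words, and of -18ω.

    Identifying the Nichols ideal with R demands that R be compatible with coproduct, antipode,
    grading and the braiding in both directions; this is proved for every braiding of rack type with
    nonzero scalars. The twelve relations enter R in order of dependence, because the derivatives of
    the later ones vanish only modulo earlier ones.

    The arguments use an abstract free algebra with its tensor square; the concrete monoid algebra
    returns when the two sets of definitions are compared. *)

Section FreeModule.
Variables (k : fieldType) (X : choiceType) (M : lmodType k).

Lemma linextZ (f : X -> M) c t : linext f (c *: t) = c *: linext f t.
Proof.
rewrite (linextEw f (msuppZ_le c t)) /linext scaler_sumr.
by apply: eq_bigr => m _; rewrite mcoeffZ scalerA.
Qed.

Lemma linext_is_linear (f : X -> M) : linear (linext f).
Proof. by move=> c s t; rewrite linextD linextZ. Qed.

HB.instance Definition _ (f : X -> M) :=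
  GRing.isLinear.Build k {malg k[X]} M *:%R (linext f) (linext_is_linear f).

Lemma linextU (f : X -> M) m : linext f << m >> = f m.
Proof. by rewrite /linext msuppU oner_eq0 big_seq_fset1 mcoeffUU scale1r. Qed.

Lemma malg_sumE (t : {malg k[X]}) : t = \sum_(m <- msupp t) t@_m *: << m >>.
Proof.
by rewrite [LHS]monalgE; apply: eq_bigr => m _; rewrite scale_malgU mulr1.
Qed.

Lemma malg_ind (P : {malg k[X]} -> Prop) :
  P 0 -> (forall c x y, P x -> P y -> P (c *: x + y)) ->
  (forall m, P << m >>) -> forall x, P x.
Proof.
move=> P0 PL Pm x; rewrite [x]malg_sumE.
by elim/big_rec: _ => // m y _ Py; apply: PL.
Qed.

Lemma malg_linear_eq (F G : {linear {malg k[X]} -> M}) :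
  (forall m, F << m >> = G << m >>) -> F =1 G.
Proof.
move=> FG; elim/malg_ind => [|c x y Ex Ey|//]; first by rewrite !linear0.
by rewrite !linearP Ex Ey.
Qed.

End FreeModule.

(* Determines up to isomorphism the free algebra on [I] and its tensor square;
   [ft_rec] is recursion on words, with linear dependence on the tail. *)
Record free_tensor (k : fieldType) (I : finType) := FreeTensor {
  ft_alg :> algType k;
  ft_gen : I -> ft_alg;
  ft_ind : forall P : ft_alg -> Prop,
    P 0 -> (forall c x y, P x -> P y -> P (c *: x + y)) -> P 1 ->
    (forall i x, P x -> P (ft_gen i * x)) -> forall x, P x;
  ft_rec : forall (M : lmodType k) (m1 : M) (F : I -> ft_alg -> M -> M),
    (forall i c x y m n, F i (c *: x + y) (c *: m + n) = c *: F i x m + F i y n) ->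
    {f : {linear ft_alg -> M} |
      f 1 = m1 /\ forall i x, f (ft_gen i * x) = F i x (f x)};
  ft_sq : lmodType k;
  ft_tens : ft_alg -> ft_alg -> ft_sq;
  ft_tensl : forall t, linear (ft_tens^~ t);
  ft_tensr : forall s, linear (ft_tens s);
  ft_sq_sum : forall t : ft_sq, exists s : seq (ft_alg * ft_alg),
    t = \sum_(p <- s) ft_tens p.1 p.2;
  ft_lift : forall (M : lmodType k) (F : ft_alg -> ft_alg -> M),
    (forall t, linear (F^~ t)) -> (forall s, linear (F s)) ->
    {f : {linear ft_sq -> M} | forall s t, f (ft_tens s t) = F s t}
}.

(** An alias convertible with the monoid algebra of the statement, made to carry the [algType]
    structure on which the abstract part works. *)
Definition falg (k : fieldType) (I : finType) : Type := {malg k[{fmonom I}]}.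

Section FreeAlgebra.
Variables (k : fieldType) (I : finType).
Local Notation W := {fmonom I}.
Local Notation T := {malg k[W]}.
Local Notation TT := {malg k[(W * W)%type]}.
Local Notation gen := (@gen k I).

HB.instance Definition _ := GRing.Lalgebra.copy (falg k I) T.

Fact malg_scalerAr (c : k) (x y : falg k I) : c *: (x * y) = x * (c *: y).
Proof.
rewrite (malgMEw (fsubset_refl _) (msuppZ_le c y)) malgME scaler_sumr.
apply: eq_bigr => u _; rewrite scaler_sumr; apply: eq_bigr => v _.
by rewrite scale_malgU mcoeffZ mulrCA.
Qed.

HB.instance Definition _ :=
  GRing.Lalgebra_isAlgebra.Build k (falg k I) malg_scalerAr.

Definition mon (s : seq I) : T := << FMonom s >>.

Lemma mon_nil : mon [::] = 1.
Proof. by rewrite /mon -fmoneE. Qed.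

Lemma mon_cat s t : mon (s ++ t) = mon s * mon t.
Proof.
by rewrite malgM_def fgmulUU mulr1 -[mmul _ _]/(fmmul _ _) fmmulE.
Qed.

Lemma gen_mon i : gen i = mon [:: i].
Proof. by rewrite /gen fmuE. Qed.

Lemma mon_cons i s : mon (i :: s) = gen i * mon s.
Proof. by rewrite gen_mon -mon_cat. Qed.

Lemma mon_ind (P : T -> Prop) :
  P 0 -> (forall c x y, P x -> P y -> P (c *: x + y)) -> 
  (forall s, P (mon s)) -> forall x, P x.
Proof. by move=> P0 PL Pm; elim/malg_ind => // -[s]; exact: Pm. Qed.

Lemma falg_ind (P : T -> Prop) :
  P 0 -> (forall c x y, P x -> P y -> P (c *: x + y)) -> P 1 ->
  (forall i x, P x -> P (gen i * x)) -> forall x, P x.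
Proof.
move=> P0 PL P1 Pg; apply: mon_ind => // s.
by elim: s => [|i s IHs]; rewrite ?mon_nil ?mon_cons //; exact: Pg.
Qed.

Section Recursor.
Variables (M : lmodType k) (m1 : M) (F : I -> T -> M -> M).
Hypothesis FP : forall i c x y m n,
  F i (c *: x + y) (c *: m + n) = c *: F i x m + F i y n.

Fixpoint falg_recw (s : seq I) : M :=
  if s is i :: s' then F i (mon s') (falg_recw s') else m1.

Definition falg_rec : T -> M := linext (fun m : W => falg_recw m).
HB.instance Definition _ := GRing.Linear.copy falg_rec
  (linext (fun m : W => falg_recw m)).

Lemma falg_rec_mon s : falg_rec (mon s) = falg_recw s.
Proof. exact: linextU. Qed.

Lemma falg_rec1 : falg_rec 1 = m1.
Proof. by rewrite -mon_nil falg_rec_mon. Qed.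

Lemma falg_recM i x : falg_rec (gen i * x) = F i x (falg_rec x).
Proof.
(* The law [FP] at c = -1 and zero arguments reads F 0 0 = - F 0 0 + F 0 0. *)
have F0 : F i 0 0 = 0.
  by have := FP i (-1) 0 0 0 0; rewrite !scaler0 !addr0 scaleN1r addNr.
have rP c a b : falg_rec (c *: a + b) = c *: falg_rec a + falg_rec b.
  exact: linext_is_linear.
elim/mon_ind: x => [|c x y Ex Ey|s]; last by rewrite -mon_cons !falg_rec_mon.
  have r0 : falg_rec 0 = 0 by exact: linext0.
  by rewrite mulr0 r0 F0.
have -> : gen i * (c *: x + y) = c *: (gen i * x) + gen i * y.
  by rewrite mulrDr; congr (_ + _); exact: esym (malg_scalerAr _ _ _).
by rewrite !rP FP -Ex -Ey.
Qed.

End Recursor.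

Lemma tensor_linearl t : linear ((@tensor k I)^~ t).
Proof. by move=> c s s'; rewrite tensorDl !tensorE linextZ. Qed.

Lemma tensor_linearr s : linear (@tensor k I s).
Proof.
move=> c t t'; rewrite tensorDr; congr (_ + _).
rewrite !tensorE /linext scaler_sumr; apply: eq_bigr => u _.
by rewrite -/(linext (fun v => << (u, v) >> : TT) (c *: t)) linextZ !scalerA mulrC.
Qed.

Lemma tensor_mon s t : tensor (mon s) (mon t) = << (FMonom s, FMonom t) >>.
Proof. by rewrite tensorE !linextU. Qed.

Lemma tensor_sum (t : TT) : exists s : seq (T * T),
  t = \sum_(p <- s) tensor p.1 p.2.
Proof.
elim/malg_ind: t => [|c x y [sx ->] [sy ->]|[[u] [v]]].
- by exists [::]; rewrite big_nil.
- exists ([seq (c *: p.1, p.2) | p <- sx] ++ sy).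
  rewrite big_cat big_map scaler_sumr; congr (_ + _); apply: eq_bigr => p _ /=.
  by rewrite !tensorE linextZ.
by exists [:: (mon u, mon v)]; rewrite big_seq1 tensor_mon.
Qed.

Section Lift.
Variables (M : lmodType k) (F : T -> T -> M).
Hypothesis Fl : forall t, linear (F^~ t).
Hypothesis Fr : forall s, linear (F s).

Definition bilift : TT -> M := linext (fun p : (W * W)%type => F << p.1 >> << p.2 >>).
HB.instance Definition _ := GRing.Linear.copy bilift
  (linext (fun p : (W * W)%type => F << p.1 >> << p.2 >>)).

Lemma bilift_tensor s t : bilift (tensor s t) = F s t.
Proof.
have F0l y : F 0 y = 0.
  by have := Fl y (-1) 0 0; rewrite /= scaler0 addr0 scaleN1r addNr.
have F0r x : F x 0 = 0.
  by have := Fr x (-1) 0 0; rewrite /= scaler0 addr0 scaleN1r addNr.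
have b0 : bilift 0 = 0 by exact: linext0.
have bP c a b : bilift (c *: a + b) = c *: bilift a + bilift b.
  exact: linext_is_linear.
have t0l y : tensor 0 y = 0 by rewrite tensorE linext0.
have t0r y : tensor y 0 = 0.
  by rewrite tensorE /linext big1 // => u _; rewrite msupp0 big_nil scaler0.
elim/mon_ind: s t => [|c x y Ex Ey|s] t.
- by rewrite t0l b0 F0l.
- rewrite (tensor_linearl t c x y) bP; apply: etrans (esym (Fl t c x y)).
  by congr (_ *: _ + _); [exact: Ex|exact: Ey].
elim/mon_ind: t => [|c x y Ex Ey|t].
- by rewrite t0r b0 F0r.
- rewrite (tensor_linearr _ c x y) bP; apply: etrans (esym (Fr _ c x y)).
  by congr (_ *: _ + _); [exact: Ex|exact: Ey].
by rewrite tensor_mon; exact: linextU.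
Qed.

End Lift.

Definition malg_free_tensor : free_tensor k I :=
  @FreeTensor k I (falg k I) gen falg_ind
    (fun M m1 F FP => exist _ (falg_rec m1 F : {linear T -> M})
       (conj (falg_rec1 m1 F) (falg_recM m1 FP)))
    {malg k[(W * W)%type]} (@tensor k I) tensor_linearl tensor_linearr tensor_sum
    (fun M F Fl Fr => exist _ (bilift F : {linear TT -> M}) (bilift_tensor Fl Fr)).

End FreeAlgebra.

Section FreeTensorTheory.
Variables (k : fieldType) (I : finType) (T : free_tensor k I).
Local Notation gen := (ft_gen T).
Local Notation TT := (ft_sq T).
Local Notation "s ⊗ t" := (ft_tens s t) (at level 40).

Section Morphism.
Variables (A : algType k) (f : I -> A).

Fact ft_morphP :
  {g : {linear T -> A} | g 1 = 1 /\ forall i x, g (gen i * x) = f i * g x}.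
Proof.
apply: (@ft_rec k I T _ 1 (fun i _ m => f i * m)) => i c x y m n.
by rewrite mulrDr scalerAr.
Qed.

Definition ft_morph : {linear T -> A} := sval ft_morphP.

Lemma ft_morph1 : ft_morph 1 = 1.
Proof. by rewrite /ft_morph; case: ft_morphP => g []. Qed.

Lemma ft_morph_genM i x : ft_morph (gen i * x) = f i * ft_morph x.
Proof. by rewrite /ft_morph; case: ft_morphP => g []. Qed.

Lemma ft_morph_gen i : ft_morph (gen i) = f i.
Proof. by rewrite -[gen i]mulr1 ft_morph_genM ft_morph1 mulr1. Qed.

Lemma ft_morphM x y : ft_morph (x * y) = ft_morph x * ft_morph y.
Proof.
elim/ft_ind: x => [|c x z Ex Ez||i x Ex].
- by rewrite mul0r linear0 mul0r.
- by rewrite mulrDl -scalerAl !linearP /= Ex Ez mulrDl scalerAl.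
- by rewrite mul1r ft_morph1 mul1r.
by rewrite -mulrA !ft_morph_genM Ex mulrA.
Qed.

End Morphism.

Lemma tens0l (t : T) : 0 ⊗ t = 0.
Proof. by have := ft_tensl t (-1) 0 0; rewrite /= scaler0 addr0 scaleN1r addNr. Qed.

Lemma tens0r (t : T) : t ⊗ 0 = 0.
Proof. by have := ft_tensr t (-1) 0 0; rewrite /= scaler0 addr0 scaleN1r addNr. Qed.

Lemma tensDl (s s' t : T) : (s + s') ⊗ t = s ⊗ t + s' ⊗ t.
Proof. by have := ft_tensl t 1 s s'; rewrite /= !scale1r. Qed.

Lemma tensDr (s t t' : T) : s ⊗ (t + t') = s ⊗ t + s ⊗ t'.
Proof. by have := ft_tensr s 1 t t'; rewrite /= !scale1r. Qed.

Lemma tensZl c (s t : T) : (c *: s) ⊗ t = c *: (s ⊗ t).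
Proof. by have := ft_tensl t c s 0; rewrite /= tens0l !addr0. Qed.

Lemma tensZr c (s t : T) : s ⊗ (c *: t) = c *: (s ⊗ t).
Proof. by have := ft_tensr s c t 0; rewrite /= tens0r !addr0. Qed.

Lemma tensNl (s t : T) : (- s) ⊗ t = - (s ⊗ t).
Proof. by have := tensZl (-1) s t; rewrite !scaleN1r. Qed.

Lemma sliceP (phi : {linear T -> k^o}) :
  {f : {linear TT -> T} | forall s t, f (s ⊗ t) = (phi t : k) *: s}.
Proof.
apply: ft_lift => [t c s s'|s c t t'] /=.
  by rewrite scalerDr !scalerA mulrC.
by rewrite linearP /= scalerDl scalerA.
Qed.

Lemma slicelP (phi : {linear T -> k^o}) :
  {f : {linear TT -> T} | forall s t, f (s ⊗ t) = (phi s : k) *: t}.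
Proof.
apply: ft_lift => [t c s s'|s c t t'] /=.
  by rewrite linearP /= scalerDl scalerA.
by rewrite scalerDr !scalerA mulrC.
Qed.

Lemma maptensP (f g : {linear T -> T}) :
  {h : {linear TT -> TT} | forall s t, h (s ⊗ t) = f s ⊗ g t}.
Proof.
apply: ft_lift => [t c s s'|s c t t'] /=.
  by rewrite linearP /= tensDl tensZl.
by rewrite linearP /= tensDr tensZr.
Qed.

Definition slice phi : {linear TT -> T} := sval (sliceP phi).
Definition slicel phi : {linear TT -> T} := sval (slicelP phi).
Definition maptens f g : {linear TT -> TT} := sval (maptensP f g).

Lemma slice_tens phi s t : slice phi (s ⊗ t) = (phi t : k) *: s.
Proof. by rewrite /slice; case: sliceP => f ->. Qed.
Lemma slicel_tens phi s t : slicel phi (s ⊗ t) = (phi s : k) *: t.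
Proof. by rewrite /slicel; case: slicelP => f ->. Qed.
Lemma maptensE f g s t : maptens f g (s ⊗ t) = f s ⊗ g t.
Proof. by rewrite /maptens; case: maptensP => h ->. Qed.

Definition lmul (x : T) : {linear T -> T} := (GRing.mull_fun x idfun).
Lemma lmulE x y : lmul x y = x * y. Proof. by []. Qed.

End FreeTensorTheory.

(** * Skew derivations and their radical *)

Section Braided.
Variables (k : fieldType) (I : finType) (T : free_tensor k I).
Variables (act : I -> I -> I) (q : I -> I -> k).
Hypothesis act_inj : forall i, injective (act i).
Hypothesis q_neq0 : forall i j, q i j != 0.
(** Together with [q_rack] this is the braid equation for c: [act] is a rack operation and [q] a
    2-cocycle on it. It amounts to g_i g_j = g_(i . j) g_i. *)
Hypothesis act_rack :
  forall i j l, act i (act j l) = act (act i j) (act i l).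
Hypothesis q_rack :
  forall i j l, q i (act j l) * q j l = q (act i j) (act i l) * q i l.

Local Notation gen := (ft_gen T).
Local Notation TT := (ft_sq T).
Local Notation "s ⊗ t" := (ft_tens s t) (at level 40).

Definition actV i : I -> I := invF (@act_inj i).

Lemma actVK i : cancel (actV i) (act i). Proof. exact: f_invF. Qed.
Lemma actKV i : cancel (act i) (actV i). Proof. exact: invF_f. Qed.

Definition gact i : {linear T -> T} := ft_morph T (fun j => q i j *: gen (act i j)).

Lemma gact1 i : gact i 1 = 1.
Proof. exact: ft_morph1. Qed.

Lemma gact_genM i j x : gact i (gen j * x) = q i j *: gen (act i j) * gact i x.
Proof. exact: ft_morph_genM. Qed.

Lemma gact_gen i j : gact i (gen j) = q i j *: gen (act i j).
Proof. exact: ft_morph_gen. Qed.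

Lemma gactM i x y : gact i (x * y) = gact i x * gact i y.
Proof. exact: ft_morphM. Qed.

Definition gactV i : {linear T -> T} :=
  ft_morph T (fun j => (q i (actV i j))^-1 *: gen (actV i j)).

Lemma gactV1 i : gactV i 1 = 1.
Proof. exact: ft_morph1. Qed.

Lemma gactV_genM i j x :
  gactV i (gen j * x) = (q i (actV i j))^-1 *: gen (actV i j) * gactV i x.
Proof. exact: ft_morph_genM. Qed.

Lemma gactVK i : cancel (gactV i) (gact i).
Proof.
elim/ft_ind => [|c x y Ex Ey||j x Ex]; rewrite ?linear0 ?gactV1 ?gact1 //.
  by rewrite !linearP /= Ex Ey.
rewrite gactV_genM -scalerAl linearZ /= gact_genM Ex actVK -scalerAl scalerA.
by rewrite mulVf ?scale1r.
Qed.

Lemma gactKV i : cancel (gact i) (gactV i).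
Proof.
elim/ft_ind => [|c x y Ex Ey||j x Ex]; rewrite ?linear0 ?gact1 ?gactV1 //.
  by rewrite !linearP /= Ex Ey.
rewrite gact_genM -scalerAl linearZ /= gactV_genM Ex actKV -scalerAl scalerA.
by rewrite mulfV ?scale1r.
Qed.

Lemma gact_gact i j x : gact i (gact j x) = gact (act i j) (gact i x).
Proof.
elim/ft_ind: x => [|c x y Ex Ey||l x Ex]; rewrite ?linear0 ?gact1 //.
  by rewrite !linearP /= Ex Ey.
rewrite !gact_genM -!scalerAl !linearZ /= !gact_genM Ex -!scalerAl !scalerA.
by rewrite act_rack [q j l * _]mulrC q_rack mulrC.
Qed.

Fact counitP : {f : {linear T -> k^o} | f 1 = 1 /\ forall i x, f (gen i * x) = 0}.
Proof.
apply: (@ft_rec k I T k^o 1 (fun _ _ _ => 0)) => i c x y m n.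
by rewrite scaler0 addr0.
Qed.

Definition eps : {linear T -> k^o} := sval counitP.

Lemma eps1 : eps 1 = 1.
Proof. by rewrite /eps; case: counitP => g []. Qed.

Lemma eps_genM i x : eps (gen i * x) = 0.
Proof. by rewrite /eps; case: counitP => g []. Qed.

Lemma eps_gact i x : eps (gact i x) = eps x.
Proof.
elim/ft_ind: x => [|c x y Ex Ey||j x _].
- by rewrite !linear0.
- by rewrite !linearP /= Ex Ey.
- by rewrite gact1.
by rewrite gact_genM -scalerAl linearZ /= !eps_genM scaler0.
Qed.

Fact derP j : {f : {linear T -> T} | f 1 = 0 /\
  forall i x, f (gen i * x) = gen i * f x + (i == j)%:R *: gact i x}.
Proof.
apply: (@ft_rec k I T _ _ (fun i x m => gen i * m + (i == j)%:R *: gact i x)).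
move=> i c x y m n.
by rewrite linearP /= mulrDr -scalerAr !scalerDr !scalerA [_%:R * c]mulrC addrACA.
Qed.

Definition der j : {linear T -> T} := sval (derP j).

Lemma der1 j : der j 1 = 0.
Proof. by rewrite /der; case: derP => g []. Qed.

Lemma der_genM j i x :
  der j (gen i * x) = gen i * der j x + (i == j)%:R *: gact i x.
Proof. by rewrite /der; case: derP => g []. Qed.

Lemma der_gen j i : der j (gen i) = (i == j)%:R.
Proof. by rewrite -[gen i]mulr1 der_genM der1 gact1 mulr0 add0r scaler_nat. Qed.

Lemma derM j x y : der j (x * y) = x * der j y + der j x * gact j y.
Proof.
elim/ft_ind: x => [|c x x' Ex Ex'||i x Ex].
- by rewrite !(mul0r, linear0) addr0.
- rewrite !linearP /= !mulrDl -!scalerAl linearP /= Ex Ex' !scalerDr.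
  by rewrite addrACA.
- by rewrite !mul1r der1 mul0r addr0.
rewrite -mulrA !der_genM Ex gactM mulrDr !mulrA -addrA mulrDl; congr (_ + (_ + _)).
by rewrite -scalerAl; case: eqP => [->|_] //; rewrite !scale0r.
Qed.

(** As g_i carries x_j to a multiple of x_(i . j), it conjugates d_j into a multiple of d_(i . j).
    Stability of the radical under g_i rests on this exchange. *)
Lemma der_gact i j x : der (act i j) (gact i x) = q i j *: gact i (der j x).
Proof.
elim/ft_ind: x => [|c x y Ex Ey||l x Ex].
- by rewrite !linear0.
- by rewrite !linearP /= Ex Ey !scalerA mulrC.
- by rewrite der1 gact1 der1 !linear0.
rewrite gact_genM -scalerAl [LHS]linearZ /= !der_genM Ex.
rewrite [gact i (_ + _)]linearD /= gact_genM [gact i (_ *: _)]linearZ /=.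
rewrite (inj_eq (@act_inj i)) -gact_gact !scalerDr -!scalerAl -!scalerAr !scalerA.
congr (_ *: _ + _); first by rewrite mulrC.
by case: eqP => [->//|]; rewrite !mulr0 !scale0r.
Qed.

Fixpoint ders (w : seq I) (x : T) : T := if w is i :: w' then ders w' (der i x) else x.

Lemma ders_is_linear w : linear (ders w).
Proof. by elim: w => //= i w IH c x y; rewrite linearP /= IH. Qed.
HB.instance Definition _ w := GRing.isLinear.Build k T T *:%R (ders w) (ders_is_linear w).

Definition pairing w : {linear T -> k^o} := (eps \o ders w)%FUN.

Lemma pairing_cons i w x : pairing (i :: w) x = pairing w (der i x).
Proof. by []. Qed.

Lemma pairingP w c x y :
  pairing w (c *: x + y) = c * (pairing w x : k) + pairing w y.
Proof. exact: linearP. Qed.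

Lemma pairingD w x y : pairing w (x + y) = (pairing w x : k) + pairing w y.
Proof. exact: linearD. Qed.

Lemma pairingZ w c x : pairing w (c *: x) = c * (pairing w x : k).
Proof. exact: linearZ. Qed.

Definition radical : set T := [set x | forall w, pairing w x = 0].

Lemma radical_lin c x y : radical x -> radical y -> radical (c *: x + y).
Proof. by move=> Jx Jy w; rewrite pairingP Jx Jy mulr0 addr0. Qed.

Lemma radical0 : radical 0. Proof. by move=> w; rewrite linear0. Qed.

Lemma radicalD x y : radical x -> radical y -> radical (x + y).
Proof. by move=> Jx Jy; rewrite -[x]scale1r; exact: radical_lin. Qed.

Lemma radicalZ c x : radical x -> radical (c *: x).
Proof. by move=> Jx; rewrite -[_ *: _]addr0; apply: radical_lin radical0. Qed.

Lemma radical_der i x : radical x -> radical (der i x).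
Proof. by move=> Jx w; exact: (Jx (i :: w)). Qed.

Lemma radicalP x : eps x = 0 -> (forall i, radical (der i x)) -> radical x.
Proof. by move=> e0 Jd [|i w] //; exact: Jd. Qed.

Lemma radical_gact i x : radical x -> radical (gact i x).
Proof.
move=> Jx w; elim: w x Jx => [|j w IH] x Jx; first by rewrite /= eps_gact (Jx [::]).
rewrite pairing_cons -(actVK i j) der_gact pairingZ.
by rewrite IH ?mulr0 //; exact: radical_der.
Qed.

(** The exchange of [der_gact] is read backwards, which costs a division by q i j. *)
Lemma radical_gactV i x : radical x -> radical (gactV i x).
Proof.
move=> Jx w; rewrite -[x](gactVK i) in Jx; move: (gactV i x) Jx => {}x Jx.
elim: w x Jx => [|j w IH] x Jx; first by rewrite -(eps_gact i) (Jx [::]).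
rewrite pairing_cons; apply: IH => w'.
have := Jx (act i j :: w'); rewrite pairing_cons der_gact pairingZ.
by move/eqP; rewrite mulf_eq0 (negbTE (q_neq0 _ _)) => /eqP.
Qed.

Lemma epsM x y : eps (x * y) = (eps x : k) * eps y.
Proof.
elim/ft_ind: x => [|c x z Ex Ez||i x _].
- by rewrite mul0r linear0 mul0r.
- rewrite mulrDl -scalerAl !linearP /= Ex Ez.
  by apply/esym; rewrite [LHS]mulrDl; congr (_ + _); rewrite -mulrA.
- by rewrite mul1r eps1 mul1r.
by rewrite -mulrA !eps_genM mul0r.
Qed.

(** By the Leibniz rule both terms of d_i(x y) again have a left factor in the radical; the right
    factor may become g_i(y), so the induction keeps both factors general. *)
Lemma radical_mulr x y : radical x -> radical (x * y).
Proof.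
move=> Jx w; elim: w x y Jx => [|i w IH] x y Jx.
  by rewrite /pairing /= epsM (Jx [::] : eps x = 0) mul0r.
rewrite pairing_cons derM pairingD (IH x) // (IH (der i x)) ?addr0 //.
exact: radical_der.
Qed.

Lemma radical_mull x y : radical y -> radical (x * y).
Proof.
move=> Jy w; elim: w x y Jy => [|i w IH] x y Jy.
  by rewrite /pairing /= epsM (Jy [::] : eps y = 0) mulr0.
rewrite pairing_cons derM pairingD (IH x (der i y)) ?(IH _ (gact i y)) ?addr0 //.
  exact: radical_gact.
exact: radical_der.
Qed.

Lemma radical_ideal : two_sided_ideal radical.
Proof.
split; [exact: radical0|exact: radicalD|].
by move=> a x b Jx; apply: radical_mulr; exact: radical_mull.
Qed.

(** * Left skew derivations and the antipode *)

Fact derLP : {f : {linear T -> {ffun I -> T}} | f 1 = 0 /\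
  forall i x, f (gen i * x) =
    [ffun j => (i == j)%:R *: x + q i (actV i j) *: (gen i * f x (actV i j))]}.
Proof.
apply: (@ft_rec k I T _ 0 (fun i x m =>
  [ffun j => (i == j)%:R *: x + q i (actV i j) *: (gen i * (m : {ffun I -> T}) (actV i j))])).
move=> i c x y m n; apply/ffunP => j; rewrite !ffunE.
rewrite mulrDr -scalerAr !scalerDr !scalerA [_%:R * c]mulrC [q _ _ * c]mulrC.
by rewrite addrACA.
Qed.

(** The recursion on [gen i * x] passes from index j to [actV i j], so the whole family is
    constructed at once, with values in functions on [I]. *)
Definition derL j (x : T) : T := sval derLP x j.

Lemma derL_is_linear j : linear (derL j).
Proof. by move=> c x y; rewrite /derL linearP !ffunE. Qed.
HB.instance Definition _ j := GRing.isLinear.Build k T T *:%R (derL j) (derL_is_linear j).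

Lemma derL1 j : derL j 1 = 0.
Proof. by rewrite /derL; case: derLP => g [/= -> _]; rewrite ffunE. Qed.

Lemma derL_genM j i x : derL j (gen i * x) =
  (i == j)%:R *: x + q i (actV i j) *: (gen i * derL (actV i j) x).
Proof. by rewrite /derL; case: derLP => g [/= _ ->]; rewrite ffunE. Qed.

Lemma actV_act i l j : actV (act i l) (act i j) = act i (actV l j).
Proof. by apply: (@act_inj (act i l)); rewrite actVK -act_rack actVK. Qed.

Lemma derL_gact i j x : derL (act i j) (gact i x) = q i j *: gact i (derL j x).
Proof.
elim/ft_ind: x j => [|c x y Ex Ey||l x Ex] j.
- by rewrite !linear0.
- by rewrite !linearP /= Ex Ey !scalerA mulrC.
- by rewrite derL1 gact1 derL1 !linear0.
rewrite gact_genM -scalerAl [LHS]linearZ /= !derL_genM actV_act Ex.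
rewrite [gact i (_ + _)]linearD /= ![gact i (_ *: _)]linearZ /= gact_genM.
rewrite (inj_eq (@act_inj i)) !scalerDr -!scalerAl -!scalerAr !scalerA.
congr (_ + _ *: _).
  by case: eqP => [->//|]; rewrite !mulr0 !scale0r.
by have E := q_rack i l (actV l j); rewrite actVK in E; rewrite E -mulrA mulrC.
Qed.

(** The two families read the two outer legs of the iterated coproduct, so commutation is
    coassociativity; it is checked here by recursion on words. *)
Lemma der_derL j i x : der j (derL i x) = derL i (der j x).
Proof.
elim/ft_ind: x i => [|c x y Ex Ey||l x Ex] i.
- by rewrite !linear0.
- by rewrite !linearP /= Ex Ey.
- by rewrite derL1 der1 !linear0.
rewrite derL_genM der_genM !linearD !linearZ /= derL_genM der_genM Ex -addrA.
rewrite scalerDr; congr (_ + (_ + _)).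
by rewrite -[in RHS](actVK l i) derL_gact !scalerA mulrC.
Qed.

Lemma eps_derL i x : eps (derL i x) = eps (der i x).
Proof.
elim/ft_ind: x => [|c x y Ex Ey||l x Ex].
- by rewrite !linear0.
- by rewrite !linearP /= Ex Ey.
- by rewrite derL1 der1.
rewrite derL_genM der_genM !linearD !linearZ /= !eps_genM scaler0 addr0 add0r.
by rewrite eps_gact.
Qed.

Lemma radical_derL i x : radical x -> radical (derL i x).
Proof.
move=> Jx w; elim: w x Jx => [|j w IH] x Jx.
  by rewrite /pairing /= eps_derL; exact: (Jx [:: i]).
by rewrite pairing_cons der_derL; apply: IH; exact: radical_der.
Qed.

Fact antipodeP : {f : {linear T -> T} | f 1 = 1 /\
  forall i x, f (gen i * x) = - gact i (f x) * gen i}.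
Proof.
apply: (@ft_rec k I T _ 1 (fun i x m => - gact i m * gen i)).
by move=> i c x y m n; rewrite linearP /= opprD mulrDl -scalerN scalerAl.
Qed.

Definition anti : {linear T -> T} := sval antipodeP.

Lemma anti1 : anti 1 = 1.
Proof. by rewrite /anti; case: antipodeP => g []. Qed.

Lemma anti_genM i x : anti (gen i * x) = - gact i (anti x) * gen i.
Proof. by rewrite /anti; case: antipodeP => g []. Qed.

Lemma anti_gact i x : anti (gact i x) = gact i (anti x).
Proof.
elim/ft_ind: x => [|c x y Ex Ey||l x Ex].
- by rewrite !linear0.
- by rewrite !linearP /= Ex Ey.
- by rewrite gact1 anti1 gact1.
rewrite gact_genM -scalerAl linearZ /= !anti_genM gactM gact_gen linearN /=.
by rewrite Ex -gact_gact scalerAr.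
Qed.

(** The antipode reverses products, so a derivation acting from one end of S(x) becomes one acting
    from the other end of x. Stability of the radical under S thus reduces to stability under left
    derivations and g_j. *)
Lemma der_anti j x : der j (anti x) = - anti (gact j (derL j x)).
Proof.
elim/ft_ind: x j => [|c x y Ex Ey||i x Ex] j.
- by rewrite !linear0 ?oppr0.
- by rewrite !linearP /= Ex Ey.
- by rewrite anti1 der1 derL1 !linear0 ?oppr0.
rewrite anti_genM derL_genM derM der_gen linearN /= mulNr.
have -> : der j (gact i (anti x)) =
    - (q i (actV i j) *: gact j (gact i (anti (derL (actV i j) x)))).
  rewrite -{1}(actVK i j) der_gact Ex !linearN /= anti_gact.
  by rewrite (gact_gact i (actV i j)) actVK.
rewrite opprK ![gact j (_ + _)]linearD ![anti (_ + _)]linearD /= opprD; congr (_ + _).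
  rewrite [gact j (_ *: _)]linearZ [anti (_ *: _)]linearZ /= anti_gact.
  case: eqP => [->|_]; last by rewrite mulr0 scale0r.
  by rewrite mulr1 scale1r.
rewrite [gact j (_ *: _)]linearZ [anti (_ *: _)]linearZ /= gactM gact_gen.
rewrite -[_ *: gen _ * gact _ _]scalerAl [anti (_ *: _)]linearZ /= anti_genM.
by rewrite anti_gact -gact_gact mulNr !scalerN opprK -scalerAl -scalerAr.
Qed.

Lemma radical_anti x : radical x -> radical (anti x).
Proof.
move=> Jx w; elim: w x Jx => [|j w IH] x Jx.
  suff -> : pairing [::] (anti x) = pairing [::] x by exact: Jx.
  rewrite /pairing /=; elim/ft_ind: {Jx} x => [|c x y Ex Ey||i x _].
  - by rewrite !linear0.
  - by rewrite !linearP /= Ex Ey.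
  - by rewrite anti1.
  rewrite anti_genM epsM eps_genM -[gen i]mulr1 eps_genM.
  exact: mulr0.
rewrite pairing_cons der_anti -scaleN1r pairingZ IH ?mulr0 //.
by apply: radical_gact; exact: radical_derL.
Qed.

(** * The coproduct and the coideal property *)

Definition genact i : {linear TT -> TT} := maptens (gact i) (lmul (gen i)).
Definition genid i : {linear TT -> TT} := maptens (lmul (gen i)) (idfun : {linear T -> T}).

Lemma genact_tens i a b : genact i (a ⊗ b) = gact i a ⊗ (gen i * b).
Proof. by rewrite /genact maptensE lmulE. Qed.

Lemma genid_tens i a b : genid i (a ⊗ b) = (gen i * a) ⊗ b.
Proof. by rewrite /genid maptensE lmulE. Qed.

(** [genid i] and [genact i] are left multiplication by x_i ⊗ 1 and by 1 ⊗ x_i in the braided tensor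
    square, so the recursion is multiplicativity of the coproduct. *)
Fact coproductP : {f : {linear T -> TT} | f 1 = 1 ⊗ 1 /\
  forall i x, f (gen i * x) = genid i (f x) + genact i (f x)}.
Proof.
apply: (@ft_rec k I T TT (1 ⊗ 1) (fun i x m => genid i m + genact i m)).
by move=> i c x y m n; rewrite !linearP /= scalerDr addrACA.
Qed.

Definition coprod : {linear T -> TT} := sval coproductP.

Lemma coprod1 : coprod 1 = 1 ⊗ 1.
Proof. by rewrite /coprod; case: coproductP => g []. Qed.

Lemma coprod_genM i x : coprod (gen i * x) = genid i (coprod x) + genact i (coprod x).
Proof. by rewrite /coprod; case: coproductP => g []. Qed.

Lemma coprod_gact i x :
  coprod (gact i x) = maptens (gact i) (gact i) (coprod x).
Proof.
elim/ft_ind: x => [|c x y Ex Ey||j x Ex].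
- by rewrite !linear0.
- by rewrite !linearP /= Ex Ey.
- by rewrite gact1 coprod1 maptensE gact1.
rewrite gact_genM -scalerAl linearZ /= !coprod_genM Ex.
move: (coprod x) => t {x Ex}; have [s ->] := ft_sq_sum t.
rewrite !linear_sum -!big_split !linear_sum /=; apply: eq_bigr => -[a b] _ /=.
rewrite !maptensE !linearD /= !maptensE /= !gact_genM.
by rewrite -!scalerAl tensZl tensZr -gact_gact.
Qed.

Lemma der_coprod j x :
  maptens (idfun : {linear T -> T}) (der j) (coprod x) = coprod (der j x).
Proof.
elim/ft_ind: x => [|c x y Ex Ey||i x Ex].
- by rewrite !linear0.
- by rewrite !linearP /= Ex Ey.
- by rewrite der1 coprod1 maptensE der1 tens0r linear0.
rewrite der_genM [in RHS]linearD [coprod (_ *: _)]linearZ /= !coprod_genM -Ex coprod_gact.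
move: (coprod x) => t {x Ex}; have [s ->] := ft_sq_sum t.
rewrite !linear_sum -!big_split !linear_sum /=.
apply: eq_bigr => -[a b] _ /=.
by rewrite !maptensE linearD /= !maptensE /= der_genM tensDr tensZr addrA.
Qed.

(** Coassociativity in functional form: [der_coprod] moves each derivation inside the coproduct, and
    the counit on the right leg finishes. Conditions on coproducts thereby become conditions on
    derivatives. *)
Lemma slice_coprod w x : slice (pairing w) (coprod x) = ders w x.
Proof.
elim: w x => [|j w IH] x.
  elim/ft_ind: x => [|c x y Ex Ey||i x Ex].
  - by rewrite !linear0.
  - by rewrite !linearP /= Ex Ey.
  - by rewrite coprod1 slice_tens /pairing /= eps1 scale1r.
  rewrite coprod_genM /=; rewrite /= in Ex; rewrite -[in RHS]Ex.
  move: (coprod x) => t {x Ex}; have [s ->] := ft_sq_sum t.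
  rewrite !linear_sum -big_split linear_sum mulr_sumr; apply: eq_bigr => -[a b] _ /=.
  rewrite linearD /= genid_tens genact_tens !slice_tens /pairing /= eps_genM scale0r.
  by rewrite addr0 scalerAr.
rewrite /= -IH -der_coprod.
move: (coprod x) => t {x}; have [s ->] := ft_sq_sum t.
rewrite !linear_sum; apply: eq_bigr => -[a b] _ /=.
by rewrite maptensE !slice_tens.
Qed.

Definition tens_sub (A B : set T) : set TT :=
  [set t | exists2 s : seq (T * T),
     (forall p, p \in s -> A p.1 /\ B p.2) & t = \sum_(p <- s) p.1 ⊗ p.2].

Lemma tens_sub0 A B : tens_sub A B 0.
Proof. by exists [::]; rewrite ?big_nil. Qed.

Lemma tens_subD A B s t : tens_sub A B s -> tens_sub A B t -> tens_sub A B (s + t).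
Proof.
move=> [ls hs ->] [lt ht ->]; exists (ls ++ lt); last by rewrite big_cat.
by move=> p; rewrite mem_cat => /orP[/hs|/ht].
Qed.

Lemma tens_sub_tens (A B : set T) a b : A a -> B b -> tens_sub A B (a ⊗ b).
Proof.
by exists [:: (a, b)]; rewrite ?big_seq1 // => p; rewrite inE => /eqP ->.
Qed.

Lemma tens_sub_ind (A B : set T) (P : TT -> Prop) :
  P 0 -> (forall s t, P s -> P t -> P (s + t)) ->
  (forall a b, A a -> B b -> P (a ⊗ b)) -> tens_sub A B `<=` P.
Proof.
move=> P0 PD Pt t [s hs ->]; rewrite big_seq; elim/big_ind: _ => // p /hs[].
exact: Pt.
Qed.

(* By induction on the number of terms: if some second factor [b] is not in the
   radical, a functional not vanishing on [b] allows to eliminate it. *)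
Lemma coideal_sum (A : set T) (s : seq (T * T)) :
  A 0 -> (forall c x y, A x -> A y -> A (c *: x + y)) ->
  (forall w, A (slice (pairing w) (\sum_(p <- s) p.1 ⊗ p.2))) ->
  exists s1 s2, [/\ tens_sub A setT s1, tens_sub setT radical s2 &
    \sum_(p <- s) p.1 ⊗ p.2 = s1 + s2].
Proof.
move=> A0 AL; elim: {s}(size s) {-2}s (erefl (size s)) => [|n IH] s sz hA.
  exists 0, 0; split; try exact: tens_sub0.
  by rewrite (size0nil sz) big_nil addr0.
have [Jb|] := pselect (forall p, p \in s -> radical p.2).
  exists 0, (\sum_(p <- s) p.1 ⊗ p.2); split; first exact: tens_sub0.
    by exists s => // p ps; split => //; exact: Jb.
  by rewrite add0r.
move=> /existsNP[p] /not_implyP[ps] /existsNP[v /eqP c_neq0].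
set c : k := pairing v p.2 in c_neq0.
have perm_s := perm_to_rem ps.
pose a := slice (pairing v) (\sum_(p <- s) p.1 ⊗ p.2).
(* Each remaining second factor is corrected by a multiple of [p.2] so as to be killed by v. The
   first factors thus collected at [p.2] add up to a / c, and the slice a lies in [A] by
   hypothesis. *)
pose s' := [seq (r.1, r.2 - ((pairing v r.2 : k) / c) *: p.2) | r <- rem p s].
have Es : \sum_(p <- s) p.1 ⊗ p.2 = c^-1 *: a ⊗ p.2 + \sum_(r <- s') r.1 ⊗ r.2.
  have -> : c^-1 *: a = p.1 + \sum_(r <- rem p s) ((pairing v r.2 : k) / c) *: r.1.
    rewrite /a (perm_big _ perm_s) /= big_cons linearD linear_sum scalerDr /=.
    rewrite slice_tens scalerA mulVf // scale1r; congr (_ + _).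
    rewrite scaler_sumr; apply: eq_bigr => r _.
    by rewrite slice_tens scalerA mulrC.
  rewrite (perm_big _ perm_s) /= big_cons tensDl -addrA; congr (_ + _).
  rewrite big_map (big_morph (fun x => x ⊗ p.2) (id1 := 0) (op1 := +%R)).
  - rewrite -big_split; apply: eq_bigr => r _ /=.
    rewrite tensDr addrCA -[LHS]addr0; congr (_ + _).
    by rewrite -scaleNr tensZl tensZr scaleNr addrN.
  - by move=> x y; rewrite tensDl.
  - by rewrite tens0l.
have [||s1 [s2 [h1 h2 E2]]] := IH s'.
- by rewrite size_map size_rem // sz.
- move=> w; have -> : \sum_(r <- s') r.1 ⊗ r.2 =
    - (c^-1 *: a ⊗ p.2) + \sum_(p <- s) p.1 ⊗ p.2 by rewrite Es addKr.
  rewrite linearD linearN /= slice_tens scalerA -scaleNr.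
  by apply: AL; exact: hA.
exists (c^-1 *: a ⊗ p.2 + s1), s2; split=> //; last by rewrite Es E2 addrA.
apply: tens_subD h1; apply: tens_sub_tens => //.
by rewrite -[_ *: _]addr0; apply: AL => //; exact: hA.
Qed.

Lemma radical_coprod x : radical x -> exists s t,
  [/\ tens_sub radical setT s, tens_sub setT radical t & coprod x = s + t].
Proof.
move=> Jx; have [s Es] := ft_sq_sum (coprod x); rewrite Es.
apply: coideal_sum => [||w]; [exact: radical0|exact: radical_lin|].
rewrite -Es slice_coprod; elim: w x Jx {Es} => //= i w IH x Jx.
by apply: IH; exact: radical_der.
Qed.

(** This is [coideal_sum] for the zero subspace in place of [A]. *)
Lemma tens_sub_radicalr t : (forall w, slice (pairing w) t = 0) -> tens_sub setT radical t.
Proof.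
have [s ->] := ft_sq_sum t => h0.
have [||w|s1 [s2 [h1 h2 ->]]] := @coideal_sum [set 0] s.
- by [].
- by move=> c x y /= -> ->; rewrite scaler0 addr0.
- exact: h0.
suff -> : s1 = 0 by rewrite add0r.
apply: (tens_sub_ind (P := fun t => t = 0)) h1 => // [? ? -> ->|a b -> _].
  by rewrite addr0.
by rewrite tens0l.
Qed.

Lemma swapP : {f : {linear TT -> TT} | forall s t, f (s ⊗ t) = t ⊗ s}.
Proof. by apply: ft_lift => *; [exact: ft_tensr|exact: ft_tensl]. Qed.

Lemma tens_sub_radicall t : (forall w, slicel (pairing w) t = 0) -> tens_sub radical setT t.
Proof.
move=> h0; have [sw swE] := swapP.
have swsw u : sw (sw u) = u.
  have [s ->] := ft_sq_sum u; rewrite !linear_sum.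
  by apply: eq_bigr => p _; rewrite /= !swE.
have [w|s hs Es] := @tens_sub_radicalr (sw t).
  rewrite -(h0 w); have [s ->] := ft_sq_sum t; rewrite !linear_sum.
  by apply: eq_bigr => p _; rewrite /= swE slice_tens slicel_tens.
exists [seq (p.2, p.1) | p <- s]; first by move=> _ /mapP[p /hs[] ? ? ->].
rewrite -[t]swsw Es big_map linear_sum.
by apply: eq_bigr => p _ /=; rewrite swE.
Qed.

(** Slicing the coproduct with the single letter i kills its part in T ⊗ J, since J has no component
    of degree 1. Hence d_i maps J into J, and after all derivations the counit gives zero. *)
Lemma sub_radical (J : set T) :
  J 0 -> (forall c x y, J x -> J y -> J (c *: x + y)) ->
  (forall x, J x -> exists s t,
     [/\ tens_sub J setT s, tens_sub setT J t & coprod x = s + t]) ->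
  (forall x, J x -> eps x = 0) -> (forall i x, J x -> eps (der i x) = 0) ->
  J `<=` radical.
Proof.
move=> J0 JL Jc Je Jd x Jx w; elim: w x Jx => [|i w IH] x Jx; first exact: Je.
rewrite pairing_cons; apply: IH.
have [s [t [hs ht E]]] := Jc x Jx.
have := slice_coprod [:: i] x; rewrite /= E linearD /= => <-.
have -> : slice (pairing [:: i]) t = 0.
  apply: (tens_sub_ind (P := fun t => slice (pairing [:: i]) t = 0)) ht.
  - by rewrite linear0.
  - by move=> ? ? h1 h2; rewrite linearD /= h1 h2 addr0.
  - by move=> a b _ Jb; rewrite slice_tens /pairing /= (Jd i b Jb) scale0r.
rewrite addr0; apply: (tens_sub_ind (P := fun t => J (slice (pairing [:: i]) t))) hs.
- by rewrite linear0.
- by move=> ? ? h1 h2; rewrite linearD /= -[slice _ _]scale1r; exact: JL.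
- by move=> a b Ja _; rewrite slice_tens -[_ *: _]addr0; exact: JL.
Qed.

(** * The braiding of the free algebra *)

Fact braidlP b : {f : {linear T -> TT} | f 1 = b ⊗ 1 /\
  forall i x, f (gen i * x) = genact i (f x)}.
Proof.
apply: (@ft_rec k I T TT (b ⊗ 1) (fun i _ m => genact i m)).
by move=> i c x y m n; rewrite linearP.
Qed.

(** The braiding with a fixed right argument b: x_i x crosses b by letting x cross first, after
    which x_i acts on the moved factor by g_i. *)
Definition braidl b : {linear T -> TT} := sval (braidlP b).

Lemma braidl1 b : braidl b 1 = b ⊗ 1.
Proof. by rewrite /braidl; case: braidlP => g []. Qed.

Lemma braidl_genM b i x : braidl b (gen i * x) = genact i (braidl b x).
Proof. by rewrite /braidl; case: braidlP => g []. Qed.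

Lemma braidl_linear x : linear (fun b => braidl b x).
Proof.
move=> c a b; elim/ft_ind: x => [|d x y Ex Ey||i x Ex].
- by rewrite !linear0 addr0.
- by rewrite !linearP /= Ex Ey scalerDr addrACA.
- by rewrite !braidl1; exact: ft_tensl.
by rewrite !braidl_genM Ex linearP.
Qed.

Fact braidP : {f : {linear TT -> TT} | forall x b, f (x ⊗ b) = braidl b x}.
Proof.
apply: ft_lift => [b c x y|x c a b] /=; first by rewrite linearP.
exact: braidl_linear.
Qed.

Definition braid : {linear TT -> TT} := sval braidP.

Lemma braid_tens1 b : braid (1 ⊗ b) = b ⊗ 1.
Proof. by rewrite /braid; case: braidP => g /= ->; exact: braidl1. Qed.

Lemma braid_tensM i x b : braid ((gen i * x) ⊗ b) = genact i (braid (x ⊗ b)).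
Proof. by rewrite /braid; case: braidP => g /= gE; rewrite !gE braidl_genM. Qed.

Lemma braid_Ngen i b : braid ((- gen i) ⊗ b) = (- gact i b) ⊗ gen i.
Proof.
rewrite tensNl linearN /= -{1}[gen i]mulr1 braid_tensM braid_tens1 genact_tens mulr1.
by rewrite tensNl.
Qed.

Lemma braid_genid i t : braid (genid i t) = genact i (braid t).
Proof.
have [s ->] := ft_sq_sum t; rewrite !linear_sum; apply: eq_bigr => -[a b] _ /=.
by rewrite genid_tens braid_tensM.
Qed.

Lemma genact_gact i j t : maptens (gact i) (gact i) (genact j t) =
  q i j *: genact (act i j) (maptens (gact i) (gact i) t).
Proof.
have [s ->] := ft_sq_sum t; rewrite !linear_sum; apply: eq_bigr => -[a b] _ /=.
rewrite !maptensE /= gact_genM -!scalerAl tensZr.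
by rewrite (gact_gact i j).
Qed.

Lemma braid_gact i x b :
  maptens (gact i) (gact i) (braid (x ⊗ b)) = braid (gact i x ⊗ gact i b).
Proof.
elim/ft_ind: x => [|c x y Ex Ey||j x Ex].
- by rewrite !(tens0l, linear0).
- by rewrite linearP /= !tensDl !tensZl !linearP /= Ex Ey.
- by rewrite gact1 !braid_tens1 maptensE gact1.
rewrite braid_tensM genact_gact Ex gact_genM -scalerAl tensZl linearZ /=.
by rewrite braid_tensM.
Qed.

Lemma der_braid j x b :
  maptens (idfun : {linear T -> T}) (der j) (braid (x ⊗ b)) =
  braid (der j x ⊗ gact j b).
Proof.
elim/ft_ind: x => [|c x y Ex Ey||i x Ex].
- by rewrite !(tens0l, linear0).
- by rewrite linearP /= !tensDl !tensZl !linearP /= Ex Ey.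
- by rewrite braid_tens1 maptensE der1 tens0r tens0l linear0.
rewrite braid_tensM der_genM tensDl tensZl [RHS]linearD [X in _ + X]linearZ /=.
rewrite braid_tensM -Ex.
have -> : (i == j)%:R *: braid (gact i x ⊗ gact j b) =
    (i == j)%:R *: maptens (gact i) (gact i) (braid (x ⊗ b)).
  by case: eqP => [->|]; rewrite ?scale0r // braid_gact.
move: (braid _) => t; have [s ->] := ft_sq_sum t.
rewrite !linear_sum -big_split /=; apply: eq_bigr => -[u v] _ /=.
by rewrite genact_tens !maptensE /= der_genM tensDr tensZr.
Qed.

Fixpoint gacts (w : seq I) (x : T) : T := if w is i :: w' then gacts w' (gact i x) else x.

Lemma gacts0 w : gacts w 0 = 0.
Proof. by elim: w => //= i w IH; rewrite linear0. Qed.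

Lemma gactsP w c x y : gacts w (c *: x + y) = c *: gacts w x + gacts w y.
Proof. by elim: w x y => //= i w IH x y; rewrite linearP /= IH. Qed.

Lemma gacts_eq0 w x : gacts w x = 0 -> x = 0.
Proof.
elim: w x => //= i w IH x /IH /(congr1 (gactV i)).
by rewrite gactKV linear0.
Qed.

(** A functional on the strand that moves to the right may be evaluated before the crossing, at the
    price of the automorphisms of its letters acting on the other strand. These are invertible, so
    membership in the radical passes through the braiding in both directions. *)
Lemma slice_braid w t : slice (pairing w) (braid t) = gacts w (slicel (pairing w) t).
Proof.
have [s ->] := ft_sq_sum t; elim: s => [|[x b] s IH].
  by rewrite big_nil !linear0 gacts0.
rewrite big_cons !linearD /= IH -[X in gacts w (X + _)]scale1r gactsP scale1r.
congr (_ + _); rewrite slicel_tens /= -[_ *: b]addr0 gactsP gacts0 addr0 => {s IH}.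
elim: w x b => [|j w IH] x b /=.
  elim/ft_ind: x => [|c x y Ex Ey||i x _].
  - by rewrite tens0l !linear0 scale0r.
  - rewrite tensDl tensZl !linearP /= Ex Ey scalerDl scalerA.
    by [].
  - by rewrite braid_tens1 slice_tens.
  rewrite braid_tensM /pairing /= eps_genM scale0r.
  have [s ->] := ft_sq_sum (braid (x ⊗ b)); rewrite !linear_sum big1 //.
  by move=> -[u v] _ /=; rewrite genact_tens slice_tens /= eps_genM scale0r.
rewrite -[eps _]/(pairing w (der j x)) -IH -der_braid.
have [s ->] := ft_sq_sum (braid (x ⊗ b)); rewrite !linear_sum.
by apply: eq_bigr => -[u v] _ /=; rewrite maptensE !slice_tens.
Qed.

Lemma tens_sub_genact i t : tens_sub radical setT t -> tens_sub radical setT (genact i t).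
Proof.
move=> ht; apply: (tens_sub_ind (P := fun t => tens_sub radical setT (genact i t))) ht.
- by rewrite linear0; exact: tens_sub0.
- by move=> s u hs hu; rewrite linearD; exact: tens_subD.
move=> a b Ja _; rewrite genact_tens; apply: tens_sub_tens => //.
exact: radical_gact.
Qed.

Lemma tens_subZ A B c t : (forall x, B x -> B (c *: x)) ->
  tens_sub A B t -> tens_sub A B (c *: t).
Proof.
move=> BZ; apply: (tens_sub_ind (P := fun t => tens_sub A B (c *: t))).
- by rewrite scaler0; exact: tens_sub0.
- by move=> s u hs hu; rewrite scalerDr; exact: tens_subD.
by move=> a b Aa Bb; rewrite -tensZr; apply: tens_sub_tens => //; exact: BZ.
Qed.

Lemma braid_radicall : braid @` tens_sub radical setT = tens_sub setT radical.
Proof.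
apply/seteqP; split=> [_ [t ht <-]|t ht].
  apply: tens_sub_radicalr => w; rewrite slice_braid -(gacts0 w); congr gacts.
  apply: (tens_sub_ind (P := fun t => slicel (pairing w) t = 0)) ht.
  - by rewrite linear0.
  - by move=> s u hs hu; rewrite linearD /= hs hu addr0.
  by move=> a b Ja _; rewrite slicel_tens Ja scale0r.
suff [u Eu] : exists u, braid u = t.
  exists u => //; apply: tens_sub_radicall => w; apply: (@gacts_eq0 w).
  rewrite -slice_braid Eu.
  apply: (tens_sub_ind (P := fun t => slice (pairing w) t = 0)) ht.
  - by rewrite linear0.
  - by move=> s v hs hv; rewrite linearD /= hs hv addr0.
  by move=> a b _ Jb; rewrite slice_tens Jb scale0r.
apply: (tens_sub_ind (P := fun t => exists u, braid u = t)) ht.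
- by exists 0; rewrite linear0.
- by move=> s v [u <-] [u' <-]; exists (u + u'); rewrite linearD.
move=> a y _ _; elim/ft_ind: y a => [|c x y Ex Ey||i y Ey] a.
- by exists 0; rewrite tens0r linear0.
- have [u Eu] := Ex a; have [v Ev] := Ey a.
  by exists (c *: u + v); rewrite linearP /= Eu Ev tensDr tensZr.
- by exists (1 ⊗ a); rewrite braid_tens1.
(* A preimage of g_i^-1(a) ⊗ y, multiplied by x_i on the left, is a preimage of a ⊗ x_i y. *)
have [u Eu] := Ey (gactV i a); exists (genid i u).
by rewrite braid_genid Eu genact_tens gactVK.
Qed.

(** Here the factor in the radical is the one acted on during the crossing, so stability under the
    g_i and their inverses takes the place of slicing. *)
Lemma braid_radicalr : braid @` tens_sub setT radical = tens_sub radical setT.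
Proof.
apply/seteqP; split=> [_ [t ht <-]|t ht].
  apply: (tens_sub_ind (P := fun t => tens_sub radical setT (braid t))) ht.
  - by rewrite linear0; exact: tens_sub0.
  - by move=> s u hs hu; rewrite linearD; exact: tens_subD.
  move=> x b _ Jb; elim/ft_ind: x => [|c x y Ex Ey||i x Ex].
  - by rewrite tens0l linear0; exact: tens_sub0.
  - rewrite tensDl tensZl linearP; apply: tens_subD Ey.
    by apply: tens_subZ Ex.
  - by rewrite braid_tens1; exact: tens_sub_tens.
  by rewrite braid_tensM; exact: tens_sub_genact.
suff [u hu <-] : exists2 u, tens_sub setT radical u & braid u = t by exists u.
apply: (tens_sub_ind
  (P := fun t => exists2 u, tens_sub setT radical u & braid u = t)) ht.
- by exists 0; [exact: tens_sub0|rewrite linear0].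
- move=> s v [u hu <-] [u' hu' <-].
  by exists (u + u'); [exact: tens_subD|rewrite linearD].
move=> a y Ja _; elim/ft_ind: y a Ja => [|c x y Ex Ey||i y Ey] a Ja.
- by exists 0; [exact: tens_sub0|rewrite tens0r linear0].
- have [u hu Eu] := Ex a Ja; have [v hv Ev] := Ey a Ja.
  exists (c *: u + v); last by rewrite linearP /= Eu Ev tensDr tensZr.
  by apply: tens_subD hv; apply: tens_subZ hu => z; exact: radicalZ.
- by exists (1 ⊗ a); [exact: tens_sub_tens|rewrite braid_tens1].
have [u hu Eu] := Ey (gactV i a) (radical_gactV i Ja).
exists (genid i u); last by rewrite braid_genid Eu genact_tens gactVK.
apply: (tens_sub_ind (P := fun u => tens_sub setT radical (genid i u))) hu.
- by rewrite linear0; exact: tens_sub0.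
- by move=> s v hs hv; rewrite linearD; exact: tens_subD.
by move=> x b _ Jb; rewrite genid_tens; exact: tens_sub_tens.
Qed.

(** The interface [free_tensor] has no grading; the three hypotheses characterize [h n] as the
    projection to degree n. It commutes with every g_i, and a derivation lowers the degree by
    one. *)
Lemma radical_graded (h : nat -> {linear T -> T}) :
  (forall n, h n 1 = (n == 0%N)%:R) -> (forall i x, h 0%N (gen i * x) = 0) ->
  (forall n i x, h n.+1 (gen i * x) = gen i * h n x) ->
  forall n x, radical x -> radical (h n x).
Proof.
move=> h1 h0 hS.
have h_gact n i x : h n (gact i x) = gact i (h n x).
  elim/ft_ind: x n => [|c x y Ex Ey||j x Ex] n.
  - by rewrite !linear0.
  - by rewrite !linearP /= Ex Ey.
  - by rewrite gact1 h1; case: n => [|n]; rewrite ?gact1 ?linear0.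
  rewrite gact_genM -scalerAl linearZ /=; case: n => [|n]; first by rewrite !h0 !linear0.
  by rewrite !hS Ex gact_genM scalerAl.
have der_h n i x : der i (h n x) = if n is m.+1 then h m (der i x) else 0.
  elim/ft_ind: x n => [|c x y Ex Ey||j x Ex] [|n]; rewrite ?linear0 //.
  - by rewrite linearP /= !linearP /= !Ex !Ey scaler0 addr0.
  - by rewrite !linearP /= Ex Ey.
  - by rewrite h1 der1.
  - by rewrite h1 der1 !linear0.
  - by rewrite h0 linear0.
  rewrite hS !der_genM linearD linearZ /= h_gact Ex; congr (_ + _).
  by case: n => [|n]; rewrite ?h0 ?mulr0 ?hS.
have eps_h n x : eps (h n x) = if n is m.+1 then 0 else eps x.
  elim/ft_ind: x n => [|c x y Ex Ey||j x Ex] [|n]; rewrite ?linear0 //.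
  - by rewrite !linearP /= Ex Ey.
  - by rewrite linearP /= linearP /= Ex Ey scaler0 addr0.
  - by rewrite h1.
  - by rewrite h1 linear0.
  - by rewrite h0 eps_genM linear0.
  - by rewrite hS eps_genM.
move=> n x Jx w; elim: w n x Jx => [|i w IH] [|n] x Jx.
- by rewrite /pairing /= eps_h; exact: (Jx [::]).
- by rewrite /pairing /= eps_h.
- by rewrite pairing_cons der_h linear0.
by rewrite pairing_cons der_h; apply: IH; exact: radical_der.
Qed.

End Braided.

(** * The Nichols ideal is the radical *)

Lemma linZ (R : pzRingType) (U V : lmodType R) (f : {linear U -> V}) c x : f (c *: x) = c *: f x.
Proof. exact: linearZ. Qed.

Section NicholsRadical.
Variables (k : fieldType) (I : finType) (act : I -> I -> I) (q : I -> I -> k).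
Hypothesis act_inj : forall i, injective (act i).
Hypothesis q_neq0 : forall i j, q i j != 0.
Hypothesis act_rack :
  forall i j l, act i (act j l) = act (act i j) (act i l).
Hypothesis q_rack :
  forall i j l, q i (act j l) * q j l = q (act i j) (act i l) * q i l.

Local Notation W := {fmonom I}.
Local Notation T := {malg k[W]}.
Local Notation TT := {malg k[(W * W)%type]}.
Local Notation F := (malg_free_tensor k I).
Local Notation mon := (@mon k I).
Local Notation gact := (@gact k I F act q).
Local Notation radical := (@radical k I F act q).

Lemma gact_mon i u : gact i (mon u) =
  (\prod_(j <- u) q i j) *: mon [seq act i j | j <- u] :> T.
Proof.
elim: u => [|j u IH].
  by rewrite mon_nil big_nil scale1r; exact: (@gact1 k I F).
rewrite mon_cons big_cons /= [X in _ *: X]mon_cons.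
apply: etrans (@gact_genM k I F act q i j (mon u)) _.
rewrite IH -scalerA -[LHS](@scalerAl k F) -[X in _ *: X = _](@scalerAr k F).
by [].
Qed.

Lemma linear_ext (M : lmodType k) (f g : T -> M) : linear f -> linear g ->
  (forall u, f (mon u) = g (mon u)) -> f =1 g.
Proof.
move=> fL gL fg x.
pose f' : {linear T -> M} := HB.pack f (GRing.isLinear.Build k T M *:%R f fL).
pose g' : {linear T -> M} := HB.pack g (GRing.isLinear.Build k T M *:%R g gL).
by apply: (@malg_linear_eq _ _ _ f' g') => -[u]; exact: fg.
Qed.

Lemma linear_ext2 (M : lmodType k) (f g : TT -> M) : linear f -> linear g ->
  (forall u v, f (tensor (mon u) (mon v)) = g (tensor (mon u) (mon v))) -> f =1 g.
Proof.
move=> fL gL fg x.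
pose f' : {linear TT -> M} := HB.pack f (GRing.isLinear.Build k TT M *:%R f fL).
pose g' : {linear TT -> M} := HB.pack g (GRing.isLinear.Build k TT M *:%R g gL).
by apply: (@malg_linear_eq _ _ _ f' g') => -[[u] [v]]; rewrite /= -tensor_mon; exact: fg.
Qed.

Lemma genid_mon i u v : @genid k I F i (tensor (mon u) (mon v) : ft_sq F) =
  << (FMonom (i :: u), FMonom v) >>.
Proof.
apply: etrans (@genid_tens k I F i (mon u) (mon v)) _.
by rewrite -[ft_tens _ _]/(tensor (gen k i * mon u) (mon v)) -mon_cons tensor_mon.
Qed.

Lemma genact_mon i u v : @genact k I F act q i (tensor (mon u) (mon v)) =
  << (\prod_(j <- u) q i j) *g (FMonom [seq act i j | j <- u], FMonom (i :: v)) >>.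
Proof.
apply: etrans (@genact_tens k I F act q i (mon u) (mon v)) _.
rewrite gact_mon.
rewrite -[ft_tens _ _]/(tensor (_ *: mon [seq act i j | j <- u]) (gen k i * mon v)).
rewrite -mon_cons tensorE linextZ -tensorE tensor_mon scale_malgU.
by rewrite mulr1.
Qed.

Lemma word_q_cons i u v : word_q act q (FMonom (i :: u)) (FMonom v) =
  (\prod_(j <- v) q i (letter_act act u j)) * word_q act q (FMonom u) (FMonom v).
Proof. by rewrite /word_q -big_split. Qed.

Lemma word_q_nil v : word_q act q (FMonom [::]) (FMonom v) = 1.
Proof. by rewrite /word_q big1. Qed.

Lemma word_act_nil v : word_act act (FMonom [::]) (FMonom v) = FMonom v.
Proof. by rewrite /word_act map_id. Qed.

Lemma word_act_cons i u v : word_act act (FMonom (i :: u)) (FMonom v) =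
  FMonom [seq act i j | j <- word_act act (FMonom u) (FMonom v)].
Proof. by rewrite /word_act -map_comp. Qed.

(** Both braidings obey the same recursion on the first letter of the left word. *)
Lemma braidingE t : braiding act q t = @braid k I F act q t.
Proof.
apply: (linear_ext2 (f := braiding act q) (g := @braid k I F act q)) => [||u v].
- exact: linext_is_linear.
- exact: (@linearP k (ft_sq F) (ft_sq F) _ (@braid k I F act q)).
rewrite tensor_mon /braiding linextU /= -tensor_mon.
elim: u => [|i u IH].
  rewrite word_q_nil word_act_nil mon_nil.
  apply: esym; apply: etrans (@braid_tens1 k I F act q (mon v)) _.
  by rewrite -[ft_tens _ _]/(tensor (mon v) 1) -mon_nil tensor_mon.
rewrite mon_cons; apply: esym; apply: etrans (@braid_tensM k I F act q i (mon u) (mon v)) _.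
rewrite -[ft_tens _ _]/(tensor (mon u) (mon v)) -IH.
have -> : << word_q act q (FMonom u) (FMonom v) *g (word_act act (FMonom u) (FMonom v), FMonom u) >> =
  word_q act q (FMonom u) (FMonom v) *: tensor (mon (word_act act (FMonom u) (FMonom v))) (mon u) :> TT.
  by rewrite tensor_mon scale_malgU mulr1 fmK.
apply: etrans (linZ (@genact k I F act q i) _ _) _.
rewrite [X in _ *: X]genact_mon [LHS]scale_malgU word_q_cons word_act_cons.
by rewrite big_map mulrC.
Qed.

Lemma braided_mulD s s' t :
  braided_mul act q (s + s') t = braided_mul act q s t + braided_mul act q s' t.
Proof. exact: linextD. Qed.

Lemma braided_mulU p t : braided_mul act q << p >> t =
  linext (fun r : (W * W)%type => << word_q act q p.2 r.1 *g
    (mmul p.1 (word_act act p.2 r.1), mmul p.2 r.2) >> : TT) t.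
Proof. exact: linextU. Qed.

Lemma braided_mul_gen1 i t :
  braided_mul act q (tensor (gen k i) 1) t = @genid k I F i t.
Proof.
have -> : tensor (gen k i) 1 = << (FMonom [:: i], FMonom [::]) >>.
  by apply: etrans (congr2 (@tensor k I) (gen_mon k i) (esym (mon_nil k I))) _;
    exact: tensor_mon.
rewrite braided_mulU; move: t; apply: linear_ext2 => [||u v].
- exact: linext_is_linear.
- exact: (@linearP k (ft_sq F) (ft_sq F) _ (@genid k I F i)).
rewrite genid_mon tensor_mon linextU /= word_q_nil word_act_nil.
by congr (<< (_, _) >>); rewrite -[mmul _ _]/(fmmul _ _) fmmulE.
Qed.

Lemma braided_mul_1gen i t :
  braided_mul act q (tensor 1 (gen k i)) t = @genact k I F act q i t.
Proof.
have -> : tensor 1 (gen k i) = << (FMonom [::], FMonom [:: i]) >>.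
  by apply: etrans (congr2 (@tensor k I) (esym (mon_nil k I)) (gen_mon k i)) _;
    exact: tensor_mon.
rewrite braided_mulU; move: t; apply: linear_ext2 => [||u v].
- exact: linext_is_linear.
- exact: (@linearP k (ft_sq F) (ft_sq F) _ (@genact k I F act q i)).
rewrite genact_mon tensor_mon linextU /= word_q_cons word_q_nil mulr1.
rewrite word_act_cons word_act_nil.
by congr (<< _ *g (_, _) >>); rewrite -[mmul _ _]/(fmmul _ _) fmmulE.
Qed.

Lemma comulE x : comul act q x = @coprod k I F act q x.
Proof.
apply: (linear_ext (f := comul act q) (g := @coprod k I F act q)) => [||u].
- exact: linext_is_linear.
- exact: (@linearP k F (ft_sq F) _ (@coprod k I F act q)).
rewrite /comul linextU /=; elim: u => [|i u IH] /=.
  by rewrite mon_nil; apply: esym; exact: (@coprod1 k I F).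
rewrite mon_cons; apply: esym; apply: etrans (@coprod_genM k I F act q i (mon u)) _.
rewrite -IH; apply: esym; apply: etrans (braided_mulD _ _ _) _.
by apply: (congr2 (fun a b : TT => a + b)); [exact: braided_mul_gen1|exact: braided_mul_1gen].
Qed.

Lemma counitE (x : T) : counit x = @eps k I F x.
Proof.
apply: (linear_ext (M := k^o) (f := @counit k I) (g := @eps k I F)) => [c y z||u].
- by rewrite /counit mcoeffD mcoeffZ.
- exact: (@linearP k F k^o _ (@eps k I F)).
case: u => [|i u].
  rewrite mon_nil; apply: etrans (esym (@eps1 k I F)).
  by rewrite /counit mcoeff1 eqxx.
rewrite {2}mon_cons; apply: etrans (esym (@eps_genM k I F i (mon u))).
rewrite /counit /mon mcoeffU -[mone]/(fmone _) fmoneE.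
by have /negPf-> : FMonom (i :: u) != FMonom [::] by [].
Qed.

Lemma mult_bilift t : mult t = @bilift k I (falg k I) (fun a b : falg k I => a * b) t.
Proof.
rewrite /mult /bilift; congr (linext _ t); apply: boolp.funext => -[[u] [v]] /=.
transitivity (mon (u ++ v)); last exact: mon_cat.
by rewrite -[mmul _ _]/(fmmul _ _) fmmulE.
Qed.

Lemma mult_tensor (x y : falg k I) : mult (tensor x y) = x * y.
Proof.
rewrite mult_bilift; apply: (@bilift_tensor k I (falg k I) (fun a b => a * b)).
- by move=> b c a a' /=; rewrite mulrDl -scalerAl.
- by move=> a c b b'; rewrite mulrDr; congr (_ + _); apply: esym; exact: malg_scalerAr.
Qed.

Lemma antipodeE x : antipode act q x = @anti k I F act q x.
Proof.
have h1 : linear (antipode act q) by exact: linext_is_linear.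
have h2 : linear (fun x : T => @anti k I F act q x : T).
  exact: (@linearP k F F _ (@anti k I F act q)).
have h3 u : antipode act q (mon u) = @anti k I F act q (mon u).
  rewrite /antipode linextU /=; elim: u => [|i u IH] /=.
    by rewrite mon_nil; apply: esym; exact: (@anti1 k I F).
  rewrite mon_cons; apply: esym; apply: etrans (@anti_genM k I F act q i (mon u)) _.
  rewrite -IH; move: (foldr _ _ _) => t; rewrite braidingE.
  apply: esym; apply: etrans (congr1 (@mult k I) (@braid_Ngen k I F act q i t)) _.
  exact: mult_tensor.
exact: (@linear_ext T (antipode act q) (fun x : T => @anti k I F act q x : T) h1 h2 h3 x).
Qed.

Lemma homogE n x :
  homog n x = linext (fun m : W => if fdeg m == n then << m >> else 0 : T) x.
Proof.
rewrite /homog big_mkcond; apply: eq_bigr => m _.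
by case: (fdeg m == n); [rewrite scale_malgU mulr1|apply: esym; exact: scaler0].
Qed.

Lemma homog_is_linear n : linear (@homog k I n).
Proof.
have -> : @homog k I n = linext (fun m : W => if fdeg m == n then << m >> else 0 : T).
  by apply: boolp.funext => x; exact: homogE.
exact: linext_is_linear.
Qed.

Lemma homog_mon n u : homog n (mon u) = if size u == n then mon u else 0.
Proof. by rewrite homogE; exact: linextU. Qed.

Lemma radical_homog n x : radical x -> radical (homog n x).
Proof.
pose h n : {linear F -> F} := HB.pack (@homog k I n)
  (GRing.isLinear.Build k F F *:%R (@homog k I n) (@homog_is_linear n)).
apply: (@radical_graded k I F act q h) => {n x} [n|i x|n i x].
- by rewrite -[1]/(1 : T) -mon_nil; apply: etrans (homog_mon _ _) _; case: n.
- move: x; apply: (linear_ext (f := fun x => homog 0%N (gen k i * x)) (g := fun _ => 0)) => [c x y|c x y|u].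
  + exact: (linearP (h 0%N \o lmul (ft_gen F i)) c x y).
  + by rewrite scaler0 addr0.
  by rewrite -mon_cons homog_mon.
move: x; apply: (linear_ext (f := fun x => homog n.+1 (gen k i * x))
  (g := fun x => gen k i * homog n x)) => [c x y|c x y|u].
- exact: (linearP (h n.+1 \o lmul (ft_gen F i)) c x y).
- exact: (linearP (lmul (ft_gen F i) \o h n) c x y).
rewrite -mon_cons !homog_mon /= eqSS; case: eqP => _; first exact: mon_cons.
by rewrite mulr0.
Qed.

(** It turns vanishing of the degree 1 part into a condition on derivations, as required by both
    inclusions of [nichols_radical]. *)
Lemma coef_gen i x : x@_(FMonom [:: i]) = @eps k I F (@der k I F act q i x).
Proof.
apply: (linear_ext (M := k^o) (f := mcoeff (FMonom [:: i]))
  (g := @eps k I F \o @der k I F act q i)) => [c y z||u].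
- by rewrite mcoeffD mcoeffZ.
- exact: (linearP (@eps k I F \o @der k I F act q i)).
rewrite /mon mcoeffU /=; case: u => [|j u].
  rewrite -/(mon _) mon_nil; apply: esym.
  by apply: etrans (congr1 (@eps k I F) (@der1 k I F act q i)) _; exact: linear0.
rewrite -/(mon (j :: u)) mon_cons; apply: esym.
apply: etrans (congr1 (@eps k I F) (@der_genM k I F act q i j (mon u))) _.
apply: etrans (linearD (@eps k I F) _ _) _.
rewrite (eps_genM (T := F)) (linZ (@eps k I F)) /= add0r.
rewrite (@eps_gact k I F) -counitE /counit /mon mcoeffU -[mone]/(fmone _) fmoneE.
rewrite !fmP /= eqseq_cons.
by case: eqP; rewrite ?scale1r ?scale0r.
Qed.

(** The radical is itself admissible, hence contained in the union of admissible ideals. Conversely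
    each admissible ideal satisfies [sub_radical], the degree condition supplying the vanishing of
    the counit after one derivation. *)
Lemma nichols_radical : nichols_ideal act q = radical.
Proof.
have adm : nichols_admissible act q radical.
  split; first split.
  - exact: (@radical_ideal k I F act q).
  - move=> x Jx; have [s [t [hs ht E]]] := @radical_coprod k I F act q act_rack q_rack x Jx.
    by exists s, t; split=> //; rewrite comulE.
  - by move=> x Jx; rewrite counitE; exact: (Jx [::]).
  - move=> x Jx; rewrite antipodeE.
    exact: (@radical_anti k I F act q act_inj act_rack q_rack x Jx).
  - have := @braid_radicall k I F act q act_inj q_neq0 act_rack q_rack.
    by have -> : (braiding act q : TT -> TT) = @braid k I F act q by apply: boolp.funext => t; exact: braidingE.
  - have := @braid_radicalr k I F act q act_inj q_neq0 act_rack q_rack.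
    by have -> : (braiding act q : TT -> TT) = @braid k I F act q by apply: boolp.funext => t; exact: braidingE.
  - by move=> n x; exact: radical_homog.
  - move=> x Jx [[|i [|j u]]] //; rewrite -mcoeff_neq0.
      by have := Jx [::]; rewrite /pairing /= -counitE /counit -fmoneE => ->; rewrite eqxx.
    by rewrite coef_gen (Jx [:: i] : @eps k I F (@der k I F act q i x) = 0) eqxx.
apply/seteqP; split=> [x [J admJ Jx]|]; last exact: nichols_ideal_max.
case: admJ => -[[J0 JD JM] Jc Je _ _ _] _ Jd.
apply: (@sub_radical k I F act q act_rack q_rack J) Jx => //.
- move=> c y z Jy Jz; apply: JD => //.
  by have := JM (c *: 1) y 1 Jy; rewrite mulr1 -scalerAl mul1r.
- move=> y /Jc[s [t [hs ht]]]; rewrite comulE => E; by exists s, t.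
- by move=> y /Je; rewrite counitE.
move=> i y Jy; rewrite -coef_gen; apply/eqP; apply: contraT.
by rewrite mcoeff_neq0 => /(Jd y Jy).
Qed.

End NicholsRadical.

(** * Rewriting noncommutative polynomials *)

(* [(a, b, n)] stands for [(a + b * w) * q ^ n], where [w] is a primitive cube
   root of unity and [q] is invertible. *)
Definition coef := (Z * Z * Z)%type.
Definition ncpoly := seq (coef * seq nat).
Definition rule := (seq nat * ncpoly)%type.

Definition cone : coef := (Zpos xH, Z0, Z0).

Definition coef_mul (c d : coef) : coef :=
  let: (a, b, n) := c in let: (a', b', n') := d in
  (Z.sub (Z.mul a a') (Z.mul b b'),
   Z.sub (Z.add (Z.mul a b') (Z.mul b a')) (Z.mul b b'), Z.add n n').

Definition coef_opp (c : coef) : coef := let: (a, b, n) := c in (Z.opp a, Z.opp b, n).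

(** The quadratic form is the norm of a + b w. *)
Definition coef_nonzero (c : coef) : bool :=
  let: (a, b, _) := c in
  ~~ Z.eqb (Z.add (Z.sub (Z.mul a a) (Z.mul a b)) (Z.mul b b)) Z0.

Fixpoint word_cmp (u v : seq nat) : comparison :=
  match u, v with
  | [::], [::] => Eq
  | [::], _ :: _ => Lt
  | _ :: _, [::] => Gt
  | i :: u', j :: v' => if Nat.compare i j is Eq then word_cmp u' v' else Nat.compare i j
  end.

(* Monomials are kept in decreasing lexicographic order. *)
Fixpoint ncadd1 (t : coef * seq nat) (p : ncpoly) : ncpoly :=
  match p with
  | [::] => [:: t]
  | s :: p' =>
    match word_cmp t.2 s.2 with
    | Gt => t :: p
    | Lt => s :: ncadd1 t p'
    | Eq =>
      let: (a, b, n) := t.1 in let: (a', b', n') := s.1 in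
      if Z.eqb n n' then
        let a'' := Z.add a a' in let b'' := Z.add b b' in
        if Z.eqb a'' Z0 && Z.eqb b'' Z0 then p' else (a'', b'', n, s.2) :: p'
      else s :: ncadd1 t p'
    end
  end.

Definition ncadd (p p' : ncpoly) : ncpoly := foldr ncadd1 p' p.

Definition ncmul1 (c : coef) (u : seq nat) (p : ncpoly) (v : seq nat) : ncpoly :=
  [seq (coef_mul c t.1, u ++ t.2 ++ v) | t <- p].

Definition ncopp (p : ncpoly) : ncpoly := [seq (coef_opp t.1, t.2) | t <- p].

Definition ncmul (p p' : ncpoly) : ncpoly :=
  foldr (fun t => ncadd (ncmul1 t.1 t.2 p' [::])) [::] p.

Fixpoint strip (u w : seq nat) : option (seq nat) :=
  match u, w with
  | [::], _ => Some w
  | i :: u', j :: w' => if eqn i j then strip u' w' else None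
  | _, _ => None
  end.

Fixpoint rewrite_head (rs : seq rule) (w : seq nat) : option ncpoly :=
  if rs is r :: rs' then
    if strip r.1 w is Some v then Some (ncmul1 cone [::] r.2 v)
    else rewrite_head rs' w
  else None.

(* [table] lists the rules according to the first letter of their left side. *)
Fixpoint rewrite_word (table : seq (seq rule)) (w : seq nat) : option ncpoly :=
  if w is i :: w' then
    if rewrite_head (nth [::] table i) w is Some p then Some p
    else omap (fun p => ncmul1 cone [:: i] p [::]) (rewrite_word table w')
  else None.

(** Exhausted fuel returns the rest unreduced, which is still congruent to the input; a fuel value
    that is too small could only make a check fail. *)
Fixpoint ncnf (table : seq (seq rule)) (fuel : nat) (p : ncpoly) : ncpoly :=
  if fuel is fuel'.+1 then
    if p is t :: p' then
      if rewrite_word table t.2 is Some p'' then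
        ncnf table fuel' (ncadd (ncmul1 t.1 [::] p'' [::]) p')
      else t :: ncnf table fuel' p'
    else [::]
  else p.

Arguments ncnf : simpl never.

Definition rule_table (rs : seq rule) : seq (seq rule) :=
  [seq [seq r <- rs | eqn (head 0 r.1) i] | i <- iota 0 10].

Section Evaluation.
Variables (k : fieldType) (w q : k).
Hypothesis w_root : w ^+ 2 + w + 1 = 0.
Hypothesis q_neq0 : q != 0.
Local Notation zr a := ((int_of_Z a)%:~R : k).

Lemma zrD a b : zr (Z.add a b) = zr a + zr b.
Proof. by rewrite -intrD; congr (_%:~R); exact: (raddfD int_of_Z). Qed.

Lemma zrN a : zr (Z.opp a) = - zr a.
Proof. by rewrite -intrN; congr (_%:~R); exact: (raddfN int_of_Z). Qed.

Lemma zrB a b : zr (Z.sub a b) = zr a - zr b.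
Proof. by rewrite /Z.sub zrD zrN. Qed.

Lemma zrM a b : zr (Z.mul a b) = zr a * zr b.
Proof. by rewrite -intrM; congr (_%:~R); exact: (rmorphM int_of_Z). Qed.

Lemma int_of_ZD a b : int_of_Z (Z.add a b) = int_of_Z a + int_of_Z b.
Proof. exact: (raddfD int_of_Z). Qed.

Definition coef_eval (c : coef) : k :=
  let: (a, b, n) := c in
  ((int_of_Z a)%:~R + (int_of_Z b)%:~R * w) * q ^ (int_of_Z n).

Lemma cone_eval : coef_eval cone = 1.
Proof. by rewrite /= mul0r addr0 !mulr1. Qed.

Lemma coef_evalM c d : coef_eval (coef_mul c d) = coef_eval c * coef_eval d.
Proof.
case: c d => [[a b] n] [[a' b'] n'] /=.
rewrite !(zrD, zrB, zrM) int_of_ZD expfzDr //.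
move: (zr a) (zr b) (zr a') (zr b') (q ^ int_of_Z n) (q ^ int_of_Z n') => x y z t u v.
apply/eqP; rewrite -subr_eq0; apply/eqP.
(* The term y t w^2 of the product is reduced by w^2 = - w - 1. *)
transitivity (- y * t * u * v * (w ^+ 2 + w + 1)); first by ring.
by rewrite w_root mulr0.
Qed.

Lemma coef_evalN c : coef_eval (coef_opp c) = - coef_eval c.
Proof.
case: c => [[a b] n] /=; rewrite -mulNr; congr (_ * _).
by rewrite !zrN mulNr opprD.
Qed.

Section Linear.
Variables (M : lmodType k) (wv : seq nat -> M).

Definition lceval (p : ncpoly) : M := \sum_(t <- p) coef_eval t.1 *: wv t.2.

Lemma lceval_nil : lceval [::] = 0.
Proof. exact: big_nil. Qed.

Lemma lceval_cons t p : lceval (t :: p) = coef_eval t.1 *: wv t.2 + lceval p.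
Proof. exact: big_cons. Qed.

Lemma lceval1 c u : lceval [:: (c, u)] = coef_eval c *: wv u.
Proof. by rewrite lceval_cons lceval_nil addr0. Qed.

Lemma word_cmp_eq u v : word_cmp u v = Eq -> u = v.
Proof.
elim: u v => [|i u IH] [|j v] //=; case E: (Nat.compare i j) => // /IH ->.
by rewrite (PeanoNat.Nat.compare_eq _ _ E).
Qed.

Lemma lceval_add1 t p : lceval (ncadd1 t p) = coef_eval t.1 *: wv t.2 + lceval p.
Proof.
elim: p => [|s p IH] /=; first by rewrite lceval_cons.
case E: (word_cmp _ _); rewrite ?lceval_cons ?IH //; last by rewrite addrCA.
move: t s E IH => [[[a b] n] u] [[[a' b'] n'] v] /= /word_cmp_eq <- IH.
case: Z.eqb_spec => [<-|_]; last by rewrite !lceval_cons IH addrCA.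
have Ec : coef_eval (a, b, n) + coef_eval (a', b', n) =
    coef_eval (Z.add a a', Z.add b b', n).
  by rewrite /coef_eval -mulrDl addrACA -mulrDl !zrD.
have Es : coef_eval (a, b, n) *: wv u + (coef_eval (a', b', n) *: wv u + lceval p) =
    coef_eval (Z.add a a', Z.add b b', n) *: wv u + lceval p.
  by rewrite addrA -scalerDl Ec.
case: ifP => [/andP[/Z.eqb_eq Ea /Z.eqb_eq Eb]|_]; rewrite ?lceval_cons Es //.
by rewrite Ea Eb /= mul0r addr0 mul0r scale0r add0r.
Qed.

Lemma lceval_add p p' : lceval (ncadd p p') = lceval p + lceval p'.
Proof.
elim: p => [|t p IH] /=; first by rewrite lceval_nil add0r.
by rewrite lceval_add1 IH lceval_cons addrA.
Qed.

Lemma lceval_opp p : lceval (ncopp p) = - lceval p.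
Proof.
elim: p => [|t p IH]; first by rewrite lceval_nil oppr0.
by rewrite /ncopp /= !lceval_cons -/(ncopp p) IH /= coef_evalN scaleNr opprD.
Qed.

End Linear.

Section Algebra.
Variables (A : algType k) (ev : nat -> A).

Definition word_eval (u : seq nat) : A := \prod_(i <- u) ev i.

Local Notation nceval := (lceval word_eval).

Lemma word_eval_cat u v : word_eval (u ++ v) = word_eval u * word_eval v.
Proof. exact: big_cat. Qed.

Lemma word_eval_nil : word_eval [::] = 1.
Proof. exact: big_nil. Qed.

Lemma word_eval1 i : word_eval [:: i] = ev i.
Proof. exact: big_seq1. Qed.

Lemma nceval_mul1 c u p v :
  nceval (ncmul1 c u p v) = coef_eval c *: (word_eval u * nceval p * word_eval v).
Proof.
elim: p => [|t p IH]; first by rewrite !lceval_nil mulr0 mul0r scaler0.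
rewrite /ncmul1 /= !lceval_cons -/(ncmul1 c u p v) IH /= mulrDr mulrDl scalerDr.
congr (_ + _); rewrite coef_evalM !word_eval_cat -scalerAr -scalerAl scalerA.
by rewrite mulrA.
Qed.

Lemma nceval_mul p p' : nceval (ncmul p p') = nceval p * nceval p'.
Proof.
elim: p => [|t p IH]; first by rewrite lceval_nil mul0r.
rewrite /= lceval_add IH nceval_mul1 word_eval_nil mulr1 lceval_cons mulrDl.
by rewrite scalerAl.
Qed.

Lemma strip_eq u v s : strip u v = Some s -> v = u ++ s.
Proof.
elim: u v => [|i u IH] [|j v] //=; try by case=> <-.
by case: eqnP => // <- /IH ->.
Qed.

Variable J : set A.
Hypothesis J_ideal : two_sided_ideal J.

Definition rule_holds (r : rule) : Prop := J (word_eval r.1 - nceval r.2).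
Definition rules_hold (rs : seq rule) : Prop := forall r, List.In r rs -> rule_holds r.

Lemma rules_hold_cat rs rs' : rules_hold rs -> rules_hold rs' -> rules_hold (rs ++ rs').
Proof.
elim: rs => [|r rs IH] //= hrs hrs' r' [<-|hr]; first by apply: hrs; left.
by apply: IH => // r'' ?; apply: hrs; right.
Qed.

Definition table_holds (table : seq (seq rule)) : Prop :=
  forall i, rules_hold (nth [::] table i).

Lemma ideal0 : J 0. Proof. by case: J_ideal. Qed.

Lemma idealD x y : J x -> J y -> J (x + y).
Proof. by case: J_ideal => _ h _; exact: h. Qed.

Lemma idealM a x b : J x -> J (a * x * b).
Proof. by case: J_ideal => _ _ h; exact: h. Qed.

Lemma idealZ c x : J x -> J (c *: x).
Proof. by move=> Jx; have := idealM (c *: 1) 1 Jx; rewrite mulr1 -scalerAl mul1r. Qed.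

Lemma idealN x : J x -> J (- x).
Proof. by rewrite -scaleN1r; exact: idealZ. Qed.

Lemma ideal_trans y x z : J (x - y) -> J (y - z) -> J (x - z).
Proof. by move=> h1 h2; have := idealD h1 h2; rewrite addrA subrK. Qed.

Lemma ideal_congM a b x y : J (x - y) -> J (a * x * b - a * y * b).
Proof. by move=> h; rewrite -mulrBl -mulrBr; exact: idealM. Qed.

Lemma ideal_congl x y : J (x - y) -> J x <-> J y.
Proof.
move=> h; split=> [Jx|Jy]; last by rewrite -[x](subrK y); exact: idealD.
by rewrite -[y](subKr x); apply: idealD => //; exact: idealN.
Qed.

Lemma cone_scale (x : A) : coef_eval cone *: x = x.
Proof. by rewrite cone_eval scale1r. Qed.

Lemma rewrite_headP rs u p : rules_hold rs -> rewrite_head rs u = Some p ->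
  J (word_eval u - nceval p).
Proof.
elim: rs => [|r rs IH] //= hrs; case E: (strip _ _) => [v|].
  case=> <-; rewrite (strip_eq E) word_eval_cat nceval_mul1 cone_scale.
  rewrite word_eval_nil -[X in J (X * _ - _)]mul1r; apply: ideal_congM.
  by apply: hrs; left.
by apply: IH => r' hr'; apply: hrs; right.
Qed.

Lemma rewrite_wordP table u p : table_holds table -> rewrite_word table u = Some p ->
  J (word_eval u - nceval p).
Proof.
move=> ht; elim: u p => [|i u IH] p //=.
case E: (rewrite_head _ _) => [p'|]; first by case=> <-; apply: rewrite_headP E; exact: ht.
case E': (rewrite_word _ _) => [p'|] //= [<-].
rewrite -cat1s word_eval_cat nceval_mul1 cone_scale word_eval_nil mulr1.
by rewrite -mulrBr -[X in J X]mulr1; apply: idealM; exact: IH.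
Qed.

Lemma ncnfP table fuel p : table_holds table -> J (nceval p - nceval (ncnf table fuel p)).
Proof.
move=> ht; elim: fuel p => [|f IH] [|t p]; rewrite ?subrr; try exact: ideal0.
rewrite [ncnf _ _ _]/ncnf -/ncnf.
case E: (rewrite_word _ _) => [p'|]; last first.
  by rewrite !lceval_cons opprD addrACA subrr add0r; exact: IH.
apply: ideal_trans (IH _); rewrite lceval_add nceval_mul1 lceval_cons.
rewrite opprD addrACA subrr addr0 word_eval_nil mul1r mulr1 -scalerBr; apply: idealZ.
exact: rewrite_wordP E.
Qed.

Lemma rule_tableP rs : rules_hold rs -> table_holds (rule_table rs).
Proof.
move=> hrs i r; case: (ltnP i 10) => hi; last first.
  by rewrite nth_default // size_map size_iota.
rewrite (nth_map 0%N) ?size_iota // nth_iota // => hin; apply: hrs.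
elim: rs hin => //= r' rs IH; case: ifP => _ /=; last by right; exact: IH.
by case=> [->|/IH]; [left|right].
Qed.

Definition is_nil (p : ncpoly) : bool := if p is [::] then true else false.

Lemma nf_nil_holds table fuel p : table_holds table -> is_nil (ncnf table fuel p) ->
  J (nceval p).
Proof.
move=> ht; have := ncnfP fuel p ht; case: (ncnf _ _ _) => // h _.
by rewrite lceval_nil subr0 in h.
Qed.

(* [(u, j, c, r)]: rewriting the word [u] at positions [0] and [j] and normalizing
   the difference yields [c] times the new rule [r]. *)
Definition overlap := (seq nat * nat * coef * rule)%type.

Definition overlap_check (fuel : nat) (rs : seq rule) (o : overlap) : bool :=
  let: (u, j, c, r) := o in
  match rewrite_head rs u, rewrite_head rs (drop j u) with
  | Some p1, Some p2 => coef_nonzero c &&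
    is_nil (ncnf (rule_table rs) fuel
      (ncadd p1 (ncadd (ncopp (ncmul1 cone (take j u) p2 [::]))
        (ncadd [:: (coef_opp c, r.1)] (ncmul1 c [::] r.2 [::])))))
  | _, _ => false
  end.

Hypothesis k_char0 : [pchar k] =i pred0.

Lemma coef_eval_neq0 c : coef_nonzero c -> coef_eval c != 0.
Proof.
case: c => [[a b] n] /=; rewrite mulf_eq0 negb_or => hn.
rewrite expfz_neq0 // andbT; apply: contraNneq hn => e0.
have : zr (Z.add (Z.sub (Z.mul a a) (Z.mul a b)) (Z.mul b b)) = 0.
  rewrite !(zrD, zrB, zrM).
  (* The second factor is a + b w^2, the conjugate of a + b w. *)
  transitivity ((zr a + zr b * w) * (zr a - zr b - zr b * w) +
    zr b * zr b * (w ^+ 2 + w + 1)); first by ring.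
  by rewrite e0 w_root mul0r mulr0 addr0.
move: (Z.add _ _) => d /eqP.
have -> : (zr d == 0) = (int_of_Z d == 0).
  case: (int_of_Z d) => m; first exact: ((pcharf0P _).1 k_char0).
  by rewrite NegzE mulrNz !oppr_eq0; exact: ((pcharf0P _).1 k_char0).
by move=> /eqP d0; rewrite -[d]int_of_ZK d0.
Qed.

(** Both reductions are congruent to the overlap word, so their difference lies in J; since c is
    invertible, the rule follows after division by c. *)
Lemma overlapP fuel rs o : rules_hold rs -> overlap_check fuel rs o -> rule_holds o.2.
Proof.
case: o => [[[u j] c] r] hrs /=.
case E1: (rewrite_head rs u) => [p1|] //; case E2: (rewrite_head _ _) => [p2|] //.
case/andP => /coef_eval_neq0 hc /(nf_nil_holds (rule_tableP hrs)).
rewrite !lceval_add lceval_add1 lceval_opp !nceval_mul1 /= cone_scale word_eval_nil.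
rewrite mul1r !mulr1 coef_evalN scaleNr addrA => h.
have h1 := rewrite_headP hrs E1; have h2 := rewrite_headP hrs E2.
have hu : J (nceval p1 - word_eval (take j u) * nceval p2).
  apply: (ideal_trans (y := word_eval u)); first by rewrite -opprB; exact: idealN.
  rewrite -{1}(cat_take_drop j u) word_eval_cat -mulrBr -[X in J X]mulr1.
  exact: idealM.
have {h}h : J (coef_eval c *: (word_eval r.1 - nceval r.2)).
  by have := idealD (idealN h) hu; rewrite opprD addrAC addNr add0r opprD opprK scalerBr.
by have := idealZ (coef_eval c)^-1 h; rewrite scalerA mulVf // scale1r.
Qed.

(** Every accepted rule is available to the later overlaps, so the list is a derivation whose order
    matters. *)
Fixpoint overlaps_check (fuel : nat) (rs : seq rule) (os : seq overlap) : bool :=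
  if os is o :: os' then
    overlap_check fuel rs o && overlaps_check fuel (o.2 :: rs) os'
  else true.

Lemma overlapsP fuel rs os : rules_hold rs -> overlaps_check fuel rs os ->
  rules_hold (rs ++ [seq o.2 | o <- os]).
Proof.
elim: os rs => [|o os IH] rs hrs; first by rewrite cats0.
case/andP => /(overlapP hrs) ho /IH h r hin.
apply: h => [r' [<-|/hrs]|] //.
move: hin; rewrite !List.in_app_iff /= List.in_app_iff; tauto.
Qed.

End Algebra.
End Evaluation.

(** * The relations and their consequences *)

Section RewritingData.
Local Open Scope nat_scope.

Definition cz (a b n : Z) : coef := (a, b, n).
Arguments cz : simpl never.

(* The letters 0, ..., 9 stand for x_4, x_14, x_24, x_34, x_124, x_124134,
   x_134, x_1, x_2, x_3. *)
Definition hv_base_rules : seq rule :=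
  [:: ([:: 7; 0], [:: (cz 1 0 0, [:: 1]); (cz 1 0 1, [:: 0; 7])]);
      ([:: 8; 0], [:: (cz 1 0 0, [:: 2]); (cz 1 0 1, [:: 0; 8])]);
      ([:: 9; 0], [:: (cz 1 0 0, [:: 3]); (cz 1 0 1, [:: 0; 9])]);
      ([:: 7; 2], [:: (cz 1 0 0, [:: 4]); (cz (-1) 0 1, [:: 3; 7])]);
      ([:: 7; 3], [:: (cz 1 0 0, [:: 6]); (cz (-1) 0 1, [:: 2; 7])]);
      ([:: 6; 4], [:: (cz 0 1 0, [:: 5]); (cz 0 (-1) 0, [:: 4; 6])]);
      ([:: 7; 7], [::]);
      ([:: 8; 8], [::]);
      ([:: 9; 9], [::]);
      ([:: 9; 7], [:: (cz (-1) 0 0, [:: 8; 9]); (cz (-1) 0 0, [:: 7; 8])]);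
      ([:: 9; 8], [:: (cz (-1) 0 0, [:: 8; 7]); (cz (-1) 0 0, [:: 7; 9])]);
      ([:: 0; 0; 0; 0; 0; 0], [::]);
      ([:: 8; 1], [:: (cz 0 1 0, [:: 6]); (cz (-1) 0 1, [:: 3; 8])]);
      ([:: 9; 1], [:: (cz 0 1 0, [:: 4]); (cz (-1) 0 1, [:: 2; 9])]);
      ([:: 1; 0], [:: (cz 1 1 1, [:: 0; 1])]);
      ([:: 2; 0], [:: (cz 1 1 1, [:: 0; 2])]);
      ([:: 3; 0], [:: (cz 1 1 1, [:: 0; 3])])].

(** Certificates of the completion, found by computation and only verified here. Among the
    consequences are the vanishing squares of x_h4, x_124 and x_134, and the commutation of x_124134
    with the other letters up to scalars and lower terms. *)
Definition hv_overlaps : seq overlap :=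
  [:: ([:: 7; 7; 0], 1, cz (-1) 0 0,
       ([:: 7; 1], [:: (cz (-1) 0 1, [:: 1; 7])]));
      ([:: 8; 8; 0], 1, cz (-1) 0 0,
       ([:: 8; 2], [:: (cz (-1) 0 1, [:: 2; 8])]));
      ([:: 9; 9; 0], 1, cz (-1) 0 0,
       ([:: 9; 3], [:: (cz (-1) 0 1, [:: 3; 9])]));
      ([:: 9; 7; 0], 1, cz (-1) 0 0,
       ([:: 8; 3], [:: (cz (-1) (-1) 0, [:: 4]); (cz (-1) 0 1, [:: 1; 8])]));
      ([:: 9; 8; 0], 1, cz (-1) 0 0,
       ([:: 9; 2], [:: (cz (-1) (-1) 0, [:: 6]); (cz (-1) 0 1, [:: 1; 9])]));
      ([:: 9; 7; 7], 1, cz 1 0 0,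
       ([:: 8; 7; 8], [:: (cz 1 0 0, [:: 7; 8; 7])]));
      ([:: 8; 1; 0], 1, cz 0 1 0,
       ([:: 6; 0], [:: (cz (-1) (-1) 1, [:: 3; 2]); (cz 0 (-1) 1, [:: 2; 1]); (cz 1 1 2, [:: 0; 6])]));
      ([:: 9; 1; 0], 1, cz 0 1 0,
       ([:: 4; 0], [:: (cz 0 (-1) 1, [:: 3; 1]); (cz (-1) (-1) 1, [:: 2; 3]); (cz 1 1 2, [:: 0; 4])]));
      ([:: 7; 2; 0], 1, cz (-1) (-1) 1,
       ([:: 3; 1], [:: (cz (-1) 0 0, [:: 2; 3]); (cz (-1) 0 0, [:: 1; 2])]));
      ([:: 7; 3; 0], 1, cz (-1) (-1) 1,
       ([:: 3; 2], [:: (cz (-1) 0 0, [:: 2; 1]); (cz (-1) 0 0, [:: 1; 3])]));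
      ([:: 7; 1; 0], 1, cz (-2) (-1) 1,
       ([:: 1; 1], [::]));
      ([:: 8; 2; 0], 1, cz (-2) (-1) 1,
       ([:: 2; 2], [::]));
      ([:: 9; 3; 0], 1, cz (-2) (-1) 1,
       ([:: 3; 3], [::]));
      ([:: 7; 7; 2], 1, cz (-1) 0 0,
       ([:: 7; 4], [:: (cz 1 0 1, [:: 6; 7])]));
      ([:: 7; 7; 3], 1, cz (-1) 0 0,
       ([:: 7; 6], [:: (cz 1 0 1, [:: 4; 7])]));
      ([:: 9; 7; 2], 1, cz (-1) 0 0,
       ([:: 9; 4], [:: (cz 1 1 0, [:: 8; 6]); (cz 0 1 1, [:: 6; 9]); (cz 1 0 1, [:: 4; 8])]));
      ([:: 9; 7; 3], 1, cz (-1) 0 0,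
       ([:: 9; 6], [:: (cz (-1) (-1) 1, [:: 4; 9])]));
      ([:: 8; 8; 1], 1, cz 0 (-1) 0,
       ([:: 8; 6], [:: (cz 0 1 1, [:: 4; 8])]));
      ([:: 9; 7; 1], 1, cz 0 (-1) 0,
       ([:: 8; 4], [:: (cz (-1) (-1) 1, [:: 6; 8])]));
      ([:: 7; 3; 1], 1, cz 1 0 0,
       ([:: 6; 1], [:: (cz (-1) 0 0, [:: 4; 3]); (cz 1 0 1, [:: 3; 6]); (cz 1 0 1, [:: 1; 4])]));
      ([:: 9; 3; 1], 1, cz (-1) (-1) 0,
       ([:: 6; 3], [:: (cz 1 1 0, [:: 4; 2]); (cz (-1) (-1) 1, [:: 3; 4]); (cz 1 0 1, [:: 2; 6])]));
      ([:: 8; 3; 1], 1, cz 0 1 0,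
       ([:: 6; 2], [:: (cz 0 (-1) 0, [:: 4; 1]); (cz 0 1 1, [:: 2; 4]); (cz 1 0 1, [:: 1; 6])]));
      ([:: 7; 3; 2], 1, cz 1 (-1) 0,
       ([:: 4; 1], [:: (cz 1 0 1, [:: 2; 4])]));
      ([:: 9; 3; 2], 1, cz 1 2 0,
       ([:: 4; 3], [:: (cz 1 0 1, [:: 1; 4])]));
      ([:: 8; 3; 2], 1, cz (-2) (-1) 0,
       ([:: 4; 2], [:: (cz 1 0 1, [:: 3; 4])]));
      ([:: 3; 1; 1], 1, cz 1 0 0,
       ([:: 2; 1; 2], [:: (cz 1 0 0, [:: 1; 2; 1])]));
      ([:: 9; 6; 1], 1, cz 1 (-1) 1,
       ([:: 4; 4], [::]));
      ([:: 8; 4; 1], 1, cz 1 0 1,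
       ([:: 6; 6], [::]));
      ([:: 6; 4; 0], 1, cz 0 1 0,
       ([:: 5; 0], [:: (cz (-2) (-1) 3, [:: 2; 3; 6]); (cz (-1) 1 3, [:: 1; 2; 6]); (cz 0 1 4, [:: 0; 5])]));
      ([:: 7; 6; 4], 1, cz 0 (-1) 0,
       ([:: 7; 5], [:: (cz 0 1 2, [:: 5; 7]); (cz (-1) (-2) 2, [:: 4; 6; 7])]));
      ([:: 9; 6; 4], 1, cz 0 (-1) 0,
       ([:: 9; 5], [:: (cz 0 1 2, [:: 5; 9]); (cz (-1) (-2) 2, [:: 4; 6; 9])]));
      ([:: 8; 6; 4], 1, cz 0 (-1) 0,
       ([:: 8; 5], [:: (cz 0 1 2, [:: 5; 8]); (cz (-1) (-2) 2, [:: 4; 6; 8])]));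
      ([:: 6; 4; 1], 1, cz 0 1 0,
       ([:: 5; 1], [:: (cz 1 0 2, [:: 1; 5])]));
      ([:: 6; 4; 3], 1, cz 0 1 0,
       ([:: 5; 3], [:: (cz 1 0 2, [:: 3; 5])]));
      ([:: 6; 4; 2], 1, cz 0 1 0,
       ([:: 5; 2], [:: (cz 1 0 2, [:: 2; 5])]));
      ([:: 6; 4; 4], 1, cz 0 1 0,
       ([:: 5; 4], [:: (cz 0 1 0, [:: 4; 5])]));
      ([:: 6; 6; 4], 1, cz 0 (-1) 0,
       ([:: 6; 5], [:: (cz 0 1 0, [:: 5; 6])]))].

Definition hv_cube_rule : rule := ([:: 5; 5; 5], [::]).

Definition hv_rules : seq rule := hv_base_rules ++ [seq o.2 | o <- hv_overlaps].

(** This table leaves out the cube of x_124134: with it that cube is shown to lie in the radical,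
    after which [hv_table] becomes available. *)
Definition hv_table0 := Eval vm_compute in rule_table hv_rules.
Definition hv_table := Eval vm_compute in rule_table (hv_cube_rule :: hv_rules).

Definition nfw (w : seq nat) : ncpoly := ncnf hv_table 2000 [:: (cone, w)].

Lemma hv_overlaps_checked : overlaps_check 1000 hv_base_rules hv_overlaps.
Proof. by vm_compute. Qed.

(* [None] stands for the derivation and automorphism attached to x_4, and
   [Some j] for those attached to x_(j+1). *)
Definition xlet (i : nat) : nat := 7 + i %% 3.
Definition x4let (i : nat) : nat := 1 + i %% 3.

(* x_ij4 in terms of the letters, with i and j shifted by one. *)
Definition xij4let (i j : nat) : ncpoly :=
  [:: (cz 1 0 0, [:: xlet i; x4let j]); (cz 1 0 1, [:: x4let (2 * i + 2 * j); xlet i])].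

Definition zlet (p p' : ncpoly) : ncpoly :=
  ncadd (ncmul p p') (ncmul1 (cz (-1) (-1) 0) [::] (ncmul p' p) [::]).

(** The automorphism of x_4 scales every letter, and the list contains its eigenvalues. Those of
    x_1, x_2, x_3 permute the x_h and the x_h4 up to scalars, but may send x_124 to some x_ij4 that
    is not a letter; hence polynomial values. *)
Definition gact_letter (d : option nat) (l : nat) : ncpoly :=
  match d with
  | None => [:: (nth cone [:: cz 1 1 0; cz 1 0 (-1); cz 1 0 (-1); cz 1 0 (-1);
      cz 0 (-1) (-2); cz (-1) (-1) (-4); cz 0 (-1) (-2); cz 0 (-1) (-1);
      cz 0 (-1) (-1); cz 0 (-1) (-1)] l, [:: l])]
  | Some j =>
    let g4 i h := ncmul1 (cz 1 0 1) [::] (xij4let (2 * j + 2 * i) (2 * j + 2 * h)) [::] in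
    match l with
    | 0 => [:: (cz 1 0 1, [:: 0])]
    | 1 | 2 | 3 => [:: (cz (-1) 0 1, [:: x4let (2 * j + 2 * (l - 1))])]
    | 4 => g4 0 1
    | 5 => zlet (g4 0 1) (g4 0 2)
    | 6 => g4 0 2
    | _ => [:: (cz (-1) 0 0, [:: xlet (2 * j + 2 * (l - 7))])]
    end
  end.

Definition gact_word (d : option nat) (w : seq nat) : ncpoly :=
  foldr (fun l => ncmul (gact_letter d l)) [:: (cone, [::])] w.

(** The values on letters are a parameter so that the same recursion can first produce the
    derivative of the letter 5 from those of 4 and 6. The test on [dl l] avoids expanding
    automorphisms that would be multiplied by zero. *)
Definition der_step (dl : nat -> ncpoly) (d : option nat) : seq nat -> ncpoly :=
  fix loop w := if w is l :: w' then
    let p := ncmul1 cone [:: l] (loop w') [::] in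
    if dl l is [::] then p else ncadd p (ncmul (dl l) (gact_word d w'))
  else [::].

Definition der_xij4 (i j : nat) : ncpoly :=
  [:: (cz 1 1 0, [:: xlet i; xlet j]); (cz 1 0 0, [:: xlet (2 * i + 2 * j); xlet i])].

(** The value at letter 5 is a placeholder, replaced in [der_letter]. *)
Definition der_letter0 (d : option nat) (l : nat) : ncpoly :=
  match d with
  | None =>
    match l with
    | 0 => [:: (cone, [::])]
    | 1 | 2 | 3 => [:: (cz 1 1 0, [:: xlet (l - 1)])]
    | 4 => der_xij4 0 1
    | 6 => der_xij4 0 2
    | _ => [::]
    end
  | Some j => if eqn l (xlet j) then [:: (cone, [::])] else [::]
  end.

Definition der_letter (d : option nat) (l : nat) : ncpoly :=
  if l is 5 then
    ncadd (der_step (der_letter0 d) d [:: 4; 6])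
      (ncmul1 (cz (-1) (-1) 0) [::] (der_step (der_letter0 d) d [:: 6; 4]) [::])
  else der_letter0 d l.

Definition der_poly (d : option nat) (p : ncpoly) : ncpoly :=
  foldr (fun t => ncadd (ncmul1 t.1 [::] (der_step (der_letter d) d t.2) [::])) [::] p.

Definition letters_ok (p : ncpoly) : bool := all (fun t => all (fun l => l < 10) t.2) p.

Fixpoint ders_poly (table : seq (seq rule)) (ds : seq (option nat)) (p : ncpoly) :
    option ncpoly :=
  if ds is d :: ds' then
    if letters_ok p then ders_poly table ds' (ncnf table 2000 (der_poly d p)) else None
  else Some p.

Definition hv_relation_polys : seq ncpoly :=
  [:: [:: (cone, [:: 7; 7])]; [:: (cone, [:: 8; 8])]; [:: (cone, [:: 9; 9])];
      [:: (cone, [:: 7; 8]); (cone, [:: 9; 7]); (cone, [:: 8; 9])];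
      [:: (cone, [:: 8; 7]); (cone, [:: 7; 9]); (cone, [:: 9; 8])];
      [:: (cone, [:: 0; 0; 0; 0; 0; 0])];
      [:: (cone, [:: 5; 5; 5])];
      [:: (cone, [:: 8; 1]); (cz 1 0 1, [:: 3; 8]); (cz 0 (-1) 0, [:: 6])];
      [:: (cone, [:: 9; 1]); (cz 1 0 1, [:: 2; 9]); (cz 0 (-1) 0, [:: 4])];
      [:: (cone, [:: 0; 1]); (cz 0 1 (-1), [:: 1; 0])];
      [:: (cone, [:: 0; 2]); (cz 0 1 (-1), [:: 2; 0])];
      [:: (cone, [:: 0; 3]); (cz 0 1 (-1), [:: 3; 0])]].

Definition all_der_nil (table : seq (seq rule)) (p : ncpoly) : bool :=
  [&& letters_ok p, all (fun t => ~~ nilp t.2) p &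
    all (fun d => is_nil (ncnf table 2000 (der_poly d p)))
      [:: None; Some 0; Some 1; Some 2]].

(** Its degree in the generators is 5 + 8 + 18 + 4 = 35, so 35 derivations bring it down to a
    scalar. *)
Definition top_word : seq nat := [:: 0; 0; 0; 0; 0; 1; 2; 1; 3; 4; 5; 5; 6; 7; 8; 7; 9].
(* [0] stands for the derivation of x_4 and [j] for that of x_j. *)
Definition top_ders : seq (option nat) :=
  [seq if d is j.+1 then Some j else None | d <-
    [:: 1; 2; 1; 3; 0; 1; 2; 0; 1; 3; 0; 1; 2; 0; 1; 3; 0; 1; 2; 0; 1; 3; 0; 1; 0; 2;
        0; 1; 0; 3; 0; 0; 0; 0; 0]].

End RewritingData.

Section HV.
Variables (k : fieldType) (q1 q2 : k).
Hypothesis k_char0 : [pchar k] =i pred0.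
Hypothesis q1_neq0 : q1 != 0.
Hypothesis q2_neq0 : q2 != 0.
Hypothesis omega_prim : 3.-primitive_root (- (q1 * q2)).
Variable T : free_tensor k hv_index.

Local Notation w := (hv_omega q1 q2).

Lemma omega_root : w ^+ 2 + w + 1 = 0.
Proof.
have w3 : w ^+ 3 = 1 by exact: prim_expr_order.
have w1 : w != 1.
  by have := eq_prim_root_expr omega_prim 1 0; rewrite expr1 expr0 => ->.
have /eqP : (w - 1) * (w ^+ 2 + w + 1) = 0.
  by transitivity (w ^+ 3 - 1); [ring|rewrite w3 subrr].
by rewrite mulf_eq0 subr_eq0 (negbTE w1) => /eqP.
Qed.

(** This eliminates q_2, so that coefficients need only ω and powers of q_1. *)
Lemma q2E : q2 = - w * q1^-1.
Proof. by rewrite /hv_omega opprK mulrAC mulfV // mul1r. Qed.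

Definition ax (i : 'Z_3) : T := ft_gen T (Some i).
Definition ax4 : T := ft_gen T None.
Definition axh4 (h : 'Z_3) : T := ax h * ax4 - q1 *: (ax4 * ax h).
Definition axij4 (i j : 'Z_3) : T :=
  ax i * axh4 j + q1 *: (axh4 (2 * i - j) * ax i).
Definition axz : T := axij4 1 2 * axij4 1 3 + w ^+ 2 *: (axij4 1 3 * axij4 1 2).

Definition arels : seq T :=
  [:: ax 1 ^+ 2; ax 2 ^+ 2; ax 3 ^+ 2;
      ax 1 * ax 2 + ax 3 * ax 1 + ax 2 * ax 3;
      ax 2 * ax 1 + ax 1 * ax 3 + ax 3 * ax 2;
      ax4 ^+ 6;
      axz ^+ 3;
      axij4 2 1 - w *: axij4 1 (2 - 2);
      axij4 3 1 - w *: axij4 1 (2 - 3);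
      ax4 * axh4 1 - q2 *: (axh4 1 * ax4);
      ax4 * axh4 2 - q2 *: (axh4 2 * ax4);
      ax4 * axh4 3 - q2 *: (axh4 3 * ax4)].

Definition ev (l : nat) : T :=
  match l with
  | 0 => ax4 | 1 => axh4 1 | 2 => axh4 2 | 3 => axh4 3
  | 4 => axij4 1 2 | 5 => axz | 6 => axij4 1 3
  | 7 => ax 1 | 8 => ax 2 | _ => ax 3
  end.

Local Notation wev := (word_eval ev).
Local Notation nev := (lceval w q1 wev).

Local Notation ce := (coef_eval w q1).

(** A tuple of equations, so that one [rewrite] selects whichever applies. *)
Lemma coef_eval_cz :
  ((ce (cz 1 0 0) = 1)%R *
   (ce (cz 1 0 1) = q1)%R *
   (ce (cz (-1) 0 1) = - q1)%R *
   (ce (cz (-1) 0 0) = -1)%R *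
   (ce (cz 0 1 0) = w)%R *
   (ce (cz 0 (-1) 0) = - w)%R *
   (ce (cz 1 1 1) = (1 + w) * q1)%R *
   (ce (cz 1 1 0) = 1 + w)%R *
   (ce (cz 1 0 (-1)) = q1^-1)%R *
   (ce (cz 0 (-1) (-2)) = - w * q1 ^- 2)%R *
   (ce (cz (-1) (-1) (-4)) = - (1 + w) * q1 ^- 4)%R *
   (ce (cz 0 (-1) (-1)) = - w * q1^-1)%R *
   (ce (cz (-1) (-1) 0) = - (1 + w))%R *
   (ce (cz 0 1 (-1)) = w * q1^-1)%R *
   (ce cone = 1)%R)%type.
Proof.
have z0 : int_of_Z 0 = 0 by [].
have z1 : int_of_Z 1 = 1 by [].
have zN1 : int_of_Z (-1) = -1 by [].
have zN2 : int_of_Z (-2) = - 2%:Z by [].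
have zN4 : int_of_Z (-4) = - 4%:Z by [].
do ?split; rewrite /coef_eval /cz /cone ?z0 ?z1 ?zN1 ?zN2 ?zN4 ?expr0z ?expr1z
  ?exprN1 -?exprnN ?mulrN1z ?mulr1z ?mulr0z ?mul0r ?addr0 ?add0r ?mulr1 ?mul1r
  ?mulN1r ?opprD //.
Qed.

Lemma wev_cons i u : wev (i :: u) = ev i * wev u.
Proof. exact: big_cons. Qed.

Lemma omega3 : w ^+ 3 = 1.
Proof. exact: prim_expr_order. Qed.

Lemma one_plus_omega : 1 + w = - w ^+ 2.
Proof. by apply/eqP; rewrite -addr_eq0 -omega_root; apply/eqP; ring. Qed.

Lemma q2V : (1 + w) * q1 = q2^-1.
Proof.
apply: (mulIf q2_neq0); rewrite mulVf // one_plus_omega -omega3 /hv_omega.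
by ring.
Qed.

Lemma axij4_12 : axij4 1 2 = ax 1 * axh4 2 + q1 *: (axh4 3 * ax 1).
Proof. by rewrite /axij4 (_ : 2 * 1 - 2 = 3) //; apply: val_inj. Qed.
Lemma axij4_13 : axij4 1 3 = ax 1 * axh4 3 + q1 *: (axh4 2 * ax 1).
Proof. by rewrite /axij4 (_ : 2 * 1 - 3 = 2) //; apply: val_inj. Qed.
Lemma axij4_21 : axij4 2 1 = ax 2 * axh4 1 + q1 *: (axh4 3 * ax 2).
Proof. by rewrite /axij4 (_ : 2 * 2 - 1 = 3) //; apply: val_inj. Qed.
Lemma axij4_31 : axij4 3 1 = ax 3 * axh4 1 + q1 *: (axh4 2 * ax 3).
Proof. by rewrite /axij4 (_ : 2 * 3 - 1 = 2) //; apply: val_inj. Qed.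

Section BaseRules.
Variable J : set T.
Hypothesis J_ideal : two_sided_ideal J.

(** These rules are equalities in T: they solve the definitions of x_h4, x_124, x_134 and x_124134
    for the leading word. In the last case multiplying by ω turns the coefficient ω^2 into 1. *)
Lemma letter_rules_hold : rules_hold w q1 ev J (take 6 hv_base_rules).
Proof.
have J0 : J 0 by case: J_ideal.
rewrite /hv_base_rules => r [|[|[|[|[|[|[]]]]]]] <-;
  rewrite /rule_holds /fst /snd ?(lceval_cons, lceval_nil) /fst /snd ?coef_eval_cz
    ?(wev_cons, word_eval_nil) ?mulr1 ?addr0 ?subr0 ?scale1r.
- by rewrite /axh4 subrK subrr.
- by rewrite /axh4 subrK subrr.
- by rewrite /axh4 subrK subrr.
- by rewrite /ev axij4_12 scaleNr addrK subrr.
- by rewrite /ev axij4_13 scaleNr addrK subrr.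
- rewrite /ev /axz scalerDr scalerA -exprS omega3 scale1r (scaleNr w).
  by rewrite (addrC (w *: _)) addrK subrr.
Qed.

Lemma quadratic_rules_hold : (forall i, (i < 6)%N -> J (nth 0 arels i)) ->
  rules_hold w q1 ev J (take 12 hv_base_rules).
Proof.
move=> h; have J' i x : (i < 6)%N -> x = nth 0 arels i -> J x by move=> ? ->; exact: h.
rewrite -(cat_take_drop 6 (take 12 _)); apply: (rules_hold_cat letter_rules_hold).
move=> r; case=> [|[|[|[|[|[|[]]]]]]] <-;
  rewrite /rule_holds /fst /snd ?(lceval_cons, lceval_nil) /fst /snd ?coef_eval_cz
    ?(wev_cons, word_eval_nil) ?mulr1 ?addr0 ?subr0.
- exact: (h 0).
- exact: (h 1).
- exact: (h 2).
- apply: (J' 3) => //=.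
  by rewrite !scaleN1r opprD !opprK addrA addrC addrA.
- apply: (J' 4) => //=.
  by rewrite !scaleN1r opprD !opprK addrC.
- by apply: (J' 5) => //=; rewrite !exprS expr0 mulr1.
Qed.

Hypothesis J_rels : forall i, (i < 12)%N -> i != 6 -> J (nth 0 arels i).

(** The cube of x_124134, at index 6, is left out on purpose: the consequences of the other eleven
    relations serve to place it in the radical. *)
Lemma base_rules_hold : rules_hold w q1 ev J hv_base_rules.
Proof.
have JZ c x : J x -> J (c *: x) by exact: idealZ.
have J' i x : (i < 12)%N -> i != 6 -> x = nth 0 arels i -> J x by move=> ? ? ->; exact: J_rels.
rewrite -(cat_take_drop 12 hv_base_rules); apply: rules_hold_cat.
  by apply: quadratic_rules_hold => i hi; apply: J_rels; [exact: leq_trans hi _|case: eqP hi => // ->].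
move=> r; case=> [|[|[|[|[|[]]]]]] <-;
  rewrite /rule_holds /fst /snd ?(lceval_cons, lceval_nil) /fst /snd ?coef_eval_cz
    ?(wev_cons, word_eval_nil) ?mulr1 ?addr0 ?subr0 ?scale1r.
- apply: (J' 7) => //; rewrite /= (_ : 2 - 2 = 3) //; last exact: val_inj.
  by rewrite axij4_21 (scaleNr q1) opprB addrA.
- apply: (J' 8) => //; rewrite /= (_ : 2 - 3 = 2) //; last exact: val_inj.
  by rewrite axij4_31 (scaleNr q1) opprB addrA.
- have := JZ (- q2^-1) _ (@J_rels 9 isT isT).
  by rewrite /= scalerBr !scaleNr opprK scalerA mulVf // scale1r addrC q2V.
- have := JZ (- q2^-1) _ (@J_rels 10 isT isT).
  by rewrite /= scalerBr !scaleNr opprK scalerA mulVf // scale1r addrC q2V.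
- have := JZ (- q2^-1) _ (@J_rels 11 isT isT).
  by rewrite /= scalerBr !scaleNr opprK scalerA mulVf // scale1r addrC q2V.
Qed.

Lemma hv_rules_hold : rules_hold w q1 ev J hv_rules.
Proof.
apply: (@overlapsP _ _ _ omega_root q1_neq0 _ _ _ J_ideal k_char0 1000).
- exact: base_rules_hold.
- exact: hv_overlaps_checked.
Qed.

Lemma hv_table0_holds : table_holds w q1 ev J hv_table0.
Proof. exact: (rule_tableP hv_rules_hold). Qed.

Lemma hv_table_holds : J (axz ^+ 3) -> table_holds w q1 ev J hv_table.
Proof.
move=> Jz; apply: (@rule_tableP _ _ _ _ _ _ (hv_cube_rule :: hv_rules)) => r [<-|].
  by rewrite /rule_holds lceval_nil subr0 /= !wev_cons word_eval_nil mulr1 -expr2 -exprS.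
exact: hv_rules_hold.
Qed.

End BaseRules.

(** * Automorphisms and derivations on the PBW letters *)

Lemma hv_act_inj i : injective (hv_act i).
Proof.
by case: i => [i|] [j|] [l|] // /Some_inj /addrI /oppr_inj ->.
Qed.

Lemma hv_q_neq0 i j : hv_q q1 q2 i j != 0.
Proof.
case: i j => [i|] [j|] //=; rewrite oppr_eq0 ?oner_eq0 //.
by rewrite expf_neq0 // oppr_eq0 mulf_neq0.
Qed.

Lemma hv_act_rack i j l : hv_act i (hv_act j l) = hv_act (hv_act i j) (hv_act i l).
Proof. by case: i j l => [i|] [j|] [l|] //=; congr Some; ring. Qed.

Lemma hv_q_rack i j l : hv_q q1 q2 i (hv_act j l) * hv_q q1 q2 j l =
  hv_q q1 q2 (hv_act i j) (hv_act i l) * hv_q q1 q2 i l.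
Proof. by case: i j l => [i|] [j|] [l|] //=; rewrite mulrC. Qed.

Local Notation gact := (@gact k hv_index T hv_act (hv_q q1 q2)).
Local Notation der := (@der k hv_index T hv_act (hv_q q1 q2)).
Local Notation radical := (@radical k hv_index T hv_act (hv_q q1 q2)).

Lemma hv_radical_ideal : two_sided_ideal radical.
Proof.
apply: radical_ideal.
- exact: hv_act_inj.
- exact: hv_act_rack.
- exact: hv_q_rack.
Qed.

Lemma gact_ax i h : gact (Some i) (ax h) = - ax (2 * i - h).
Proof. by rewrite gact_gen /= scaleN1r. Qed.
Lemma gact_ax4 i : gact (Some i) ax4 = q1 *: ax4.
Proof. by rewrite gact_gen. Qed.
Lemma gact4_ax h : gact None (ax h) = q2 *: ax h.
Proof. by rewrite gact_gen. Qed.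
Lemma gact4_ax4 : gact None ax4 = (1 + w) *: ax4.
Proof. by rewrite gact_gen /= one_plus_omega. Qed.

Lemma gact_axh4 i h : gact (Some i) (axh4 h) = - q1 *: axh4 (2 * i - h).
Proof.
rewrite /axh4 linearB linearZ /= !gactM gact_ax gact_ax4 scalerBr.
by rewrite -!scalerAr -!scalerAl mulNr mulrN !(scaleNr, scalerN).
Qed.

Lemma gact_axij4 i a b :
  gact (Some i) (axij4 a b) = q1 *: axij4 (2 * i - a) (2 * i - b).
Proof.
rewrite /axij4 linearD linearZ /= !gactM gact_ax !gact_axh4 [RHS]scalerDr.
rewrite -!scalerAr -!scalerAl mulNr mulrN !scaleNr !scalerN !opprK.
congr (_ + _ *: (_ *: (axh4 _ * _))).
by ring.
Qed.

Lemma gact4_axh4 h : gact None (axh4 h) = ((1 + w) * q2) *: axh4 h.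
Proof.
rewrite /axh4 linearB linearZ /= !gactM gact4_ax gact4_ax4 scalerBr.
rewrite -!scalerAr -!scalerAl !scalerA; congr (_ *: _ - _ *: _); by ring.
Qed.

Lemma gact4_axij4 a b : gact None (axij4 a b) = ((1 + w) * q2 ^+ 2) *: axij4 a b.
Proof.
rewrite /axij4 linearD linearZ /= !gactM gact4_ax !gact4_axh4 [RHS]scalerDr.
rewrite -!scalerAr -!scalerAl !scalerA; congr (_ *: _ + _ *: _); by ring.
Qed.

Lemma der_ax j h : der (Some j) (ax h) = (h == j)%:R.
Proof. by rewrite der_gen. Qed.
Lemma der_ax4 j : der (Some j) ax4 = 0.
Proof. by rewrite der_gen. Qed.
Lemma der4_ax h : der None (ax h) = 0.
Proof. by rewrite der_gen. Qed.
Lemma der4_ax4 : der None ax4 = 1.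
Proof. by rewrite der_gen. Qed.

(** x_h4 is a braided commutator: when h = j, the automorphism acting on x_4 yields q_1 x_4, which
    the subtracted term cancels. *)
Lemma der_axh4 j h : der (Some j) (axh4 h) = 0.
Proof.
rewrite /axh4 linearB linearZ /= !derM der_ax4 der_ax gact_ax4 mulr0 mul0r add0r addr0.
by rewrite -scalerAr mulr_natl mulr_natr subrr.
Qed.

Lemma der_axij4 j a b : der (Some j) (axij4 a b) = 0.
Proof.
rewrite /axij4 linearD linearZ /= !derM !der_axh4 der_ax gact_axh4 mulr0 mul0r add0r addr0.
case: eqP => [->|_]; last by rewrite mul0r mulr0 scaler0 addr0.
by rewrite mul1r mulr1 scaleNr addNr.
Qed.

Lemma der4_axh4 h : der None (axh4 h) = (1 + w) *: ax h.
Proof.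
rewrite /axh4 linearB linearZ /= !derM der4_ax4 der4_ax gact4_ax mul0r addr0 mulr0 add0r.
by rewrite mulr1 mul1r scalerA -{1}[ax h]scale1r -scalerBl.
Qed.

Lemma der4_axij4 a b :
  der None (axij4 a b) = (1 + w) *: (ax a * ax b) + ax (2 * a - b) * ax a.
Proof.
rewrite /axij4 linearD linearZ /= !derM !der4_axh4 der4_ax mul0r addr0 mulr0 add0r.
rewrite gact4_ax -!scalerAl -!scalerAr !scalerA; congr (_ + _).
rewrite -[RHS]scale1r; congr (_ *: _).
(* The scalar is q_1 (1 + ω) q_2 = - ω (1 + ω) = 1. *)
transitivity (- (w ^+ 2 + w)); first by rewrite /hv_omega; ring.
by apply/eqP; rewrite eq_sym -subr_eq0 opprK addrC omega_root.
Qed.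

Definition didx (d : option nat) : hv_index := omap (fun j => j.+1%:R) d.

Lemma ev_xlet i : ev (xlet i) = ax i.+1%:R.
Proof.
rewrite /xlet [in RHS](divn_eq i 3); have := ltn_pmod i (isT : 0 < 3)%N.
have -> : (i %/ 3 * 3 + i %% 3).+1%:R = (i %% 3).+1%:R :> 'Z_3.
  by rewrite -addnS natrD natrM (_ : 3%:R = 0 :> 'Z_3) ?mulr0 ?add0r //; exact: val_inj.
by case: (i %% 3)%N => [|[|[|]]] //= _; congr ax; exact: val_inj.
Qed.

Lemma ev_x4let i : ev (x4let i) = axh4 i.+1%:R.
Proof.
rewrite /x4let [in RHS](divn_eq i 3); have := ltn_pmod i (isT : 0 < 3)%N.
have -> : (i %/ 3 * 3 + i %% 3).+1%:R = (i %% 3).+1%:R :> 'Z_3.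
  by rewrite -addnS natrD natrM (_ : 3%:R = 0 :> 'Z_3) ?mulr0 ?add0r //; exact: val_inj.
by case: (i %% 3)%N => [|[|[|]]] //= _; congr axh4; exact: val_inj.
Qed.

(** Since -1 = 2 modulo 3, the reflection of indices shifted by one needs no subtraction in
    [nat]. *)
Lemma Z3_reflect (i j : nat) : (2 * i + 2 * j).+1%:R = 2 * i.+1%:R - j.+1%:R :> 'Z_3.
Proof.
rewrite -!natr1 natrD !natrM; apply/eqP; rewrite -subr_eq0; apply/eqP.
transitivity (3%:R * j%:R : 'Z_3); first by ring.
by rewrite (_ : 3%:R = 0 :> 'Z_3) ?mul0r //; exact: val_inj.
Qed.

Lemma nev1 u : nev [:: (cone, u)] = wev u.
Proof. by rewrite lceval1 coef_eval_cz scale1r. Qed.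

Lemma nev_xij4 i j : nev (xij4let i j) = axij4 i.+1%:R j.+1%:R.
Proof.
rewrite /xij4let !lceval_cons lceval_nil addr0 /fst /snd !coef_eval_cz scale1r.
by rewrite !wev_cons word_eval_nil !mulr1 !ev_xlet !ev_x4let Z3_reflect.
Qed.

Lemma nev_zlet p p' : nev (zlet p p') = nev p * nev p' + w ^+ 2 *: (nev p' * nev p).
Proof.
rewrite /zlet lceval_add (nceval_mul1 omega_root q1_neq0) !(nceval_mul omega_root q1_neq0).
by rewrite coef_eval_cz word_eval_nil mul1r mulr1 one_plus_omega opprK.
Qed.

Lemma gact_letterP d l : (l < 10)%N -> (if d is Some j then j < 3 else true)%N ->
  gact (didx d) (ev l) = nev (gact_letter d l).
Proof.
have nz p : nev (ncmul1 (cz 1 0 1) [::] p [::]) = q1 *: nev p.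
  by rewrite (nceval_mul1 omega_root) // coef_eval_cz word_eval_nil mul1r mulr1.
case: d => [j|] hl hj; last first.
  rewrite /gact_letter lceval1 word_eval1.
  have z4 : gact None (axz) = (((1 + w) * q2 ^+ 2) ^+ 2) *: axz.
    rewrite /axz linearD linearZ /= !gactM !gact4_axij4 [RHS]scalerDr -!scalerAr -!scalerAl !scalerA.
    by congr (_ *: _ + _ *: _); ring.
  have e1 : (1 + w) * q2 = q1^-1.
    by apply: (mulfI q1_neq0); rewrite mulrA [q1 * _]mulrC q2V mulVf // mulfV.
  have e2 : (1 + w) * q2 ^+ 2 = - w * q1 ^- 2.
    by rewrite expr2 mulrA e1 [X in _ * X]q2E mulrCA -exprVn [q1^-1 ^+ 2]expr2.
  case: l hl => [|[|[|[|[|[|[|[|[|[|]]]]]]]]]] // _;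
    rewrite [nth _ _ _]/= coef_eval_cz [didx _]/= [ev _]/= ?gact4_ax4 ?gact4_axh4
      ?gact4_axij4 ?gact4_ax ?z4 ?e1 ?e2 -?q2E //.
  by congr (_ *: _); rewrite exprMn sqrrN one_plus_omega opprK -!exprVn -exprM.
rewrite /didx [omap _ _]/=.
have g4 i h : nev (ncmul1 (cz 1 0 1) [::] (xij4let (2 * j + 2 * i) (2 * j + 2 * h)) [::]) =
    gact (Some j.+1%:R) (axij4 i.+1%:R h.+1%:R).
  by rewrite nz nev_xij4 !Z3_reflect gact_axij4.
case: l hl => [|[|[|[|[|[|[|l]]]]]]] hl; rewrite /gact_letter.
- by rewrite lceval1 coef_eval_cz word_eval1 gact_ax4.
- by rewrite lceval1 coef_eval_cz word_eval1 ev_x4let Z3_reflect gact_axh4.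
- by rewrite lceval1 coef_eval_cz word_eval1 ev_x4let Z3_reflect gact_axh4.
- by rewrite lceval1 coef_eval_cz word_eval1 ev_x4let Z3_reflect gact_axh4.
- by rewrite g4.
- rewrite nev_zlet !g4 /= /axz linearD linearZ /= !gactM.
  by [].
- by rewrite g4.
rewrite lceval1 coef_eval_cz word_eval1 ev_xlet scaleN1r Z3_reflect -gact_ax.
by congr (gact _ _); case: l hl => [|[|[|]]].
Qed.

Definition der_ok (d : option nat) : bool := if d is Some j then (j < 3)%N else true.

Lemma gact_wordP d u : all (fun l => l < 10)%N u -> der_ok d ->
  gact (didx d) (wev u) = nev (gact_word d u).
Proof.
move=> + hd; elim: u => [|l u IH] /=.
  by rewrite word_eval_nil gact1 lceval1 coef_eval_cz scale1r word_eval_nil.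
case/andP => hl hu; rewrite wev_cons gactM (nceval_mul omega_root) // IH //.
by rewrite gact_letterP.
Qed.

Lemma der_stepP dl d u : all (fun l => l < 10)%N u -> der_ok d ->
  (forall l, l \in u -> der (didx d) (ev l) = nev (dl l)) ->
  der (didx d) (wev u) = nev (der_step dl d u).
Proof.
move=> + hd; elim: u => [|l u IH] /= hu hdl; first by rewrite word_eval_nil der1 lceval_nil.
case/andP: hu => hl hu; rewrite wev_cons derM IH //; last first.
  by move=> l' hl'; apply: hdl; rewrite inE hl' orbT.
rewrite gact_wordP // hdl ?mem_head //.
have -> : ev l * nev (der_step dl d u) = nev (ncmul1 cone [:: l] (der_step dl d u) [::]).
  by rewrite (nceval_mul1 omega_root) // coef_eval_cz scale1r word_eval1 word_eval_nil mulr1.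
case: (dl l) => [|t p]; first by rewrite lceval_nil mul0r addr0.
by rewrite lceval_add (nceval_mul omega_root).
Qed.

Lemma der_letter0P d l : (l < 10)%N -> l != 5 -> der_ok d ->
  der (didx d) (ev l) = nev (der_letter0 d l).
Proof.
have n11 : nev [:: (cone, [::])] = 1.
  by rewrite lceval1 coef_eval_cz scale1r word_eval_nil.
have hxij i j : nev (der_xij4 i j) = der None (axij4 i.+1%:R j.+1%:R).
  rewrite der4_axij4 !lceval_cons lceval_nil addr0 /fst /snd !coef_eval_cz scale1r.
  by rewrite !wev_cons word_eval_nil !mulr1 !ev_xlet Z3_reflect.
case: d => [j|] hl h5 hd; last first.
  case: l hl h5 => [|[|[|[|[|[|[|[|[|[|]]]]]]]]]] // _ _; rewrite [didx _]/= /der_letter0.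
  - by rewrite der4_ax4 n11.
  - by rewrite der4_axh4 lceval1 coef_eval_cz word_eval1.
  - by rewrite der4_axh4 lceval1 coef_eval_cz word_eval1.
  - by rewrite der4_axh4 lceval1 coef_eval_cz word_eval1.
  - by rewrite hxij.
  - by rewrite hxij.
  - by rewrite der4_ax lceval_nil.
  - by rewrite der4_ax lceval_nil.
  - by rewrite der4_ax lceval_nil.
case: l hl h5 => [|[|[|[|[|[|[|l]]]]]]] // hl _; rewrite [didx _]/= /der_letter0 [ev _]/=.
- by rewrite der_ax4 lceval_nil.
- by rewrite der_axh4 lceval_nil.
- by rewrite der_axh4 lceval_nil.
- by rewrite der_axh4 lceval_nil.
- by rewrite der_axij4 lceval_nil.
- by rewrite der_axij4 lceval_nil.
by case: l hl j hd => [|[|[|]]] // _ [|[|[|]]] // _; rewrite der_ax /= ?n11 ?lceval_nil.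
Qed.

Lemma der_letterP d l : (l < 10)%N -> der_ok d ->
  der (didx d) (ev l) = nev (der_letter d l).
Proof.
move=> hl hd; have [->|h5] := eqVneq l 5; last first.
  by rewrite der_letter0P //; case: l {hl} h5 => [|[|[|[|[|[|]]]]]].
have -> : ev 5 = wev [:: 4; 6] + w ^+ 2 *: wev [:: 6; 4].
  by rewrite !wev_cons word_eval_nil !mulr1.
rewrite linearD linearZ /= !(der_stepP (dl := der_letter0 d)) //.
- rewrite lceval_add (nceval_mul1 omega_root) // coef_eval_cz word_eval_nil mul1r mulr1.
  by rewrite one_plus_omega opprK.
- by move=> l'; rewrite !inE => /orP[]/eqP ->; exact: der_letter0P.
- by move=> l'; rewrite !inE => /orP[]/eqP ->; exact: der_letter0P.
Qed.

Lemma der_polyP d p : letters_ok p -> der_ok d ->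
  der (didx d) (nev p) = nev (der_poly d p).
Proof.
move=> + hd; elim: p => [|t p IH] /=; first by rewrite lceval_nil linear0.
case/andP => ht hp; rewrite lceval_cons linearD linearZ /= IH // lceval_add.
rewrite (nceval_mul1 omega_root) // word_eval_nil mul1r mulr1.
congr (_ *: _ + _); apply: der_stepP => // l hl; apply: der_letterP => //.
exact: (allP ht).
Qed.

(** Normalizing between derivations is harmless because the radical is stable under derivations; it
    keeps the intermediate polynomials small. *)
Lemma ders_polyP table ds p p' : table_holds w q1 ev radical table ->
  all der_ok ds -> ders_poly table ds p = Some p' ->
  radical (ders hv_act (hv_q q1 q2) [seq didx d | d <- ds] (nev p) - nev p').
Proof.
move=> ht; elim: ds p => [|d ds IH] p /=; first by move=> _ [->]; rewrite subrr; exact: radical0.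
case/andP => hd hds; case: ifP => // hp E.
have Ri := hv_radical_ideal.
apply: (ideal_trans Ri) (IH _ hds E).
rewrite der_polyP // -linearB.
have : radical (nev (der_poly d p) - nev (ncnf table 2000 (der_poly d p))).
  exact: (ncnfP omega_root q1_neq0 Ri _ _ ht).
elim: [seq didx d | d <- ds] (nev _ - _) => //= i s IHs x Rx; apply: IHs.
exact: radical_der.
Qed.

(** * Membership of the twelve relations in the radical *)

Lemma nev_arels i : nth 0 arels i = nev (nth [::] hv_relation_polys i).
Proof.
have e22 : 2 - 2 = 3 :> 'Z_3 by apply: val_inj.
have e23 : 2 - 3 = 2 :> 'Z_3 by apply: val_inj.
have e x h : x - q2 *: h = x + (w * q1^-1) *: h by rewrite -scaleNr {1}q2E mulNr opprK.
case: i => [|[|[|[|[|[|[|[|[|[|[|[|i]]]]]]]]]]]]; last by rewrite !nth_default ?lceval_nil.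
all: rewrite [nth _ _ _]/= [in RHS]/=;
  rewrite ?(lceval_cons, lceval_nil) /fst /snd ?coef_eval_cz ?scale1r ?addr0
    ?(wev_cons, word_eval_nil) ?mulr1 ?addrA.
all: rewrite ?exprS ?expr0 ?mulr1 ?e22 ?e23 ?e ?axij4_21 ?axij4_31 ?scaleNr //.
Qed.

Lemma eps_ev l : eps T (ev l) = 0.
Proof.
have ex h : eps T (ax h) = 0 by rewrite -[ax h]mulr1 eps_genM.
have eZ c x : eps T x = 0 -> eps T (c *: x) = 0 by rewrite linearZ => /= ->; exact: mulr0.
have ex4 : eps T ax4 = 0 by rewrite -[ax4]mulr1 eps_genM.
have eh h : eps T (axh4 h) = 0.
  by rewrite linearB /= epsM eZ ?epsM ?ex ?ex4 mul0r ?subr0.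
have eij i j : eps T (axij4 i j) = 0.
  by rewrite linearD /= epsM eZ ?epsM ?ex ?eh mul0r ?addr0.
have ez : eps T axz = 0 by rewrite linearD /= epsM eZ ?epsM ?eij mul0r ?addr0.
by case: l => [|[|[|[|[|[|[|[|[|l]]]]]]]]]; rewrite [ev _]/= ?ex ?eh ?eij.
Qed.

Lemma radical_poly table p : table_holds w q1 ev radical table ->
  all_der_nil table p -> radical (nev p).
Proof.
move=> ht /and3P[hl hp /allP hd]; apply: radicalP => [|i].
  elim: p hp {hl hd} => [|t p IH] /=; first by rewrite lceval_nil linear0.
  case/andP => ht2 hp; rewrite lceval_cons linearD linearZ /= IH // addr0.
  by case: t.2 ht2 => // l u _; rewrite wev_cons epsM eps_ev mul0r scaler0.
have [d [-> hd1 hd2]] : exists d, [/\ i = didx d, der_ok d & d \in [:: None; Some 0%N; Some 1%N; Some 2%N]].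
  case: i => [i|]; last by exists None.
  have hi (j : nat) : i = j.+1%:R -> Some i = didx (Some j) by move=> ->.
  by case: i hi => [[|[|[|]]] // hj] hi;
    [exists (Some 2%N)|exists (Some 0%N)|exists (Some 1%N)]; split=> //; apply: hi; exact: val_inj.
have Rd := nf_nil_holds omega_root q1_neq0 hv_radical_ideal ht (hd d hd2).
by rewrite -(der_polyP hl hd1) in Rd.
Qed.

Lemma nil_table_holds (J : set T) : table_holds w q1 ev J [::].
Proof. by move=> i r; rewrite nth_nil. Qed.

Lemma arels_radical i : (i < 12)%N -> radical (nth 0 arels i).
Proof.
have Ri := hv_radical_ideal; have h0 := nil_table_holds radical.
have hd := letter_rules_hold Ri.
(* The derivatives of these six vanish in T itself, with the empty table; for x_4^6 because -ω^2 is
   a primitive sixth root of unity. *)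
have h5 j : (j < 6)%N -> radical (nth 0 arels j).
  rewrite nev_arels => hj; apply: (radical_poly h0).
  by case: j hj => [|[|[|[|[|[|]]]]]] // _; vm_compute.
(* Only the definitions of the letters are unfolded here. *)
have h9 j : (j < 3)%N -> radical (nth 0 arels (9 + j)).
  rewrite nev_arels => hj; apply: (radical_poly (rule_tableP hd)).
  by case: j hj => [|[|[|]]] // _; vm_compute.
have hq := rule_tableP (quadratic_rules_hold Ri h5).
(* These derivatives are quadratic in x_1, x_2, x_3 and are reduced by the relations already placed
   in the radical. *)
have h7 j : (j < 2)%N -> radical (nth 0 arels (7 + j)).
  rewrite nev_arels => hj; apply: (radical_poly hq).
  by case: j hj => [|[|]] // _; vm_compute.
have h12 j : (j < 12)%N -> j != 6 -> radical (nth 0 arels j).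
  move=> hj j6; have [/h5 //|lj] := ltnP j 6.
  have [j9|j9] := ltnP j 9.
    have l7 : (7 <= j)%N by rewrite ltn_neqAle eq_sym j6.
    by rewrite -(subnKC l7); apply: h7; rewrite ltn_subLR.
  by rewrite -(subnKC j9); apply: h9; rewrite ltn_subLR.
move=> hi; have [->|] := eqVneq i 6; last exact: h12.
(* The cube requires all the consequences of the other eleven relations. *)
rewrite nev_arels; apply: (radical_poly (hv_table0_holds Ri h12)).
by vm_compute.
Qed.

End HV.

(** * The PBW monomials span *)

Section PBWData.
Local Open Scope nat_scope.

Definition factor_word (a b c : nat) (e : hv_factor_index) : seq nat :=
  match e with
  | inl (l, m, n) => nseq l a ++ nseq m b ++ nseq n c
  | inr (l, n) => nseq l a ++ b :: a :: nseq n c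
  end.

Definition middle_word (m : 'I_2 * 'I_3 * 'I_2) : seq nat :=
  nseq m.1.1 4 ++ nseq m.1.2 5 ++ nseq m.2 6.

(** Listed by degree, with 1, 3, 4, 3, 1 entries: the Hilbert series of the Fomin-Kirillov algebra
    of dimension 12. The position in this list is the index used for triangularity in the
    independence proof. *)
Definition factor_seq : seq hv_factor_index :=
  let o0 := @Ordinal 2 0 isT in let o1 := @Ordinal 2 1 isT in
  [:: inl (o0, o0, o0); inl (o1, o0, o0); inl (o0, o1, o0); inl (o0, o0, o1);
      inl (o1, o0, o1); inr (o0, o0); inl (o0, o1, o1); inl (o1, o1, o0);
      inr (o1, o0); inl (o1, o1, o1); inr (o0, o1); inr (o1, o1)].

Definition middle_seq : seq ('I_2 * 'I_3 * 'I_2) :=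
  let o0 := @Ordinal 2 0 isT in let o1 := @Ordinal 2 1 isT in
  [seq (m.1, n, m.2) | n <- [:: @Ordinal 3 0 isT; @Ordinal 3 1 isT; @Ordinal 3 2 isT],
     m <- [:: (o0, o0); (o1, o0); (o0, o1); (o1, o1)]].

Lemma mem_factor_seq e : e \in factor_seq.
Proof.
have h (i : 'I_2) : i = @Ordinal 2 0 isT \/ i = @Ordinal 2 1 isT.
  by case: i => -[|[|]] // ?; [left|right]; exact: val_inj.
by case: e => [[[l m] n]|[l n]]; case: (h l) => ->; case: (h n) => -> //; case: (h m) => ->.
Qed.

Lemma mem_middle_seq m : m \in middle_seq.
Proof.
have h (i : 'I_2) : i = @Ordinal 2 0 isT \/ i = @Ordinal 2 1 isT.
  by case: i => -[|[|]] // ?; [left|right]; exact: val_inj.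
have h3 (i : 'I_3) : [\/ i = @Ordinal 3 0 isT, i = @Ordinal 3 1 isT | i = @Ordinal 3 2 isT].
  by case: i => -[|[|[|]]] // ?; [constructor 1|constructor 2|constructor 3]; exact: val_inj.
by case: m => [[l m] n]; case: (h l) => ->; case: (h n) => ->; case: (h3 m) => ->.
Qed.

Definition x4_words := [seq nseq n 0 | n <- iota 0 6].
Definition u_words := [seq factor_word 1 2 3 e | e <- factor_seq].
Definition m_words := [seq middle_word e | e <- middle_seq].
Definition v_words := [seq factor_word 7 8 9 e | e <- factor_seq].

(** It certifies that a left factor from [L] can be pushed through the block [P], leaving to its
    right a residue from [R]. *)
Definition comm_check (L P R : seq (seq nat)) : bool :=
  all (fun l => all (fun p =>
    all (fun t => has (fun p' => has (fun r => t.2 == p' ++ r) R) P) (nfw (l ++ p))) P) L.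

(** The residues of a generator x_h pushed rightwards: past x_4^n it is some x_h or x_h4, past the
    block u some x_h, x_124, x_134 or 1, past the middle block some x_h or 1, and v absorbs it. *)
Definition r1_words := [:: [:: 7]; [:: 8]; [:: 9]; [:: 1]; [:: 2]; [:: 3]].
Definition r2_words := [:: [::]; [:: 4]; [:: 6]; [:: 7]; [:: 8]; [:: 9]].
Definition r3_words := [:: [::]; [:: 7]; [:: 8]; [:: 9]].

Lemma r1_check : comm_check [:: [:: 7]; [:: 8]; [:: 9]] x4_words r1_words.
Proof. by vm_compute. Qed.
Lemma r2_check : comm_check r1_words u_words r2_words.
Proof. by vm_compute. Qed.
Lemma r3_check : comm_check r2_words m_words r3_words.
Proof. by vm_compute. Qed.
Lemma r4_check : comm_check r3_words v_words [:: [::]].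
Proof. by vm_compute. Qed.

End PBWData.

Section Span.
Variables (k : fieldType) (q1 q2 : k).
Hypothesis k_char0 : [pchar k] =i pred0.
Hypothesis q1_neq0 : q1 != 0.
Hypothesis q2_neq0 : q2 != 0.
Hypothesis omega_prim : 3.-primitive_root (- (q1 * q2)).
Variable T : free_tensor k hv_index.

Local Notation w := (hv_omega q1 q2).
Local Notation ev := (@ev k q1 q2 T).
Local Notation wev := (word_eval ev).
Local Notation nev := (lceval w q1 wev).
Local Notation ax := (@ax k T).
Local Notation ax4 := (@ax4 k T).
Local Notation axh4 := (@axh4 k q1 T).
Local Notation axij4 := (@axij4 k q1 T).
Local Notation axz := (@axz k q1 q2 T).
Local Notation arels := (@arels k q1 q2 T).

Definition afactor (a b c : T) (e : hv_factor_index) : T :=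
  match e with
  | inl (l, m, n) => a ^+ l * b ^+ m * c ^+ n
  | inr (l, n) => a ^+ l * b * a * c ^+ n
  end.

Definition apbw (e : hv_pbw_index) : T :=
  let '(n4, u, n124, n124134, n134, v) := e in
  ax4 ^+ n4 * afactor (axh4 1) (axh4 2) (axh4 3) u
    * axij4 1 2 ^+ n124 * axz ^+ n124134 * axij4 1 3 ^+ n134
    * afactor (ax 1) (ax 2) (ax 3) v.

Lemma wev_nseq n l : wev (nseq n l) = ev l ^+ n.
Proof.
by elim: n => [|n IH]; rewrite ?expr0 ?word_eval_nil // exprS -IH wev_cons.
Qed.

Lemma wev_factor a b c e :
  wev (factor_word a b c e) = afactor (ev a) (ev b) (ev c) e.
Proof.
case: e => [[[l m] n]|[l n]]; rewrite /= !word_eval_cat ?wev_cons !wev_nseq ?mulrA //.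
Qed.

Lemma apbwE n4 u m v : apbw (n4, u, m.1.1, m.1.2, m.2, v) =
  wev (nseq n4 0%N) * wev (factor_word 1 2 3 u) * wev (middle_word m) *
  wev (factor_word 7 8 9 v).
Proof. by rewrite !wev_factor /middle_word !word_eval_cat !wev_nseq /= !mulrA. Qed.

Variable J : set T.
Hypothesis J_ideal : two_sided_ideal J.
Hypothesis J_rels : forall i, (i < 12)%N -> J (nth 0 arels i).

Definition pbw_spanned (x : T) : Prop :=
  exists a : hv_pbw_index -> k, J (x - \sum_e a e *: apbw e).

Lemma hv_table_holdsJ : table_holds w q1 ev J hv_table.
Proof. by apply: hv_table_holds => // [i hi _|]; [exact: J_rels|exact: (@J_rels 6)]. Qed.

Lemma spanned_ideal x : J x -> pbw_spanned x.
Proof. by exists (fun=> 0); rewrite big1 ?subr0 // => e _; rewrite scale0r. Qed.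

Lemma spannedZD c x y : pbw_spanned x -> pbw_spanned y -> pbw_spanned (c *: x + y).
Proof.
move=> [a ha] [b hb]; exists (fun e => c * a e + b e).
have -> : \sum_e (c * a e + b e) *: apbw e =
    c *: (\sum_e a e *: apbw e) + \sum_e b e *: apbw e.
  by rewrite scaler_sumr -big_split; apply: eq_bigr => e _; rewrite scalerDl scalerA.
by rewrite opprD addrACA -scalerBr; apply: idealD => //; exact: idealZ.
Qed.

Lemma spanned_cong x y : J (x - y) -> pbw_spanned y -> pbw_spanned x.
Proof. by move=> h [a ha]; exists a; exact: ideal_trans h ha. Qed.

Lemma spanned_sum (X : Type) (s : seq X) (F : X -> T) a b (G : X -> k) :
  (forall i, List.In i s -> pbw_spanned (a * F i * b)) ->
  pbw_spanned (a * (\sum_(i <- s) G i *: F i) * b).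
Proof.
elim: s => [|i s IH] h.
  by rewrite big_nil mulr0 mul0r; apply: spanned_ideal; exact: ideal0.
rewrite big_cons mulrDr mulrDl -scalerAr -scalerAl; apply: spannedZD.
  by apply: h; left.
by apply: IH => j hj; apply: h; right.
Qed.

Lemma spanned_pbw e : pbw_spanned (apbw e).
Proof.
exists (fun e' => (e' == e)%:R); rewrite (bigD1 e) //= eqxx scale1r big1 ?addr0 ?subrr.
  exact: ideal0.
by move=> e' /negbTE ->; rewrite scale0r.
Qed.

Lemma spanned_comm L P R (l : seq nat) p a b : comm_check L P R ->
  l \in L -> p \in P ->
  (forall p' r, p' \in P -> r \in R -> pbw_spanned (a * wev p' * wev r * b)) ->
  pbw_spanned (a * wev l * wev p * b).
Proof.
move=> /allP h /h /allP{}h /h {}h hs; rewrite -(mulrA a) -word_eval_cat.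
apply: (spanned_cong (y := a * nev (nfw (l ++ p)) * b)).
  rewrite -[wev (l ++ p)](nev1 q1 q2); apply: ideal_congM => //.
  exact: (ncnfP (omega_root omega_prim) q1_neq0 J_ideal _ _ hv_table_holdsJ).
apply: spanned_sum => t ht.
have {}h : all (fun t => has (fun p' => has (fun r => t.2 == p' ++ r) R) P) (nfw (l ++ p)) by [].
have /hasP[p' hp' /hasP[r hr /eqP ->]] : has (fun p' => has (fun r => t.2 == p' ++ r) R) P.
  by elim: (nfw _) h ht => //= t' s IH /andP[h1 h2] [<- //|]; exact: IH.
by rewrite word_eval_cat mulrA; exact: hs.
Qed.

Lemma spanned_words p0 u m v : p0 \in x4_words -> u \in u_words -> m \in m_words ->
  v \in v_words -> pbw_spanned (wev p0 * wev u * wev m * wev v).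
Proof.
case/mapP => n; rewrite mem_iota => /= hn -> /mapP[eu _ ->] /mapP[em _ ->] /mapP[e _ ->].
rewrite -[n]/(nat_of_ord (Ordinal hn)) -apbwE; exact: spanned_pbw.
Qed.

(** The four passages are established from the last block backwards, each one finishing with the
    passage through the next block. *)
Lemma spanned_x l p0 u m v : l \in [:: [:: 7]; [:: 8]; [:: 9]] ->
  p0 \in x4_words -> u \in u_words -> m \in m_words -> v \in v_words ->
  pbw_spanned (wev l * (wev p0 * wev u * wev m * wev v)).
Proof.
move=> hl hp hu hm hv; have h4 p' u' m' r : p' \in x4_words -> u' \in u_words -> m' \in m_words ->
    r \in r3_words -> pbw_spanned (wev p' * wev u' * wev m' * wev r * wev v).
  move=> ? ? ? hr; rewrite -[X in pbw_spanned X]mulr1.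
  apply: (spanned_comm r4_check) hr hv _ => v' r' hv'; rewrite inE => /eqP ->.
  by rewrite word_eval_nil !mulr1; exact: spanned_words.
have h3 p' u' r : p' \in x4_words -> u' \in u_words -> r \in r2_words ->
    pbw_spanned (wev p' * wev u' * wev r * wev m * wev v).
  move=> ? ? hr; apply: (spanned_comm r3_check) hr hm _ => m' r' hm' hr'.
  exact: h4.
have h2 p' r : p' \in x4_words -> r \in r1_words ->
    pbw_spanned (wev p' * wev r * wev u * (wev m * wev v)).
  move=> ? hr; apply: (spanned_comm r2_check) hr hu _ => u' r' hu' hr'.
  by rewrite mulrA; exact: h3.
have -> : wev l * (wev p0 * wev u * wev m * wev v) =
    1 * wev l * wev p0 * (wev u * (wev m * wev v)) by rewrite mul1r !mulrA.
apply: (spanned_comm r1_check) hl hp _ => p' r hp' hr.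
by rewrite mul1r (mulrA _ (wev u)); exact: h2.
Qed.

Lemma spanned_x4 p0 u m v : p0 \in x4_words -> u \in u_words -> m \in m_words ->
  v \in v_words -> pbw_spanned (ax4 * (wev p0 * wev u * wev m * wev v)).
Proof.
case/mapP => n; rewrite mem_iota add0n => /= hn -> hu hm hv.
rewrite wev_nseq !mulrA -exprS.
(* For n = 5 the product contains x_4^6, which is a relation; otherwise it is again a PBW
   monomial. *)
have [->|hn5] := eqVneq n 5.
  have JM x b : J x -> J (x * b) by rewrite -{2}[x]mul1r; exact: idealM.
  by apply: spanned_ideal; do 3!apply: (JM); exact: (@J_rels 5).
rewrite -(wev_nseq n.+1 0); apply: spanned_words => //.
by apply/mapP; exists n.+1 => //; rewrite mem_iota /= ltn_neqAle eqSS hn5.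
Qed.

Lemma spanned_gen i x : pbw_spanned x -> pbw_spanned (ft_gen T i * x).
Proof.
case=> a ha; apply: (spanned_cong (y := ft_gen T i * \sum_e a e *: apbw e)).
  rewrite -[X in J (X - _)]mulr1 -[X in J (_ - X)]mulr1; exact: ideal_congM.
rewrite -[X in pbw_spanned X]mulr1; apply: spanned_sum => -[[[[[n4 u] n] nz] n'] v] _.
rewrite mulr1 (apbwE n4 u (n, nz, n') v).
have hp : nseq n4 0%N \in x4_words.
  by apply/mapP; exists (n4 : nat) => //; rewrite mem_iota /=.
have hu : factor_word 1 2 3 u \in u_words by apply/map_f/mem_factor_seq.
have hm : middle_word (n, nz, n') \in m_words by apply/map_f/mem_middle_seq.
have hv : factor_word 7 8 9 v \in v_words by apply/map_f/mem_factor_seq.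
case: i => [i|]; last exact: spanned_x4.
case: i => [[|[|[|]]]] // hi.
- have := @spanned_x [:: 9] _ _ _ _ isT hp hu hm hv.
  rewrite word_eval1 [ev _]/= (_ : ax 3 = ft_gen T (Some (Ordinal hi))) //.
  by congr (ft_gen T (Some _)); exact: val_inj.
- have := @spanned_x [:: 7] _ _ _ _ isT hp hu hm hv.
  rewrite word_eval1 [ev _]/= (_ : ax 1 = ft_gen T (Some (Ordinal hi))) //.
  by congr (ft_gen T (Some _)); exact: val_inj.
- have := @spanned_x [:: 8] _ _ _ _ isT hp hu hm hv.
  rewrite word_eval1 [ev _]/= (_ : ax 2 = ft_gen T (Some (Ordinal hi))) //.
  by congr (ft_gen T (Some _)); exact: val_inj.
Qed.

Lemma pbw_spanning x : pbw_spanned x.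
Proof.
elim/ft_ind: x => [|c x y|| i x].
- by apply: spanned_ideal; exact: ideal0.
- exact: spannedZD.
- have := spanned_words (p0 := [::]) (u := [::]) (m := [::]) (v := [::]) isT isT isT isT.
  by rewrite word_eval_nil !mulr1.
- exact: spanned_gen.
Qed.
End Span.

(** * The PBW monomials are independent *)

Section FrobeniusData.
Local Open Scope nat_scope.

(** Entry i has the degree complementary to that of entry i of [u_words], as in a dual basis for a
    Frobenius form on the block. *)
Definition u_partners : seq (seq nat) :=
  [:: [:: 1; 2; 1; 3]; [:: 2; 1; 3]; [:: 1; 2; 3]; [:: 1; 2; 1]; [:: 1; 2]; [:: 2; 3];
      [:: 2; 1]; [:: 1; 3]; [:: 3]; [:: 2]; [:: 1]; [::]].
Definition v_partners := [seq [seq l + 6 | l <- s] | s <- u_partners].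
Definition m_partners : seq (seq nat) :=
  [:: [:: 4; 5; 5; 6]; [:: 5; 5; 6]; [:: 4; 5; 5]; [:: 5; 5]; [:: 4; 5; 6]; [:: 5; 6];
      [:: 4; 5]; [:: 5]; [:: 4; 6]; [:: 6]; [:: 4]; [::]].

Definition x4_top := nseq 5 0.
Definition u_top := [:: 1; 2; 1; 3].
Definition m_top := [:: 4; 5; 5; 6].
Definition v_top := [:: 7; 8; 7; 9].

Definition is_monomial (u : seq nat) (p : ncpoly) : bool :=
  if p is [:: t] then coef_nonzero t.1 && (t.2 == u) else false.

(** The Gram matrix of the pairing of a block with its partners, valued in multiples of the top
    word, is required to vanish strictly above a nonzero diagonal; entries below it are
    unconstrained. *)
Definition triangular (f : nat -> nat -> seq nat) (top : seq nat) : bool :=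
  all (fun i => is_monomial top (nfw (f i i)) &&
    all (fun j => is_nil (nfw (f i j))) (iota i.+1 (11 - i))) (iota 0 12).

Lemma u_triangular :
  triangular (fun i j => nth [::] u_partners i ++ nth [::] u_words j) u_top.
Proof. by vm_compute. Qed.
Lemma v_triangular :
  triangular (fun i j => nth [::] v_words j ++ nth [::] v_partners i) v_top.
Proof. by vm_compute. Qed.
Lemma m_triangular :
  triangular (fun i j => nth [::] m_words j ++ nth [::] m_partners i) m_top.
Proof. by vm_compute. Qed.
(** A partner of u stands to the left of x_4^5 and must cross it to meet u; likewise
    [v_top_m_partners] lets the partners of the middle block cross v. *)
Lemma u_partners_x4_top :
  all (fun s => is_monomial (x4_top ++ s) (nfw (s ++ x4_top))) u_partners.
Proof. by vm_compute. Qed.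
Lemma v_top_m_partners :
  all (fun s => is_monomial (s ++ v_top) (nfw (v_top ++ s))) m_partners.
Proof. by vm_compute. Qed.

Lemma top_ders_check :
  ders_poly hv_table top_ders [:: (cone, top_word)] = Some [:: (cz 0 (-18) 0, [::])].
Proof. by vm_compute. Qed.
End FrobeniusData.

Section Independent.
Variables (k : fieldType) (q1 q2 : k).
Hypothesis k_char0 : [pchar k] =i pred0.
Hypothesis q1_neq0 : q1 != 0.
Hypothesis q2_neq0 : q2 != 0.
Hypothesis omega_prim : 3.-primitive_root (- (q1 * q2)).
Variable T : free_tensor k hv_index.

Local Notation w := (hv_omega q1 q2).
Local Notation ev := (@ev k q1 q2 T).
Local Notation wev := (word_eval ev).
Local Notation nev := (lceval w q1 wev).
Local Notation apbw := (@apbw k q1 q2 T).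
Local Notation R := (@radical k hv_index T hv_act (hv_q q1 q2)).

Let R_ideal : two_sided_ideal R.
Proof. exact: hv_radical_ideal. Qed.

Let R_table : table_holds w q1 ev R hv_table.
Proof.
have h i : (i < 12)%N -> R (nth 0 (arels q1 q2 T) i) by exact: arels_radical.
by apply: hv_table_holds => // [i hi _|]; [exact: h|exact: (h 6)].
Qed.

Lemma top_not_radical : ~ R (wev top_word).
Proof.
rewrite -(nev1 q1 q2) => h.
have hd : all der_ok top_ders by [].
have := ders_polyP q1_neq0 q2_neq0 omega_prim R_table hd top_ders_check.
have hR d x : R x -> R (ders hv_act (hv_q q1 q2) d x).
  by elim: d x => //= i d IH x hx; apply: IH; exact: radical_der.
move=> hd'; have [h18 _] := ideal_congl R_ideal hd'; have {h18} := h18 (hR _ _ h).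
rewrite lceval1 word_eval_nil => /(idealZ R_ideal (coef_eval w q1 (cz 0 (-18) 0))^-1).
rewrite scalerA mulVf ?scale1r; last exact: (coef_eval_neq0 (omega_root omega_prim)).
by move=> /(_ [::]) /eqP; rewrite /pairing /= eps1 oner_eq0.
Qed.

Definition proportional (x y : T) : Prop := exists2 c, c != 0 & R (x - c *: y).

Lemma proportional_radical x y : proportional x y -> R x <-> R y.
Proof.
case=> c c0 h; rewrite (ideal_congl R_ideal h); split; last exact: idealZ.
by move=> /(idealZ R_ideal c^-1); rewrite scalerA mulVf // scale1r.
Qed.

Lemma proportionalM a b x y : proportional x y -> proportional (a * x * b) (a * y * b).
Proof.
case=> c c0 h; exists c => //; rewrite scalerAl scalerAr.
exact: (ideal_congM R_ideal).
Qed.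

Lemma proportional_trans y x z : proportional x y -> proportional y z -> proportional x z.
Proof.
move=> [c c0 h] [d d0 h']; exists (c * d); first exact: mulf_neq0.
by apply: (ideal_trans R_ideal h); rewrite -scalerA -scalerBr; exact: (idealZ R_ideal).
Qed.

Lemma nfw_cong u : R (wev u - nev (nfw u)).
Proof.
rewrite -[X in R (X - _)](nev1 q1 q2).
exact: (ncnfP (omega_root omega_prim) q1_neq0 R_ideal _ _ R_table).
Qed.

Lemma nfw_nil u v : is_nil (nfw (u ++ v)) -> R (wev u * wev v).
Proof.
move=> h; rewrite -word_eval_cat; have := nfw_cong (u ++ v).
by case: (nfw _) h => // _; rewrite lceval_nil subr0.
Qed.

Lemma nfw_monomial u v s : is_monomial s (nfw (u ++ v)) ->
  proportional (wev u * wev v) (wev s).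
Proof.
move=> h; rewrite -word_eval_cat; have := nfw_cong (u ++ v).
case: (nfw _) h => [|[c s'] []] //= /andP[hc /eqP ->] hR.
exists (coef_eval w q1 c); last by rewrite lceval1 in hR.
exact: (coef_eval_neq0 (omega_root omega_prim)).
Qed.

Lemma triangularP f top i j : triangular f top -> (i < 12)%N -> (j < 12)%N ->
  (i <= j)%N -> (if i == j then is_monomial top else is_nil) (nfw (f i j)).
Proof.
rewrite /triangular => /allP h hi hj.
have ii : i \in iota 0 12 by rewrite mem_iota.
have /andP[h1 /allP h2] := h i ii; rewrite leq_eqVlt => lij.
case: eqP lij => [<- _|_]; first exact: h1.
rewrite orFb => lij; apply: h2; clear h1 h ii; rewrite mem_iota lij /=; lia.
Qed.

Lemma x4_power_radical n u : (5 < n)%N -> R (wev (nseq n 0%N) * u).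
Proof.
move=> hn; rewrite -(subnK hn) nseqD word_eval_cat [wev (nseq 6 _)]wev_nseq.
by apply: (idealM R_ideal); exact: (arels_radical k_char0 q1_neq0 q2_neq0 omega_prim T (i := 5)).
Qed.

Section Detect.
Variables (n0 i0 j0 l0 : nat).
Hypotheses (hn0 : (n0 < 6)%N) (hi0 : (i0 < 12)%N) (hj0 : (j0 < 12)%N) (hl0 : (l0 < 12)%N).

Definition pbw_word (n i l j : nat) : T :=
  wev (nseq n 0%N) * wev (nth [::] u_words i) * wev (nth [::] m_words l) *
  wev (nth [::] v_words j).

(** The power of x_4 raises the exponent n0 to exactly 5 and any larger exponent to at least 6,
    where the product dies. *)
Definition detect (x : T) : T :=
  wev (nth [::] u_partners i0) * wev (nseq (5 - n0) 0%N) * x *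
  (wev (nth [::] v_partners j0) * wev (nth [::] m_partners l0)).

(** The middle block is compared last although it precedes v: its partner reaches it only by
    crossing v, once v has become the top word. *)
Definition before (n i j l : nat) : bool :=
  (n0 < n)%N || (n == n0) && ((i0 < i)%N || (i == i0) &&
    ((j0 < j)%N || (j == j0) && (l0 < l)%N)).

Let yu := wev (nth [::] u_partners i0).
Let yv := wev (nth [::] v_partners j0).
Let zm := wev (nth [::] m_partners l0).
Let u i := wev (nth [::] u_words i).
Let v j := wev (nth [::] v_words j).
Let m l := wev (nth [::] m_words l).

Lemma detectE n i j l : detect (pbw_word n i l j) =
  yu * (wev (nseq (5 - n0 + n) 0%N) * (u i * m l * v j * yv * zm)).
Proof. by rewrite /detect /pbw_word nseqD word_eval_cat !mulrA. Qed.

Lemma detect_u i j l : proportional (detect (pbw_word n0 i l j))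
  (wev x4_top * (yu * u i) * (m l * v j * yv * zm)).
Proof.
rewrite detectE (subnK (n := 5)) //.
have -> : yu * (wev (nseq 5 0%N) * (u i * m l * v j * yv * zm)) =
    1 * (yu * wev x4_top) * (u i * m l * v j * yv * zm) by rewrite mul1r !mulrA.
have -> : wev x4_top * (yu * u i) * (m l * v j * yv * zm) =
   1 * wev (x4_top ++ nth [::] u_partners i0) * (u i * m l * v j * yv * zm).
  by rewrite mul1r word_eval_cat !mulrA.
apply: proportionalM; apply: nfw_monomial.
by apply: (allP u_partners_x4_top); exact: mem_nth.
Qed.

Lemma detect_v j l : proportional (wev x4_top * (yu * u i0) * (m l * v j * yv * zm))
  (wev (x4_top ++ u_top) * m l * (v j * yv) * zm).
Proof.
have -> : wev (x4_top ++ u_top) * m l * (v j * yv) * zm =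
    wev x4_top * wev u_top * (m l * v j * yv * zm) by rewrite word_eval_cat !mulrA.
apply: proportionalM; apply: nfw_monomial.
by have := triangularP u_triangular hi0 hi0 (leqnn _); rewrite eqxx.
Qed.

Lemma detect_m l : proportional (wev (x4_top ++ u_top) * m l * (v j0 * yv) * zm)
  (wev (x4_top ++ u_top) * (m l * zm) * wev v_top).
Proof.
have hv : proportional (wev (x4_top ++ u_top) * m l * (v j0 * yv) * zm)
    (wev (x4_top ++ u_top) * m l * wev v_top * zm).
  apply: proportionalM; apply: nfw_monomial.
  by have := triangularP v_triangular hj0 hj0 (leqnn _); rewrite eqxx.
apply: (proportional_trans hv).
have -> : wev (x4_top ++ u_top) * m l * wev v_top * zm =
   wev (x4_top ++ u_top) * m l * (wev v_top * zm) * 1 by rewrite mulr1 !mulrA.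
have -> : wev (x4_top ++ u_top) * (m l * zm) * wev v_top =
   wev (x4_top ++ u_top) * m l * wev (nth [::] m_partners l0 ++ v_top) * 1.
  by rewrite mulr1 (word_eval_cat _ (nth [::] m_partners l0)) !mulrA.
apply: proportionalM; apply: nfw_monomial.
by apply: (allP v_top_m_partners); exact: mem_nth.
Qed.

(** The blocks are completed to their top words one at a time, in the order of the comparison; the
    first block that exceeds its reference value annihilates the product. *)
Lemma detect_before n i j l : (n < 6)%N -> (i < 12)%N -> (j < 12)%N -> (l < 12)%N ->
  before n i j l -> R (detect (pbw_word n i l j)).
Proof.
move=> hn hi hj hl; rewrite /before.
have [n_gt _|n_le] := ltnP n0 n.
  rewrite detectE -[X in R X]mulr1; apply: (idealM R_ideal).
  by apply: x4_power_radical; lia.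
case/andP => /eqP -> {n hn n_le}; rewrite (proportional_radical (detect_u _ _ _)).
have [i_gt _|i_le] := ltnP i0 i.
  apply: (idealM R_ideal); apply: nfw_nil.
  by have := triangularP u_triangular hi0 hi (ltnW i_gt); rewrite ltn_eqF.
case/andP => /eqP -> {i hi i_le}; rewrite (proportional_radical (detect_v _ _)).
have [j_gt _|j_le] := ltnP j0 j.
  apply: (idealM R_ideal); apply: nfw_nil.
  by have := triangularP v_triangular hj0 hj (ltnW j_gt); rewrite ltn_eqF.
case/andP => /eqP -> l_gt {j hj j_le}; rewrite (proportional_radical (detect_m _)).
apply: (idealM R_ideal); apply: nfw_nil.
by have := triangularP m_triangular hl0 hl (ltnW l_gt); rewrite ltn_eqF.
Qed.

Lemma detect_self : ~ R (detect (pbw_word n0 i0 l0 j0)).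
Proof.
rewrite (proportional_radical (detect_u _ _ _)) (proportional_radical (detect_v _ _)).
rewrite (proportional_radical (detect_m _)) => h; apply: top_not_radical.
have hm : proportional (wev (x4_top ++ u_top) * (m l0 * zm) * wev v_top)
    (wev (x4_top ++ u_top) * wev m_top * wev v_top).
  apply: proportionalM; apply: nfw_monomial.
  by have := triangularP m_triangular hl0 hl0 (leqnn _); rewrite eqxx.
by move: h; rewrite (proportional_radical hm) -!word_eval_cat.
Qed.
End Detect.
End Independent.

Section PBWIndependence.
Variables (k : fieldType) (q1 q2 : k).
Hypothesis k_char0 : [pchar k] =i pred0.
Hypothesis q1_neq0 : q1 != 0.
Hypothesis q2_neq0 : q2 != 0.
Hypothesis omega_prim : 3.-primitive_root (- (q1 * q2)).
Variable T : free_tensor k hv_index.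
Local Notation apbw := (@apbw k q1 q2 T).
Local Notation R := (@radical k hv_index T hv_act (hv_q q1 q2)).

Definition exponents (e : hv_pbw_index) : nat * nat * nat * nat :=
  let '(n4, u, n, nz, n', v) := e in
  (n4 : nat, index u factor_seq, index v factor_seq, index (n, nz, n') middle_seq).

(** The three block indices are digits in base 12, so ranks compare as the tuples do
    lexicographically. *)
Definition rank (e : hv_pbw_index) : nat :=
  let: (n, i, j, l) := exponents e in (((n * 12 + i) * 12 + j) * 12 + l)%N.

Lemma exponents_lt e : let: (n, i, j, l) := exponents e in
  [/\ n < 6, i < 12, j < 12 & l < 12]%N.
Proof.
case: e => [[[[[n4 u] n] nz] n'] v].
have hf f : (index f factor_seq < 12)%N by rewrite -[12%N]/(size factor_seq) index_mem mem_factor_seq.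
have hm m : (index m middle_seq < 12)%N by rewrite -[12%N]/(size middle_seq) index_mem mem_middle_seq.
by split=> //=; exact: hf || exact: hm.
Qed.

Lemma exponents_inj : injective exponents.
Proof.
have inj (X : eqType) (s : seq X) x y : x \in s -> y \in s -> index x s = index y s -> x = y.
  by move=> hx hy h; rewrite -(nth_index x hx) h nth_index.
move=> [[[[[n u] m1] m2] m3] v] [[[[[n' u'] m1'] m2'] m3'] v'] h.
have -> : n = n' by apply: val_inj; exact: (congr1 (fun x => x.1.1.1) h).
have -> : u = u'.
  by apply: inj (congr1 (fun x => x.1.1.2) h); exact: mem_factor_seq.
have -> : v = v'.
  by apply: inj (congr1 (fun x => x.1.2) h); exact: mem_factor_seq.
have : (m1, m2, m3) = (m1', m2', m3').
  by apply: inj (congr1 (fun x => x.2) h); exact: mem_middle_seq.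
by case=> -> -> ->.
Qed.

Lemma apbw_word e : let: (n, i, j, l) := exponents e in
  apbw e = pbw_word q1 q2 T n i l j.
Proof.
case: e => [[[[[n4 u] n] nz] n'] v]; cbv beta iota delta [exponents].
rewrite [LHS](apbwE q1 q2 T n4 u (n, nz, n') v).
rewrite /pbw_word /u_words /v_words /m_words.
by rewrite !(nth_map u) ?(nth_map (n, nz, n')) ?index_mem ?mem_factor_seq ?mem_middle_seq //
  !nth_index ?mem_factor_seq ?mem_middle_seq.
Qed.

Lemma pbw_independent (a : hv_pbw_index -> k) :
  R (\sum_e a e *: apbw e) -> forall e, a e = 0.
Proof.
move=> ha e1; apply/eqP; case: (eqVneq (a e1) 0) => // a1; exfalso.
case: (@arg_minnP _ e1 (fun e => a e != 0) rank a1) => e0 a0 min_e0.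
have R_ideal := hv_radical_ideal q1 q2 T.
have hlt := exponents_lt; have hword := apbw_word.
case E0: (exponents e0) (hlt e0) (hword e0) => [[[n0 i0] j0] l0] [hn0 hi0 hj0 hl0] W0.
have R0 e : e != e0 -> a e != 0 ->
    R (detect q1 q2 n0 i0 j0 l0 (apbw e)).
  move=> ne ae; have := min_e0 _ ae; rewrite /rank E0.
  have := contra_neq (@exponents_inj e e0) ne; rewrite E0.
  case: (exponents e) (hlt e) (hword e) => [[[n i] j] l] [hn hi hj hl] -> nE le.
  apply: detect_before => //; rewrite /before.
  by move: nE; rewrite !xpair_eqE => nE; lia.
have : R (detect q1 q2 n0 i0 j0 l0 (\sum_e a e *: apbw e)) by exact: (idealM R_ideal).
rewrite (bigD1 e0) //=; set rest := (X in _ + X) => h.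
have hrest : R (detect q1 q2 n0 i0 j0 l0 rest).
  rewrite /detect mulr_sumr mulr_suml.
  elim/big_ind: _ => [|x y|e ne]; [exact: ideal0|exact: idealD|].
  rewrite -scalerAr -scalerAl; have [->|ae] := eqVneq (a e) 0.
    by rewrite scale0r; exact: ideal0.
  by apply: (idealZ R_ideal); exact: R0.
have {}h : R (a e0 *: detect q1 q2 n0 i0 j0 l0 (apbw e0)).
  have e : detect q1 q2 n0 i0 j0 l0 (a e0 *: apbw e0 + rest) =
      a e0 *: detect q1 q2 n0 i0 j0 l0 (apbw e0) + detect q1 q2 n0 i0 j0 l0 rest.
    by rewrite /detect mulrDr mulrDl -scalerAr -scalerAl.
  by move: (idealD R_ideal h (idealN R_ideal hrest)); rewrite e addrK.
have := idealZ R_ideal (a e0)^-1 h; rewrite scalerA mulVf // scale1r W0.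
exact: detect_self.
Qed.
End PBWIndependence.

(** * Separating the relations *)

Section MatrixData.
Local Open Scope nat_scope.

(* Here a polynomial encodes a square matrix of order [n.+1]: the word [[:: i; j]]
   stands for the matrix unit in position [(i, j)]. *)
Definition scale (c : coef) (p : ncpoly) : ncpoly := [seq (coef_mul c t.1, t.2) | t <- p].

(** The guard on j matters for soundness: a matrix unit with an index beyond [n] evaluates to the
    zero matrix. *)
Definition unit_mul (n : nat) (t : coef * seq nat) (p : ncpoly) : ncpoly :=
  pmap (fun s => match t.2, s.2 with
    | [:: i; j], [:: j'; l] =>
      if eqn j j' && (j <= n) then Some (coef_mul t.1 s.1, [:: i; l]) else None
    | _, _ => None
    end) p.

Definition smul (n : nat) (p p' : ncpoly) : ncpoly :=
  foldr (fun t => ncadd (unit_mul n t p')) [::] p.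

Definition mat_word (n : nat) (ms : seq ncpoly) (u : seq nat) : ncpoly :=
  foldr (fun l => smul n (nth [::] ms l)) [seq (cone, [:: i; i]) | i <- iota 0 n.+1] u.

Definition mat_poly (n : nat) (ms : seq ncpoly) (p : ncpoly) : ncpoly :=
  foldr (fun t => ncadd (scale t.1 (mat_word n ms t.2))) [::] p.

(* [g] lists the matrices of x_4, x_1, x_2, x_3. *)
Definition letter_mats (n : nat) (g : seq ncpoly) : seq ncpoly :=
  let x4 := nth [::] g 0 in let x i := nth [::] g i in
  let xh4 i := ncadd (smul n (x i) x4) (scale (cz (-1) 0 1) (smul n x4 (x i))) in
  let x14 := xh4 1 in let x24 := xh4 2 in let x34 := xh4 3 in
  let x124 := ncadd (smul n (x 1) x24) (scale (cz 1 0 1) (smul n x34 (x 1))) in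
  let x134 := ncadd (smul n (x 1) x34) (scale (cz 1 0 1) (smul n x24 (x 1))) in
  let z := ncadd (smul n x124 x134) (scale (cz (-1) (-1) 0) (smul n x134 x124)) in
  [:: x4; x14; x24; x34; x124; z; x134; x 1; x 2; x 3].

Definition is_nonzero_mat (n : nat) (p : ncpoly) : bool :=
  if p is (c, [:: a; b]) :: p' then
    [&& coef_nonzero c, a <= n, b <= n & all (fun t => t.2 != [:: a; b]) p']
  else false.

Definition separates (n : nat) (g : seq ncpoly) (i : nat) : bool :=
  let ms := letter_mats n g in
  all (fun j => (if eqn j i then is_nonzero_mat n else is_nil)
    (mat_poly n ms (nth [::] hv_relation_polys j))) (iota 0 12).

(* The entry [(s, t)] of the image of a word is [1] if the word is the factor of
   [u] between the positions [s] and [t], and [0] otherwise. *)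
Definition path_rep (u : seq nat) : seq ncpoly :=
  [seq [seq (cone, [:: t; t.+1]) | t <- iota 0 (size u) & eqn (nth 0 u t) l] | l <- iota 0 4].

(** Entry i is a monomial of relation i having no monomial of another relation as a factor, so the
    path representation kills the others and retains its coefficient. Entry 6 is empty since the
    cube is treated by [cube_rep]. *)
Definition relation_paths : seq (seq nat) :=
  [:: [:: 1; 1]; [:: 2; 2]; [:: 3; 3]; [:: 1; 2]; [:: 2; 1]; nseq 6 0; [::];
      [:: 3; 0; 2]; [:: 2; 0; 3]; [:: 0; 0; 1]; [:: 0; 0; 2]; [:: 0; 0; 3]].

Lemma paths_separate :
  all (fun i => eqn i 6 || separates (size (nth [::] relation_paths i))
    (path_rep (nth [::] relation_paths i)) i) (iota 0 12).
Proof. by vm_compute. Qed.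

(* Let x_124 and x_134 exchange the two vectors of a basis up to scalars, with
   square zero, and let x_1, x_2, x_3 act on them by zero.  This is the quotient
   of the induced module by its largest submodule meeting that plane trivially;
   the powers of q_1 are a twist by the degree. *)
Definition cube_rep : seq ncpoly :=
  [:: [:: (cz (-1) 0 0, [:: 11; 0]); (cz 0 1 0, [:: 17; 0]); (cz 0 (-1) 0, [:: 6; 1]);
      (cz (-1) (-1) 0, [:: 12; 1]); (cz 1 0 1, [:: 15; 2]); (cz 0 1 1, [:: 18; 3]);
      (cz 0 1 1, [:: 19; 4]); (cz (-1) 0 1, [:: 20; 5]); (cz 0 (-1) 2, [:: 23; 6]);
      (cz 1 1 1, [:: 21; 8]); (cz (-1) (-1) 1, [:: 14; 9]); (cz 1 1 2, [:: 22; 11]);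
      (cz 1 1 2, [:: 23; 12]); (cz (-1) 0 2, [:: 22; 17])];
      [:: (cz 1 0 0, [:: 0; 3]); (cz 1 0 0, [:: 1; 4]); (cz 1 0 0, [:: 9; 6]);
      (cz (-1) 0 0, [:: 2; 7]); (cz (-1) 0 0, [:: 8; 11]); (cz (-1) 0 0, [:: 9; 12]);
      (cz 1 0 0, [:: 10; 15]); (cz 1 0 0, [:: 5; 16]); (cz 1 0 0, [:: 17; 18]);
      (cz (-1) 0 0, [:: 6; 19]); (cz (-1) 0 0, [:: 12; 19]); (cz (-1) 0 0, [:: 13; 20]);
      (cz (-1) 0 0, [:: 21; 22]); (cz 1 0 0, [:: 14; 23])];
      [:: (cz (-1) (-1) 0, [:: 1; 2]); (cz 1 1 0, [:: 5; 6]); (cz 0 1 0, [:: 0; 9]);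
      (cz 1 1 0, [:: 3; 10]); (cz 0 1 0, [:: 4; 11]); (cz 0 1 0, [:: 8; 13]);
      (cz 1 1 0, [:: 11; 14]); (cz 1 1 0, [:: 17; 14]); (cz 0 1 0, [:: 12; 15]);
      (cz 0 (-1) 0, [:: 4; 17]); (cz (-1) (-1) 0, [:: 7; 18]); (cz 0 (-1) 0, [:: 16; 21]);
      (cz (-1) (-1) 0, [:: 19; 22]); (cz 0 (-1) 0, [:: 20; 23])];
      [:: (cz (-1) (-1) 0, [:: 0; 5]); (cz (-1) (-1) 0, [:: 4; 7]); (cz 0 1 0, [:: 1; 8]);
      (cz 0 1 0, [:: 9; 10]); (cz 0 1 0, [:: 3; 12]); (cz 1 1 0, [:: 4; 13]);
      (cz 0 (-1) 0, [:: 7; 14]); (cz 0 (-1) 0, [:: 13; 14]); (cz 0 (-1) 0, [:: 9; 16]);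
      (cz (-1) (-1) 0, [:: 2; 17]); (cz 1 1 0, [:: 10; 19]); (cz 1 1 0, [:: 16; 19]);
      (cz 0 (-1) 0, [:: 11; 20]); (cz 1 1 0, [:: 6; 21]); (cz 0 1 0, [:: 15; 22]);
      (cz (-1) (-1) 0, [:: 18; 23])]].

Lemma cube_separates : separates 23 cube_rep 6.
Proof. by vm_compute. Qed.

End MatrixData.

Section Matrices.
Variables (k : fieldType) (q1 q2 : k).
Hypothesis k_char0 : [pchar k] =i pred0.
Hypothesis q1_neq0 : q1 != 0.
Hypothesis q2_neq0 : q2 != 0.
Hypothesis omega_prim : 3.-primitive_root (- (q1 * q2)).
Local Notation w := (hv_omega q1 q2).
Let omega_root' := omega_root omega_prim.

Section Sparse.
Variable n : nat.
Local Notation M := 'M[k]_n.+1.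

Definition unit_mx (u : seq nat) : M :=
  if u is [:: i; j] then \matrix_(a, b) ((a == i :> nat) && (b == j :> nat))%:R else 0.

Local Notation mev := (lceval w q1 unit_mx).

Lemma lceval_scale (V : lmodType k) (wv : seq nat -> V) c p :
  lceval w q1 wv (scale c p) = coef_eval w q1 c *: lceval w q1 wv p.
Proof.
elim: p => [|t p IH] /=; first by rewrite !lceval_nil scaler0.
by rewrite !lceval_cons IH scalerDr scalerA (coef_evalM omega_root') // q1_neq0.
Qed.

Lemma unit_mxM i j j' l : unit_mx [:: i; j] * unit_mx [:: j'; l] =
  if eqn j j' && (j <= n)%N then unit_mx [:: i; l] else 0.
Proof.
apply/matrixP => a b; rewrite !mxE.
case: ifP => [/andP[/eqnP <- hj]|h]; rewrite ?mxE.
  rewrite (bigD1 (inord j)) //= !mxE big1 ?addr0 => [|c hc].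
    by rewrite inordK // eqxx andbT -natrM mulnb.
  rewrite !mxE (_ : (c == j :> nat) = false) ?andbF ?mul0r //.
  by apply: contraNF hc => /eqP <-; rewrite inord_val.
rewrite big1 // => c _; rewrite !mxE -natrM mulnb.
case: eqP => // _; case: eqP => //= cj; case: eqP => //= cj'.
by move: h; rewrite -cj -cj' eqnE eqxx -ltnS ltn_ord.
Qed.

Lemma mev_unit_mul t p : mev (unit_mul n t p) = coef_eval w q1 t.1 *: unit_mx t.2 * mev p.
Proof.
elim: p => [|s p IH] /=; first by rewrite !lceval_nil mulr0.
rewrite lceval_cons mulrDr -{}IH -scalerAl -scalerAr scalerA.
case: t => c [|i [|j [|? ?]]] /=; rewrite ?mul0r ?scaler0 ?add0r //.
case: s => d [|j' [|l [|? ?]]] /=; rewrite ?mulr0 ?scaler0 ?add0r //.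
rewrite -/(unit_mx [:: i; j]) -/(unit_mx [:: j'; l]) unit_mxM.
case: ifP => _ /=; last by rewrite scaler0 add0r.
by rewrite lceval_cons (coef_evalM omega_root').
Qed.

Lemma mev_smul p p' : mev (smul n p p') = mev p * mev p'.
Proof.
elim: p => [|t p IH] /=; first by rewrite lceval_nil mul0r.
by rewrite lceval_add mev_unit_mul IH lceval_cons mulrDl.
Qed.

Lemma mev_one : mev [seq (cone, [:: i; i]) | i <- iota 0 n.+1] = 1.
Proof.
rewrite /lceval big_map; apply/matrixP => a b; rewrite summxE !mxE.
rewrite -[iota 0 n.+1]/(index_iota 0 n.+1) big_mkord (bigD1 a) // /fst /snd.
rewrite (cone_eval w q1) scale1r mxE eqxx big1 => [|c /negbTE hc].
  by rewrite [LHS]addr0 andTb eq_sym.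
by rewrite scale1r mxE eq_sym [c == a :> nat]hc.
Qed.

Section Representation.
Variable T : free_tensor k hv_index.
Local Notation ev := (@ev k q1 q2 T).
Local Notation wev := (word_eval ev).
Local Notation nev := (lceval w q1 wev).
Variable g : seq ncpoly.
Local Notation ms := (letter_mats n g).

Definition gen_mat (i : hv_index) : M := mev (nth [::] g (if i is Some j then
  if j == 1 then 1%N else if j == 2 then 2%N else 3%N else 0%N)).

Definition mat_rep : {linear T -> M} := ft_morph T gen_mat.

Lemma mat_rep_ker_ideal : two_sided_ideal [set x | mat_rep x = 0].
Proof.
split=> [|x y hx hy|a x b hx] /=; first exact: linear0.
  by rewrite linearD /= hx hy addr0.
by rewrite !ft_morphM hx mulr0 mul0r.
Qed.

Lemma mat_rep_ev l : (l < 10)%N -> mat_rep (ev l) = mev (nth [::] ms l).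
Proof.
have hx i : mat_rep (ax T i) = gen_mat (Some i) by exact: ft_morph_gen.
have hx4 : mat_rep (ax4 T) = gen_mat None by exact: ft_morph_gen.
have g0 : mat_rep (ax4 T) = mev (nth [::] g 0) by exact: hx4.
have g1 : mat_rep (ax T 1) = mev (nth [::] g 1) by exact: hx.
have g2 : mat_rep (ax T 2) = mev (nth [::] g 2) by exact: hx.
have g3 : mat_rep (ax T 3) = mev (nth [::] g 3) by exact: hx.
have m1 p : mev (scale (cz 1 0 1) p) = q1 *: mev p by rewrite lceval_scale coef_eval_cz.
have mN p : mev (scale (cz (-1) 0 1) p) = - (q1 *: mev p).
  by rewrite lceval_scale coef_eval_cz scaleNr.
have mw p : mev (scale (cz (-1) (-1) 0) p) = w ^+ 2 *: mev p.
  by rewrite lceval_scale coef_eval_cz (one_plus_omega omega_prim) opprK.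
have h4 i (h : 'Z_3) : mat_rep (ax T h) = mev (nth [::] g i) -> mat_rep (axh4 q1 T h) =
    mev (ncadd (smul n (nth [::] g i) (nth [::] g 0))
      (scale (cz (-1) 0 1) (smul n (nth [::] g 0) (nth [::] g i)))).
  by move=> e; rewrite /axh4 linearB linearZ /= !ft_morphM e g0 lceval_add mN !mev_smul.
have h41 := h4 _ _ g1; have h42 := h4 _ _ g2; have h43 := h4 _ _ g3.
rewrite /letter_mats; set x14 := ncadd _ _ in h41 *; set x24 := ncadd _ _ in h42 *.
set x34 := ncadd _ _ in h43 *.
have e12 : mat_rep (axij4 q1 T 1 2) = mev (ncadd (smul n (nth [::] g 1) x24)
    (scale (cz 1 0 1) (smul n x34 (nth [::] g 1)))).
  by rewrite axij4_12 linearD linearZ /= !ft_morphM g1 h42 h43 lceval_add m1 !mev_smul.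
have e13 : mat_rep (axij4 q1 T 1 3) = mev (ncadd (smul n (nth [::] g 1) x34)
    (scale (cz 1 0 1) (smul n x24 (nth [::] g 1)))).
  by rewrite axij4_13 linearD linearZ /= !ft_morphM g1 h42 h43 lceval_add m1 !mev_smul.
case: l => [|[|[|[|[|[|[|[|[|[|]]]]]]]]]] // _.
set p12 := ncadd _ _ in e12; set p13 := ncadd _ _ in e13.
rewrite -[nth _ _ _]/(ncadd (smul n p12 p13) (scale (cz (-1) (-1) 0) (smul n p13 p12))).
by rewrite [ev 5]/axz linearD linearZ /= !ft_morphM e12 e13 lceval_add mw !mev_smul.
Qed.

Lemma mat_rep_word u : all (fun l => l < 10)%N u -> mat_rep (wev u) = mev (mat_word n ms u).
Proof.
elim: u => [|l u IH]; first by rewrite word_eval_nil ft_morph1 mev_one.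
by case/andP => hl /IH e; rewrite wev_cons ft_morphM e mat_rep_ev // mev_smul.
Qed.

Lemma mat_rep_poly p : letters_ok p -> mat_rep (nev p) = mev (mat_poly n ms p).
Proof.
elim: p => [|t p IH]; first by rewrite !lceval_nil linear0.
case/andP => /mat_rep_word ht /IH e.
by rewrite lceval_cons linearD linearZ /= ht e lceval_add lceval_scale.
Qed.

Lemma is_nonzero_matP p : is_nonzero_mat n p -> mev p != 0.
Proof.
case: p => [|[c [|a [|b [|? ?]]]] p] // /and4P[hc ha hb hp].
apply/eqP => /matrixP /(_ (inord a) (inord b)) /eqP; apply/negP.
have -> : mev ((c, [:: a; b]) :: p) (inord a) (inord b) =
    coef_eval w q1 c + mev p (inord a) (inord b).
  by rewrite lceval_cons !mxE !inordK // !eqxx mulr1.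
have -> : mev p (inord a) (inord b) = 0.
  elim: p hp => [_|t p IH]; first by rewrite lceval_nil mxE.
  case/andP => /negbTE ht /IH e; rewrite lceval_cons mxE e addr0 mxE.
  case: t.2 ht => [|i [|j [|? ?]]]; rewrite /= ?mxE ?mulr0 // !inordK //.
  by rewrite !eqseq_cons andbT [i == a]eq_sym [j == b]eq_sym => ->; rewrite mulr0.
by rewrite addr0 mxE; exact: (coef_eval_neq0 omega_root').
Qed.

(** The separating ideal is the kernel of the matrix representation. *)
Lemma separatesP i : (i < 12)%N -> separates n g i ->
  exists J : set T, [/\ two_sided_ideal J,
    forall j, (j < 12)%N -> j != i -> J (nth 0 (arels q1 q2 T) j) &
    ~ J (nth 0 (arels q1 q2 T) i)].
Proof.
move=> hi /allP sep; exists [set x | mat_rep x = 0].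
have letters j : (j < 12)%N -> letters_ok (nth [::] hv_relation_polys j).
  have /allP h : all letters_ok hv_relation_polys by [].
  by move=> hj; apply: h; rewrite mem_nth.
have sep_j j : (j < 12)%N -> (if eqn j i then is_nonzero_mat n else is_nil)
    (mat_poly n ms (nth [::] hv_relation_polys j)).
  by move=> hj; apply: sep; rewrite mem_iota.
have e j : (j < 12)%N -> mat_rep (nth 0 (arels q1 q2 T) j) =
    mev (mat_poly n ms (nth [::] hv_relation_polys j)).
  by move=> hj; rewrite nev_arels // mat_rep_poly // letters.
split; first exact: mat_rep_ker_ideal.
  move=> j hj ji; apply: (etrans (e j hj)); have := sep_j j hj; rewrite eqnE (negbTE ji).
  by case: (mat_poly _ _ _) => // _; exact: lceval_nil.
move=> /(etrans (esym (e i hi))); have := sep_j i hi; rewrite eqnE eqxx.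
by move/is_nonzero_matP/eqP.
Qed.

End Representation.
End Sparse.
End Matrices.

Lemma hv_separated (k : fieldType) (q1 q2 : k) (k_char0 : [pchar k] =i pred0)
    (q1_neq0 : q1 != 0) (omega_prim : 3.-primitive_root (- (q1 * q2)))
    (T : free_tensor k hv_index) i : (i < 12)%N ->
  exists J : set T, [/\ two_sided_ideal J,
    forall j, (j < 12)%N -> j != i -> J (nth 0 (arels q1 q2 T) j) &
    ~ J (nth 0 (arels q1 q2 T) i)].
Proof.
move=> hi; have [->|i6] := eqVneq i 6.
  exact: (separatesP k_char0 q1_neq0 omega_prim T (i := 6) isT cube_separates).
have /allP/(_ i) := paths_separate; rewrite mem_iota hi eqnE (negbTE i6).
by move=> /(_ isT); exact: separatesP.
Qed.

(** * The theorem *)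

Lemma ideal_gen_ideal (A : nzRingType) (P : set A) : two_sided_ideal (ideal_gen P).
Proof.
split=> [J [] //|x y hx hy J hJ PJ|a x b hx J hJ PJ]; case: (hJ) => _ JD JM.
  by apply: JD; [exact: hx|exact: hy].
by apply: JM; exact: hx.
Qed.

Section Main.
Variables (k : fieldType) (q1 q2 : k).
Hypothesis k_char0 : [pchar k] =i pred0.
Hypothesis q1_neq0 : q1 != 0.
Hypothesis q2_neq0 : q2 != 0.
Hypothesis omega_prim : 3.-primitive_root (- (q1 * q2)).

(** An element of the radical is congruent modulo J to a combination of PBW monomials; that
    combination is then in the radical too, so its coefficients vanish and the element lies in J. *)
Lemma radical_presented (T : free_tensor k hv_index) (J : set T) :
  two_sided_ideal J -> (forall i, (i < 12)%N -> J (nth 0 (arels q1 q2 T) i)) ->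
  J `<=` radical hv_act (hv_q q1 q2) -> J = radical hv_act (hv_q q1 q2).
Proof.
move=> J_ideal J_rels JR; apply/seteqP; split=> // x Rx.
have [a ha] := pbw_spanning k_char0 q1_neq0 q2_neq0 omega_prim J_ideal J_rels x.
have Ra : radical hv_act (hv_q q1 q2) (\sum_e a e *: apbw q1 q2 T e).
  exact: (ideal_congl (hv_radical_ideal q1 q2 T) (JR _ ha)).1.
have a0 := pbw_independent k_char0 q1_neq0 q2_neq0 omega_prim Ra.
by move: ha; rewrite big1 ?subr0 // => e _; rewrite a0 scale0r.
Qed.

Local Notation T0 := (malg_free_tensor k hv_index).

Lemma hv_nichols_radical :
  hv_nichols_ideal q1 q2 = @radical k hv_index T0 hv_act (hv_q q1 q2).
Proof.
apply: nichols_radical.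
- exact: hv_act_inj.
- exact: hv_q_neq0.
- exact: hv_act_rack.
- exact: hv_q_rack.
Qed.

Lemma hv_relationsP r : hv_relations q1 q2 r <->
  exists2 i, (i < 12)%N & r = nth 0 (arels q1 q2 T0) i.
Proof.
split=> [/(nthP 0)[i hi <-]|[i hi ->]]; first by exists i.
by apply/(nthP 0); exists i.
Qed.

Lemma hv_presentation : hv_nichols_ideal q1 q2 = ideal_gen (hv_relations q1 q2).
Proof.
rewrite hv_nichols_radical; apply: esym; apply: (@radical_presented T0).
- exact: ideal_gen_ideal.
- by move=> i hi J hJ PJ; apply: PJ; apply/hv_relationsP; exists i.
move=> x hx; apply: hx; first exact: hv_radical_ideal.
by move=> r /hv_relationsP[i hi ->]; exact: arels_radical.
Qed.

Lemma hv_minimal r : hv_relations q1 q2 r ->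
  ideal_gen (hv_relations q1 q2 `\ r) `<` hv_nichols_ideal q1 q2.
Proof.
move=> hr; rewrite hv_presentation; split=> [x hx J hJ PJ|le].
  by apply: hx => // y [hy _]; exact: PJ.
have /hv_relationsP[i hi ri] := hr.
have [J [hJ J_rels J_i]] := hv_separated k_char0 q1_neq0 omega_prim T0 hi.
apply: J_i; rewrite -ri; apply: (le r) hJ _ => [J' _ PJ'|y [/hv_relationsP[j hj yj] /= ny]].
  exact: PJ'.
(* The value r is removed from the set, whereas separation works by index: as y differs from r, its
   index differs from i. *)
by rewrite yj; apply: J_rels => //; apply: contra_not_neq ny => ji; rewrite yj ri ji.
Qed.

Lemma hv_basis : is_basis (fun e : hv_pbw_index => hv_proj q1 q2 (hv_pbw q1 q2 e)).
Proof.
have projE (a : hv_pbw_index -> k) : \sum_e a e *: hv_proj q1 q2 (hv_pbw q1 q2 e) =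
    hv_proj q1 q2 (\sum_e a e *: apbw q1 q2 T0 e).
  by rewrite /hv_proj linear_sum; apply: eq_bigr => e _; rewrite linearZ.
split=> [a|b].
  rewrite projE => /nichols_projP h; apply: (pbw_independent k_char0 q1_neq0 q2_neq0 omega_prim (T := T0)).
  by rewrite -hv_nichols_radical.
have [x <-] := nichols_proj_surj b.
have [a ha] := pbw_spanning k_char0 q1_neq0 q2_neq0 omega_prim (hv_radical_ideal q1 q2 T0)
  (arels_radical k_char0 q1_neq0 q2_neq0 omega_prim T0) x.
exists a; rewrite projE; apply/eqP; rewrite -subr_eq0 -linearB; apply/eqP/nichols_projP.
by rewrite -hv_nichols_radical in ha.
Qed.
End Main.

Theorem theorem3p8 (k : closedFieldType) (chark : [pchar k] =i pred0)
    (q1 q2 : k) (q1_neq0 : q1 != 0) (q2_neq0 : q2 != 0)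
    (omega_prim : 3.-primitive_root (- (q1 * q2))) :
  [/\ hv_nichols_ideal q1 q2 = ideal_gen (hv_relations q1 q2),
      forall r, hv_relations q1 q2 r ->
        ideal_gen (hv_relations q1 q2 `\ r) `<` hv_nichols_ideal q1 q2
    & is_basis (fun e : hv_pbw_index => hv_proj q1 q2 (hv_pbw q1 q2 e))].
Proof.
split; [exact: hv_presentation|exact: hv_minimal|exact: hv_basis].
Qed.
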